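(* Let $w,v\in\mathbb{C}$ and let $R\geq1$ be an integer. As real $n\to\infty$: \begin{align*} S_n(1;v)&=\sum_{r=0}^{R-1}\frac{1}{n^r}\left(\rho_r(v)+\frac{\gamma_r(v)}{2}\sqrt{2\pi n}\right)+O\!\left(\frac{1}{n^{R-1/2}}\right),\\ S_n(w;v)&=\sum_{r=0}^{R-1}\frac{U_r(w;v)}{n^r}+O\!\left(\frac1{n^R}\right)\qquad (w\in\mathcal{X}\cup\mathcal{Y}\cup\mathcal{S}),\\ S_n(w;v)&=\sum_{r=0}^{R-1}\frac{1}{n^r}\left(U_r(w;v)+\gamma_r(v)\frac{e^{ni\varphi(w)}}{w^v}\sqrt{2\pi n}\right)+O\!\left(\frac{1}{n^{R-1/2}}\right)\qquad (w\in\mathcal{T}),\\ S_n(w;v)&=\frac{\sqrt{2\pi n}}{(we^{1-w})^n w^v}\left(\sum_{r=0}^{R-1}\frac{\gamma_r(v)}{n^r}+O\!\left(\frac1{n^R}\right)\right)\qquad(w\in\mathcal{Z}). \end{align*}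
   Context: Logarithms use the principal branch with arguments in $(-\pi,\pi]$; $w^v=e^{v\log w}$, $(nw)^{-(n+v)}=e^{-(n+v)\log n}e^{-(n+v)\log w}$, and $(we^{1-w})^n:=e^{n\log w+n(1-w)}$. For real $n>0$, $v\in\mathbb{C}$ with $\mathrm{Re}(n+v)>-1$ and $w\in\mathbb{C}$, define $S_n(w;v)=1+nw\int_0^1 e^{nw(1-z)}z^{n+v}\,dz$ (for integers $n\geq1$, $n+v\geq0$, $w\ne0$ this is the number with $e^{nw}=\sum_{j=0}^{n+v-1}\frac{(nw)^j}{j!}+\frac{(nw)^{n+v}}{(n+v)!}S_n(w;v)$). Regions: $\mathcal{X}=\{w:|we^{1-w}|>1\}$; $\mathcal{Y}=\{w:|we^{1-w}|<1,\ \mathrm{Re}(w)<1\}$; $\mathcal{Z}=\{w:|we^{1-w}|<1,\ \mathrm{Re}(w)>1\}$; $\mathcal{S}=\{w:|we^{1-w}|=1,\ \mathrm{Re}(w)<1\}$; $\mathcal{T}=\{w:|we^{1-w}|=1,\ \mathrm{Re}(w)>1\}$. For $|we^{1-w}|=1$, $\varphi(w):=\mathrm{Im}(w)-\arg(w)$ (real, with $we^{1-w}=e^{-i\varphi(w)}$). De Moivre polynomial $\mathcal{A}_{n,k}(a_1,a_2,\dots)$: coefficient of $x^n$ in $(a_1x+a_2x^2+\cdots)^k$. Double factorial $n!!$ as usual with $0!!=(-1)!!=1$; $\binom{v}{j}=v(v-1)\cdots(v-j+1)/j!$; $\delta_{r,0}$ Kronecker delta. Coefficients: $\rho_r(v)=\delta_{r,0}-\sum_{m=0}^{2r+1}(-1)^m\binom{v}{2r+1-m}\sum_{k=0}^{m}\frac{(2r+2k)!!}{(-1)^k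 k!}\mathcal{A}_{m,k}(\frac13,\frac14,\frac15,\dots)$; $\gamma_r(v)=\sum_{m=0}^{2r}(-1)^m\binom{v}{2r-m}\sum_{k=0}^{m}\frac{(2r+2k-1)!!}{(-1)^k k!}\mathcal{A}_{m,k}(\frac13,\frac14,\frac15,\dots)$; $U_r(w;v)=\delta_{r,0}-\sum_{m=0}^{r}(-1)^m\binom{v}{r-m}\sum_{k=0}^{m}\frac{w}{(w-1)^{r+k+1}}\frac{(r+k)!}{k!}\mathcal{A}_{m,k}(\frac12,\frac13,\frac14,\dots)$. *)

(* Defs.v *)
From Stdlib Require Import Reals Arith.
From Coquelicot Require Import Coquelicot.
Open Scope R_scope.

Definition Cexp (z : C) : C :=
  (exp (Re z) * cos (Im z), exp (Re z) * sin (Im z)).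

(** Principal argument, with values in (-PI, PI] (and arg 0 = 0). *)
Definition Carg (z : C) : R :=
  let x := Re z in let y := Im z in
  if Rlt_dec 0 x then atan (y / x)
  else if Rlt_dec x 0 then
         (if Rle_dec 0 y then atan (y / x) + PI else atan (y / x) - PI)
  else (if Rlt_dec 0 y then PI / 2
        else if Rlt_dec y 0 then - (PI / 2) else 0).

(** Principal logarithm  log z = ln|z| + i arg z  (only used for z <> 0). *)
Definition Clog (z : C) : C := (ln (Cmod z), Carg z).

Definition Ccpow (w v : C) : C := Cexp (v * Clog w)%C.

Definition wepow (n : R) (w : C) : C :=
  Cexp (RtoC n * Clog w + RtoC n * (1 - w))%C.

Definition Sn (n : R) (w v : C) : C :=
  (1 + RtoC n * w *
     RInt (V := C_R_CompleteNormedModule)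
       (fun z : R => Cexp (RtoC n * w * RtoC (1 - z)) * Ccpow (RtoC z) (RtoC n + v))%C
       0 1)%C.

Fixpoint Csum (f : nat -> C) (n : nat) : C :=
  match n with O => RtoC 0 | S m => (Csum f m + f m)%C end.

Definition ps_mul (f g : nat -> C) : nat -> C :=
  fun n => Csum (fun i => f i * g (n - i)%nat)%C (S n).
Definition ps_one : nat -> C := fun n => if Nat.eqb n 0 then RtoC 1 else RtoC 0.
Fixpoint ps_pow (f : nat -> C) (k : nat) : nat -> C :=
  match k with O => ps_one | S k' => ps_mul f (ps_pow f k') end.

(** De Moivre polynomial A_{n,k}(a_1,a_2,...): coefficient of x^n in
    (a_1 x + a_2 x^2 + ...)^k; here [a j] is a_j for j >= 1 (a 0 is ignored). *)
Definition deMoivre (a : nat -> C) (n k : nat) : C :=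
  ps_pow (fun j => if Nat.eqb j 0 then RtoC 0 else a j) k n.

Definition seq3 (j : nat) : C := RtoC (/ INR (j + 2)).
Definition seq2 (j : nat) : C := RtoC (/ INR (j + 1)).

Fixpoint dfact (n : nat) : nat :=
  match n with O => 1%nat | S O => 1%nat | S (S m as p) => (S p * dfact m)%nat end.

Fixpoint falling (v : C) (j : nat) : C :=
  match j with O => RtoC 1 | S i => (falling v i * (v - RtoC (INR i)))%C end.
Definition Cbinom (v : C) (j : nat) : C := (falling v j / RtoC (INR (fact j)))%C.

Definition kdelta (r : nat) : C := if Nat.eqb r 0 then RtoC 1 else RtoC 0.
Definition msign (m : nat) : C := (RtoC (-1)) ^ m.

Definition rho (r : nat) (v : C) : C :=
  (kdelta r -
   Csum (fun m =>
     msign m * Cbinom v (2 * r + 1 - m) *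
     Csum (fun k => RtoC (INR (dfact (2 * r + 2 * k))) / (msign k * RtoC (INR (fact k)))
                    * deMoivre seq3 m k) (S m))
     (S (2 * r + 1)))%C.

(** gamma_r(v); note (2r+2k-1)!! with truncated subtraction gives 0!! = 1 = (-1)!!
    when r = k = 0. *)
Definition gam (r : nat) (v : C) : C :=
  (Csum (fun m =>
    msign m * Cbinom v (2 * r - m) *
    Csum (fun k => RtoC (INR (dfact (2 * r + 2 * k - 1))) / (msign k * RtoC (INR (fact k)))
                   * deMoivre seq3 m k) (S m))
    (S (2 * r)))%C.

Definition Ucoef (r : nat) (w v : C) : C :=
  (kdelta r -
   Csum (fun m =>
     msign m * Cbinom v (r - m) *
     Csum (fun k => w / ((w - 1) ^ (r + k + 1)) *
                    (RtoC (INR (fact (r + k))) / RtoC (INR (fact k)))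
                    * deMoivre seq2 m k) (S m))
     (S r))%C.

Definition modwe (w : C) : R := Cmod (w * Cexp (1 - w))%C.

Definition regX (w : C) : Prop := modwe w > 1.
Definition regY (w : C) : Prop := modwe w < 1 /\ Re w < 1.
Definition regZ (w : C) : Prop := modwe w < 1 /\ Re w > 1.
Definition regS (w : C) : Prop := modwe w = 1 /\ Re w < 1.
Definition regT (w : C) : Prop := modwe w = 1 /\ Re w > 1.

Definition phi (w : C) : R := Im w - Carg w.

Definition sq2pin (n : R) : C := RtoC (sqrt (2 * PI * n)).

(* Main.v *)
Require Import Defs.
From Stdlib Require Import Reals Arith Lra Lia.
From Coquelicot Require Import Coquelicot.
Open Scope R_scope.

(** On [Re u > 0], [u^(n+v) e^(-nu)] has the primitive [F u = int_0^u x^(n+v) e^(-nx) dx], and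
    [S_n(w;v) = 1 + n e^(nw) w^(-n-v) F w].  When [Re w < 1], the integral defining [S_n] is
    dominated by its endpoint [z = 1].  When [Re w >= 1] and [w <> 1], [F w] is reached by going
    from [0] along the real axis across the saddle [u = 1] to [Re w + del], then up to [w + del]
    (exponentially negligible), then back to [w].  The real axis contributes the series in the
    [gamma_r] with weight [(w e^(1-w))^(-n) w^(-v)], and the last piece is an endpoint contribution,
    which gives the [U_r]; the size of [w e^(1-w)] decides which of the two survives.  At [w = 1]
    only the left half of the saddle is seen, so its odd-order terms [rho_r] do not cancel.  The
    integrand near an endpoint or a saddle is [exp (- a y^mu)], with [mu = 1] or [2], times the
    exponential of a tail of the series of [- log (1 - z)] times a power of [1 - z]: both kinds of
    contribution are instances of one Watson lemma. *)

Local Notation is_derive_C := (is_derive (K := R_AbsRing) (V := C_R_NormedModule)).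
Local Notation is_RInt_C := (is_RInt (V := C_R_NormedModule)).
Local Notation ex_RInt_C := (ex_RInt (V := C_R_NormedModule)).
Local Notation RInt_C := (RInt (V := C_R_CompleteNormedModule)).

Local Notation infty := (Rbar_locally p_infty).
Local Notation near_0 := (locally' (T := C_UniformSpace) (RtoC 0)).

(** * Complex numbers and the complex exponential *)

Lemma RtoC_neq_0 (x : R) : x <> 0 -> RtoC x <> 0%C.
Proof. intros Hx E. apply Hx, RtoC_inj, E. Qed.

Lemma Re_pos_neq_0 (z : C) : 0 < Re z -> z <> 0%C.
Proof. intros Hz ->. simpl in Hz. lra. Qed.

Lemma Cmod_RtoC_nonneg (x : R) : 0 <= x -> Cmod (RtoC x) = x.
Proof. intros Hx. rewrite Cmod_R. now apply Rabs_pos_eq. Qed.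

Lemma Re_le_Cmod (z : C) : Re z <= Cmod z.
Proof. apply Rle_trans with (1 := Rle_abs _), re_le_Cmod. Qed.

Lemma exp_le_compat (x y : R) : x <= y -> exp x <= exp y.
Proof. intros [Hlt | ->]; [left; now apply exp_increasing | apply Rle_refl]. Qed.

Lemma Cexp_plus (x y : C) : Cexp (x + y) = (Cexp x * Cexp y)%C.
Proof.
  unfold Cexp. rewrite re_plus, im_plus, exp_plus, cos_plus, sin_plus.
  apply injective_projections; simpl; ring.
Qed.

Lemma Cexp_RtoC (x : R) : Cexp (RtoC x) = RtoC (exp x).
Proof.
  unfold Cexp. rewrite re_RtoC, im_RtoC, cos_0, sin_0.
  apply injective_projections; simpl; ring.
Qed.

Lemma Cexp_0 : Cexp 0 = 1%C.
Proof. now rewrite Cexp_RtoC, exp_0. Qed.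

Lemma Cexp_neq_0 (z : C) : Cexp z <> 0%C.
Proof.
  intros E. apply C1_nz. rewrite <- Cexp_0, <- (Cplus_opp_r z), Cexp_plus, E. ring.
Qed.

Lemma Cexp_opp (z : C) : Cexp (- z) = (/ Cexp z)%C.
Proof.
  assert (Hz := Cexp_neq_0 z).
  transitivity (Cexp z * Cexp (- z) / Cexp z)%C; [now field | ].
  rewrite <- Cexp_plus, Cplus_opp_r, Cexp_0. now field.
Qed.

Lemma Cmod_Cexp (z : C) : Cmod (Cexp z) = exp (Re z).
Proof.
  apply Rsqr_inj; [apply Cmod_ge_0 | left; apply exp_pos | ].
  rewrite !Rsqr_pow2, Cmod2_alt. simpl.
  transitivity (exp (Re z) ^ 2 * (Rsqr (sin (Im z)) + Rsqr (cos (Im z)))).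
  - unfold Rsqr. ring.
  - rewrite sin2_cos2. ring.
Qed.

Lemma Cmod_Cexp_le (z : C) : Cmod (Cexp z) <= exp (Cmod z).
Proof. rewrite Cmod_Cexp. apply exp_le_compat, Re_le_Cmod. Qed.

(** * Functions of a real variable with complex values *)

Lemma locally_C_iff (z0 : C) (P : C -> Prop) :
  locally z0 P <-> exists r, 0 < r /\ forall z, Cmod (z - z0)%C < r -> P z.
Proof.
  split.
  - intros [eps HP]. exists eps. split; [apply cond_pos | ]. intros z Hz.
    now apply HP, C_NormedModule_mixin_compat1.
  - intros [r [Hr HP]]. assert (Hr2 : 0 < r / 2) by lra.
    exists (mkposreal _ Hr2). intros z Hz. apply HP.
    apply C_NormedModule_mixin_compat2 in Hz. change (Cmod (z - z0)%C < sqrt 2 * (r / 2)) in Hz.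
    assert (Hsqrt : sqrt 2 <= 2).
    { rewrite <- (sqrt_square 2) at 2 by lra. apply sqrt_le_1_alt. lra. }
    nra.
Qed.

Lemma continuous_C_Cmod (f : R -> C) (x : R) :
  continuous f x <-> forall eps : posreal, locally x (fun y => Cmod (f y - f x)%C < eps).
Proof.
  split.
  - intros Hf eps.
    apply (Hf (fun z => Cmod (z - f x)%C < eps)), locally_C_iff.
    exists eps. split; [apply cond_pos | auto].
  - intros Hf P HP. apply locally_C_iff in HP. destruct HP as [r [Hr HP]].
    unfold filtermap. generalize (Hf (mkposreal r Hr)). apply filter_imp. intros y. apply HP.
Qed.

Lemma is_derive_C_of_o (f : R -> C) (x : R) (l : C) :
  (forall eps : posreal,
     locally x (fun y => Cmod (f y - f x - RtoC (y - x) * l)%C <= eps * Rabs (y - x))) ->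
  is_derive_C f x l.
Proof.
  intros H. split; [apply (is_linear_scal_l (V := C_R_NormedModule)) | ].
  intros x' Hx' eps.
  apply (is_filter_lim_locally_unique (V := AbsRing_NormedModule R_AbsRing)) in Hx'. subst x'.
  generalize (H eps). apply filter_imp. intros y Hy.
  rewrite scal_R_Cmult, <- Cmod_norm. exact Hy.
Qed.

Lemma is_derive_C_of_quadratic (f : R -> C) (x : R) (l : C) (K : R) :
  (forall h, Rabs h <= 1 -> Cmod (f (x + h)%R - f x - RtoC h * l)%C <= K * h ^ 2) ->
  is_derive_C f x l.
Proof.
  intros H. apply is_derive_C_of_o. intros eps. assert (Heps := cond_pos eps).
  assert (HK := Rabs_pos K). assert (HK2 := Rle_abs K).
  assert (Hd : 0 < Rmin 1 (eps / (Rabs K + 1))).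
  { apply Rmin_pos; [lra | apply Rdiv_lt_0_compat; lra]. }
  exists (mkposreal _ Hd). intros y Hy. change (Rabs (y - x) < Rmin 1 (eps / (Rabs K + 1))) in Hy.
  assert (H1 := Rmin_l 1 (eps / (Rabs K + 1))). assert (H2 := Rmin_r 1 (eps / (Rabs K + 1))).
  specialize (H (y - x) ltac:(lra)). rewrite Rplus_minus in H.
  apply Rle_trans with (1 := H). rewrite <- Rsqr_pow2, Rsqr_abs. unfold Rsqr.
  assert (H0 := Rabs_pos (y - x)).
  assert (H3 : (Rabs K + 1) * Rabs (y - x) <= eps).
  { apply Rle_trans with ((Rabs K + 1) * (eps / (Rabs K + 1))); [ | right; field; lra].
    apply Rmult_le_compat_l; lra. }
  nra.
Qed.

Lemma is_derive_C_iff (f : R -> C) (x : R) (l : C) :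
  is_derive_C f x l <->
  is_derive (fun t => Re (f t)) x (Re l) /\ is_derive (fun t => Im (f t)) x (Im l).
Proof.
  split.
  - intros Hf. split.
    + apply (filterdiff_comp (W := R_NormedModule) f fst (fun y => scal y l) fst Hf).
      apply filterdiff_linear, (is_linear_fst (U := R_NormedModule) (V := R_NormedModule)).
    + apply (filterdiff_comp (W := R_NormedModule) f snd (fun y => scal y l) snd Hf).
      apply filterdiff_linear, (is_linear_snd (U := R_NormedModule) (V := R_NormedModule)).
  - intros [HRe HIm].
    apply (is_derive_scal_l (V := C_R_NormedModule)) with (k := RtoC 1) in HRe.
    apply (is_derive_scal_l (V := C_R_NormedModule)) with (k := Ci) in HIm.
    assert (H := is_derive_plus _ _ _ _ _ HRe HIm).
    assert (decompose : forall z : C,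
      plus (scal (Re z) (RtoC 1 : C_R_NormedModule)) (scal (Im z) (Ci : C_R_NormedModule)) = z).
    { intros z. rewrite !scal_R_Cmult.
      apply injective_projections; simpl; unfold Re, Im, plus; simpl; ring. }
    rewrite decompose in H.
    apply is_derive_ext with (2 := H). intros t. apply decompose.
Qed.

Lemma continuous_C_iff {T : UniformSpace} (f : T -> C) (x : T) :
  continuous f x <-> continuous (fun t => Re (f t)) x /\ continuous (fun t => Im (f t)) x.
Proof.
  split.
  - intros Hf. split.
    + apply (continuous_comp f fst);
        [exact Hf | rewrite (surjective_pairing (f x)); apply continuous_fst].
    + apply (continuous_comp f snd);
        [exact Hf | rewrite (surjective_pairing (f x)); apply continuous_snd].
  - intros [HRe HIm].
    apply (continuous_ext (fun t => (Re (f t), Im (f t)))).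
    { intros t. symmetry. apply surjective_pairing. }
    apply (filterlim_filter_le_2 (G := filter_prod (locally (Re (f x))) (locally (Im (f x))))).
    2: now apply filterlim_pair.
    intros P [eps HP]. exists (ball (Re (f x)) eps) (ball (Im (f x)) eps).
    + apply locally_ball.
    + apply locally_ball.
    + intros u v Hu Hv. apply HP. now split.
Qed.

Lemma is_RInt_C_iff (f : R -> C) (a b : R) (l : C) :
  is_RInt_C f a b l <->
  is_RInt (fun t => Re (f t)) a b (Re l) /\ is_RInt (fun t => Im (f t)) a b (Im l).
Proof.
  split.
  - intros Hf. split.
    + apply (is_RInt_fct_extend_fst (U := R_NormedModule) (V := R_NormedModule) f _ _ _ Hf).
    + apply (is_RInt_fct_extend_snd (U := R_NormedModule) (V := R_NormedModule) f _ _ _ Hf).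
  - intros [HRe HIm]. rewrite (surjective_pairing l).
    now apply (is_RInt_fct_extend_pair (U := R_NormedModule) (V := R_NormedModule)).
Qed.

Lemma is_derive_Cplus (f g : R -> C) (x : R) (l m : C) :
  is_derive_C f x l -> is_derive_C g x m -> is_derive_C (fun t => f t + g t)%C x (l + m)%C.
Proof. apply (is_derive_plus (V := C_R_NormedModule)). Qed.

Lemma is_derive_Cminus (f g : R -> C) (x : R) (l m : C) :
  is_derive_C f x l -> is_derive_C g x m -> is_derive_C (fun t => f t - g t)%C x (l - m)%C.
Proof. apply (is_derive_minus (V := C_R_NormedModule)). Qed.

Lemma is_derive_Cmult (f g : R -> C) (x : R) (l m : C) :
  is_derive_C f x l -> is_derive_C g x m ->
  is_derive_C (fun t => f t * g t)%C x (l * g x + f x * m)%C.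
Proof.
  intros [f1 f2]%is_derive_C_iff [g1 g2]%is_derive_C_iff. apply is_derive_C_iff. split.
  - evar_last.
    + apply (is_derive_minus (V := R_NormedModule) (fun t => Re (f t) * Re (g t))).
      * exact (is_derive_mult _ _ _ _ _ f1 g1 Rmult_comm).
      * exact (is_derive_mult _ _ _ _ _ f2 g2 Rmult_comm).
    + unfold minus, plus, opp, mult; simpl. unfold Re, Im; ring.
  - evar_last.
    + apply (is_derive_plus (V := R_NormedModule) (fun t => Re (f t) * Im (g t))).
      * exact (is_derive_mult _ _ _ _ _ f1 g2 Rmult_comm).
      * exact (is_derive_mult _ _ _ _ _ f2 g1 Rmult_comm).
    + unfold plus, mult; simpl. unfold Re, Im; ring.
Qed.

Lemma is_derive_C_const (c : C) (x : R) : is_derive_C (fun _ => c) x (RtoC 0).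
Proof. apply (is_derive_const (V := C_R_NormedModule)). Qed.

Lemma is_derive_Cmult_l (c : C) (f : R -> C) (x : R) (l : C) :
  is_derive_C f x l -> is_derive_C (fun t => c * f t)%C x (c * l)%C.
Proof.
  intros Hf. evar_last.
  - apply is_derive_Cmult; [apply is_derive_C_const | exact Hf].
  - simpl. ring.
Qed.

Lemma is_derive_RtoC (f : R -> R) (x l : R) :
  is_derive f x l -> is_derive_C (fun t => RtoC (f t)) x (RtoC l).
Proof.
  intros Hf. apply is_derive_C_iff. split; [exact Hf | ].
  exact (is_derive_const (V := R_NormedModule) 0 x).
Qed.

Lemma is_derive_affine (p q : C) (x : R) : is_derive_C (fun t => p + RtoC t * q)%C x q.
Proof.
  evar_last.
  - apply is_derive_Cplus; [apply is_derive_C_const | apply is_derive_Cmult].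
    + apply (is_derive_RtoC (fun t => t) x 1), (is_derive_id (K := R_AbsRing)).
    + apply is_derive_C_const.
  - simpl. ring.
Qed.

Lemma is_derive_dilation (q : C) (x : R) : is_derive_C (fun t => RtoC t * q)%C x q.
Proof.
  apply is_derive_ext with (2 := is_derive_affine 0 q x). intros t. simpl. ring.
Qed.

Lemma is_derive_Cpow (f : R -> C) (x : R) (l : C) (n : nat) :
  is_derive_C f x l ->
  is_derive_C (fun t => f t ^ S n)%C x (RtoC (INR (S n)) * f x ^ n * l)%C.
Proof.
  intros Hf. induction n as [ | n IHn].
  - evar_last.
    + apply is_derive_ext with (2 := Hf). intros t. simpl. ring.
    + simpl. ring.
  - evar_last.
    + exact (is_derive_Cmult _ _ _ _ _ Hf IHn).
    + rewrite (S_INR (S n)), RtoC_plus, !Cpow_S. ring.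
Qed.

Lemma is_derive_monomial (j : nat) (s : R) :
  is_derive_C (fun x => RtoC x ^ j)%C s (RtoC (INR j) * RtoC s ^ pred j)%C.
Proof.
  destruct j as [ | j].
  - replace (RtoC (INR 0) * RtoC s ^ pred 0)%C with (RtoC 0) by (simpl; ring).
    apply (is_derive_C_const 1).
  - evar_last.
    + apply is_derive_Cpow, (is_derive_RtoC (fun x => x) s 1), (is_derive_id (K := R_AbsRing)).
    + apply Cmult_1_r.
Qed.

Lemma is_derive_Csum (f : nat -> R -> C) (l : nat -> C) (x : R) (n : nat) :
  (forall i, (i < n)%nat -> is_derive_C (f i) x (l i)) ->
  is_derive_C (fun t => Csum (fun i => f i t) n) x (Csum l n).
Proof.
  induction n as [ | n IHn]; intros Hf; simpl.
  - apply is_derive_C_const.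
  - apply is_derive_Cplus; auto.
Qed.

Lemma is_derive_Cexp (f : R -> C) (x : R) (l : C) :
  is_derive_C f x l -> is_derive_C (fun t => Cexp (f t)) x (l * Cexp (f x))%C.
Proof.
  intros [f1 f2]%is_derive_C_iff. apply is_derive_C_iff. simpl.
  assert (He := is_derive_comp exp _ _ _ _ (is_derive_exp _) f1).
  assert (Hc := is_derive_comp cos _ _ _ _ (is_derive_cos _) f2).
  assert (Hs := is_derive_comp sin _ _ _ _ (is_derive_sin _) f2).
  split.
  - evar_last; [exact (is_derive_mult _ _ _ _ _ He Hc Rmult_comm) | ].
    unfold plus, scal, mult; simpl. unfold mult; simpl. unfold Re, Im; ring.
  - evar_last; [exact (is_derive_mult _ _ _ _ _ He Hs Rmult_comm) | ].
    unfold plus, scal, mult; simpl. unfold mult; simpl. unfold Re, Im; ring.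
Qed.

Lemma continuous_is_derive_C (f : R -> C) (x : R) (l : C) : is_derive_C f x l -> continuous f x.
Proof.
  intros Hf. apply (ex_derive_continuous (K := R_AbsRing) (V := C_R_NormedModule)). now exists l.
Qed.

Lemma continuous_Cmult {T : UniformSpace} (f g : T -> C) (x : T) :
  continuous f x -> continuous g x -> continuous (fun t => f t * g t)%C x.
Proof.
  intros [f1 f2]%continuous_C_iff [g1 g2]%continuous_C_iff. apply continuous_C_iff. split.
  - apply (continuous_minus (V := R_NormedModule) (fun t => Re (f t) * Re (g t))).
    + exact (continuous_mult (K := R_AbsRing) _ _ _ f1 g1).
    + exact (continuous_mult (K := R_AbsRing) _ _ _ f2 g2).
  - apply (continuous_plus (V := R_NormedModule) (fun t => Re (f t) * Im (g t))).
    + exact (continuous_mult (K := R_AbsRing) _ _ _ f1 g2).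
    + exact (continuous_mult (K := R_AbsRing) _ _ _ f2 g1).
Qed.

Lemma continuous_Cmult_l {T : UniformSpace} (c : C) (f : T -> C) (x : T) :
  continuous f x -> continuous (fun t => c * f t)%C x.
Proof. intros Hf. apply continuous_Cmult; [apply continuous_const | exact Hf]. Qed.

(* The phase of [F b - F a] turns the claim into the real mean value theorem. *)
Lemma mean_value_inequality (F f : R -> C) (a b M : R) :
  a <= b -> (forall x, a <= x <= b -> is_derive_C F x (f x)) ->
  (forall x, a <= x <= b -> Cmod (f x) <= M) ->
  Cmod (F b - F a)%C <= M * (b - a).
Proof.
  intros Hab HF HM. set (D := (F b - F a)%C).
  destruct (Req_dec (Cmod D) 0) as [HD | HD].
  { rewrite HD. apply Rmult_le_pos; [ | lra].
    apply Rle_trans with (2 := HM a ltac:(lra)), Cmod_ge_0. }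
  assert (HD0 : RtoC (Cmod D) <> 0%C) by now apply RtoC_neq_0.
  set (u := (Cconj D / RtoC (Cmod D))%C).
  assert (Hu : Cmod u = 1).
  { unfold u. rewrite Cmod_div, Cmod_conj, Cmod_RtoC_nonneg by (auto; apply Cmod_ge_0). now field. }
  assert (HuD : (u * F b - u * F a)%C = RtoC (Cmod D)).
  { transitivity (D * Cconj D / RtoC (Cmod D))%C; [unfold u, D; now field | ].
    rewrite <- Cmod2_conj, RtoC_pow. now field. }
  assert (Hder : forall x, a <= x <= b -> is_derive (fun t => Re (u * F t)%C) x (Re (u * f x)%C)).
  { intros x Hx. apply is_derive_C_iff, is_derive_Cmult_l. now apply HF. }
  destruct (MVT_gen (fun t => Re (u * F t)%C) a b (fun t => Re (u * f t)%C)) as [c [Hc E]].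
  - rewrite Rmin_left, Rmax_right by exact Hab. intros x Hx. apply Hder. lra.
  - rewrite Rmin_left, Rmax_right by exact Hab. intros x Hx. apply continuity_pt_filterlim.
    apply (ex_derive_continuous (K := R_AbsRing) (V := R_NormedModule)).
    eexists. now apply Hder.
  - rewrite Rmin_left, Rmax_right in Hc by exact Hab.
    apply (f_equal Re) in HuD. unfold Cminus in HuD. rewrite re_plus, re_opp, re_RtoC in HuD.
    rewrite <- HuD. unfold Rminus in E at 1. rewrite E.
    apply Rmult_le_compat_r; [lra | ].
    apply Rle_trans with (1 := Re_le_Cmod _). rewrite Cmod_mult, Hu, Rmult_1_l. now apply HM.
Qed.

Lemma RInt_C_unique (f : R -> C) (a b : R) (l : C) : is_RInt_C f a b l -> RInt_C f a b = l.
Proof. apply (is_RInt_unique (V := C_R_CompleteNormedModule)). Qed.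

Lemma is_RInt_C_RInt (f : R -> C) (a b : R) :
  ex_RInt_C f a b -> is_RInt_C f a b (RInt_C f a b).
Proof. apply (RInt_correct (V := C_R_CompleteNormedModule)). Qed.

Lemma is_RInt_C_unique (f : R -> C) (a b : R) (l m : C) :
  is_RInt_C f a b l -> is_RInt_C f a b m -> l = m.
Proof. intros Hl Hm. rewrite <- (RInt_C_unique _ _ _ _ Hl). now apply RInt_C_unique. Qed.

Lemma is_RInt_RtoC (f : R -> R) (a b l : R) :
  is_RInt f a b l -> is_RInt_C (fun t => RtoC (f t)) a b (RtoC l).
Proof.
  intros Hf. apply is_RInt_C_iff. split; [exact Hf | ].
  replace (Im (RtoC l)) with (scal (b - a) 0);
    [exact (is_RInt_const (V := R_NormedModule) a b 0) | ].
  apply Rmult_0_r.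
Qed.

Lemma is_RInt_Cmult_l (c : C) (f : R -> C) (a b : R) (l : C) :
  is_RInt_C f a b l -> is_RInt_C (fun t => c * f t)%C a b (c * l)%C.
Proof.
  intros [f1 f2]%is_RInt_C_iff. apply is_RInt_C_iff. split.
  - apply (is_RInt_minus (V := R_NormedModule) (fun t => Re c * Re (f t))).
    + exact (is_RInt_scal (V := R_NormedModule) _ _ _ (Re c) _ f1).
    + exact (is_RInt_scal (V := R_NormedModule) _ _ _ (Im c) _ f2).
  - apply (is_RInt_plus (V := R_NormedModule) (fun t => Re c * Im (f t))).
    + exact (is_RInt_scal (V := R_NormedModule) _ _ _ (Re c) _ f2).
    + exact (is_RInt_scal (V := R_NormedModule) _ _ _ (Im c) _ f1).
Qed.

Lemma RInt_Cmult_l (c : C) (f : R -> C) (a b : R) :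
  ex_RInt_C f a b -> RInt_C (fun t => c * f t)%C a b = (c * RInt_C f a b)%C.
Proof.
  intros Hf. apply is_RInt_unique, is_RInt_Cmult_l, is_RInt_C_RInt, Hf.
Qed.

Lemma is_RInt_Cminus (f g : R -> C) (a b : R) (l m : C) :
  is_RInt_C f a b l -> is_RInt_C g a b m -> is_RInt_C (fun t => f t - g t)%C a b (l - m)%C.
Proof. apply (is_RInt_minus (V := C_R_NormedModule)). Qed.

Lemma is_RInt_Csum (f : nat -> R -> C) (l : nat -> C) (a b : R) (n : nat) :
  (forall i, (i < n)%nat -> is_RInt_C (f i) a b (l i)) ->
  is_RInt_C (fun t => Csum (fun i => f i t) n) a b (Csum l n).
Proof.
  induction n as [ | n IHn]; intros Hf; simpl.
  - evar_last; [apply (is_RInt_const (V := C_R_NormedModule)) | ].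
    rewrite scal_R_Cmult. apply Cmult_0_r.
  - apply (is_RInt_plus (V := C_R_NormedModule) (fun t => Csum (fun i => f i t) n)); auto.
Qed.

Lemma ex_RInt_C_continuous (f : R -> C) (a b : R) :
  a <= b -> (forall x, a <= x <= b -> continuous f x) -> ex_RInt_C f a b.
Proof.
  intros Hab Hf. apply (ex_RInt_continuous (V := C_R_CompleteNormedModule)).
  now rewrite Rmin_left, Rmax_right.
Qed.

Lemma is_RInt_C_derive (F f : R -> C) (a b : R) :
  a <= b -> (forall x, a <= x <= b -> is_derive_C F x (f x)) ->
  (forall x, a <= x <= b -> continuous f x) -> is_RInt_C f a b (F b - F a)%C.
Proof.
  intros Hab HF Hf. apply (is_RInt_derive (V := C_R_CompleteNormedModule));
    now rewrite Rmin_left, Rmax_right.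
Qed.

Lemma RInt_C_ext (f g : R -> C) (a b : R) :
  a <= b -> (forall x, a < x < b -> f x = g x) -> RInt_C f a b = RInt_C g a b.
Proof.
  intros Hab Hfg. apply (RInt_ext (V := C_R_CompleteNormedModule)).
  now rewrite Rmin_left, Rmax_right.
Qed.

Lemma RInt_C_Chasles (f : R -> C) (a b c : R) :
  ex_RInt_C f a b -> ex_RInt_C f b c -> RInt_C f a c = (RInt_C f a b + RInt_C f b c)%C.
Proof. intros Hab Hbc. symmetry. now apply (RInt_Chasles (V := C_R_CompleteNormedModule)). Qed.

Lemma Cmod_is_RInt_le (f : R -> C) (g : R -> R) (a b : R) (l : C) (m : R) :
  a <= b -> (forall x, a < x < b -> Cmod (f x) <= g x) ->
  is_RInt_C f a b l -> is_RInt g a b m -> Cmod l <= m.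
Proof.
  intros Hab Hfg Hf Hg.
  set (f0 := fun x => if Rle_dec x a then RtoC 0 else if Rle_dec b x then RtoC 0 else f x).
  set (g0 := fun x => if Rle_dec x a then 0 else if Rle_dec b x then 0 else g x).
  rewrite Cmod_norm. apply (norm_RInt_le (V := C_R_NormedModule) f0 g0 a b); auto.
  - intros x _. rewrite <- Cmod_norm. unfold f0, g0.
    destruct (Rle_dec x a); [rewrite Cmod_0; lra | ].
    destruct (Rle_dec b x); [rewrite Cmod_0; lra | ]. apply Hfg. lra.
  - apply is_RInt_ext with (2 := Hf). rewrite Rmin_left, Rmax_right by exact Hab.
    intros x Hx. unfold f0.
    destruct (Rle_dec x a); [lra | ]. destruct (Rle_dec b x); [lra | reflexivity].
  - apply is_RInt_ext with (2 := Hg). rewrite Rmin_left, Rmax_right by exact Hab.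
    intros x Hx. unfold g0.
    destruct (Rle_dec x a); [lra | ]. destruct (Rle_dec b x); [lra | reflexivity].
Qed.

Lemma Cmod_is_RInt_le_const (f : R -> C) (a b : R) (l : C) (M : R) :
  a <= b -> (forall x, a < x < b -> Cmod (f x) <= M) -> is_RInt_C f a b l ->
  Cmod l <= M * (b - a).
Proof.
  intros Hab HM Hf. apply (Cmod_is_RInt_le f (fun _ => M) a b); auto.
  rewrite Rmult_comm. apply (is_RInt_const (V := R_NormedModule)).
Qed.

(** * Finite sums *)

Lemma Csum_ext (f g : nat -> C) (n : nat) :
  (forall i, (i < n)%nat -> f i = g i) -> Csum f n = Csum g n.
Proof. induction n as [ | n IHn]; intros H; simpl; [ | rewrite IHn, H]; auto. Qed.

Lemma Csum_plus (f g : nat -> C) (n : nat) :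
  Csum (fun i => f i + g i)%C n = (Csum f n + Csum g n)%C.
Proof. induction n as [ | n IHn]; simpl; [ | rewrite IHn]; ring. Qed.

Lemma Csum_minus (f g : nat -> C) (n : nat) :
  Csum (fun i => f i - g i)%C n = (Csum f n - Csum g n)%C.
Proof. induction n as [ | n IHn]; simpl; [ | rewrite IHn]; ring. Qed.

Lemma Csum_mult_l (c : C) (f : nat -> C) (n : nat) :
  Csum (fun i => c * f i)%C n = (c * Csum f n)%C.
Proof. induction n as [ | n IHn]; simpl; [ | rewrite IHn]; ring. Qed.

Lemma Csum_0 (f : nat -> C) (n : nat) :
  (forall i, (i < n)%nat -> f i = 0%C) -> Csum f n = 0%C.
Proof.
  induction n as [ | n IHn]; intros H; simpl; [reflexivity | ]. rewrite IHn, H by auto. ring.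
Qed.

Lemma Csum_exchange (f : nat -> nat -> C) (n m : nat) :
  Csum (fun i => Csum (fun j => f i j) m) n = Csum (fun j => Csum (fun i => f i j) n) m.
Proof.
  induction n as [ | n IHn]; simpl.
  - symmetry. now apply Csum_0.
  - now rewrite IHn, <- Csum_plus.
Qed.

Lemma Csum_add (f : nat -> C) (n m : nat) :
  Csum f (n + m) = (Csum f n + Csum (fun i => f (n + i)%nat) m)%C.
Proof.
  induction m as [ | m IHm];
    [rewrite Nat.add_0_r | rewrite Nat.add_succ_r]; simpl; [ | rewrite IHm]; ring.
Qed.

Lemma Csum_S_l (f : nat -> C) (n : nat) :
  Csum f (S n) = (f 0%nat + Csum (fun i => f (S i)) n)%C.
Proof. change (S n) with (1 + n)%nat at 1. rewrite Csum_add. simpl. ring. Qed.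

Lemma Csum_trailing_0 (f : nat -> C) (n m : nat) :
  (n <= m)%nat -> (forall i, (n <= i < m)%nat -> f i = 0%C) -> Csum f m = Csum f n.
Proof.
  intros Hnm Hf. replace m with (n + (m - n))%nat by lia.
  rewrite Csum_add, (Csum_0 (fun i => f (n + i)%nat)); [ring | ].
  intros i Hi. apply Hf. lia.
Qed.

Lemma Csum_pairs (f : nat -> C) (n : nat) :
  Csum f (2 * n) = Csum (fun r => f (2 * r)%nat + f (2 * r + 1)%nat)%C n.
Proof.
  induction n as [ | n IHn]; [reflexivity | ].
  replace (2 * S n)%nat with (2 * n + 2)%nat by lia.
  rewrite Csum_add, IHn. simpl Csum. rewrite Nat.add_0_r. ring.
Qed.

Lemma Cmod_Csum_le (f : nat -> C) (B : R) (n : nat) :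
  (forall i, (i < n)%nat -> Cmod (f i) <= B) -> Cmod (Csum f n) <= INR n * B.
Proof.
  induction n as [ | n IHn]; intros Hf.
  - simpl. rewrite Cmod_0. lra.
  - rewrite S_INR. simpl Csum. apply Rle_trans with (1 := Cmod_triangle _ _).
    assert (Cmod (Csum f n) <= INR n * B) by auto.
    assert (Cmod (f n) <= B) by auto. lra.
Qed.

(** * Landau's O *)

Definition is_O {T : Type} (F : (T -> Prop) -> Prop) (f : T -> C) (g : T -> R) : Prop :=
  exists K, 0 <= K /\ F (fun x => Cmod (f x) <= K * g x).

Section LandauO.

Context {T : Type} {F : (T -> Prop) -> Prop} {FF : Filter F}.

Lemma is_O_of_le (f : T -> C) (g : T -> R) : F (fun x => Cmod (f x) <= g x) -> is_O F f g.
Proof.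
  intros H. exists 1. split; [lra | ]. apply filter_imp with (2 := H). intros x Hx. lra.
Qed.

Lemma is_O_ext (f1 f2 : T -> C) (g : T -> R) :
  F (fun x => f1 x = f2 x) -> is_O F f1 g -> is_O F f2 g.
Proof.
  intros E [K [HK H]]. exists K. split; [exact HK | ].
  generalize (filter_and _ _ E H). apply filter_imp. now intros x [<- Hx].
Qed.

Lemma is_O_weaken (c : R) (f : T -> C) (g h : T -> R) :
  0 <= c -> F (fun x => g x <= c * h x) -> is_O F f g -> is_O F f h.
Proof.
  intros Hc Hgh [K [HK H]]. exists (K * c). split; [now apply Rmult_le_pos | ].
  generalize (filter_and _ _ Hgh H). apply filter_imp. intros x [Hx1 Hx2].
  rewrite Rmult_assoc. apply Rle_trans with (1 := Hx2). now apply Rmult_le_compat_l.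
Qed.

Lemma is_O_plus (f1 f2 : T -> C) (g : T -> R) :
  is_O F f1 g -> is_O F f2 g -> is_O F (fun x => f1 x + f2 x)%C g.
Proof.
  intros [K1 [HK1 H1]] [K2 [HK2 H2]]. exists (K1 + K2). split; [lra | ].
  generalize (filter_and _ _ H1 H2). apply filter_imp. intros x [Hx1 Hx2].
  apply Rle_trans with (1 := Cmod_triangle _ _). lra.
Qed.

Lemma is_O_mult (f1 f2 : T -> C) (g1 g2 : T -> R) :
  is_O F f1 g1 -> is_O F f2 g2 -> is_O F (fun x => f1 x * f2 x)%C (fun x => g1 x * g2 x).
Proof.
  intros [K1 [HK1 H1]] [K2 [HK2 H2]]. exists (K1 * K2). split; [now apply Rmult_le_pos | ].
  generalize (filter_and _ _ H1 H2). apply filter_imp. intros x [Hx1 Hx2].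
  rewrite Cmod_mult. replace (K1 * K2 * (g1 x * g2 x)) with (K1 * g1 x * (K2 * g2 x)) by ring.
  apply Rmult_le_compat; auto; apply Cmod_ge_0.
Qed.

Lemma is_O_const (c : C) : is_O F (fun _ => c) (fun _ => 1).
Proof.
  exists (Cmod c). split; [apply Cmod_ge_0 | ]. apply filter_forall. intros _. lra.
Qed.

Lemma is_O_mult_l (f1 f2 : T -> C) (g : T -> R) :
  is_O F f1 (fun _ => 1) -> is_O F f2 g -> is_O F (fun x => f1 x * f2 x)%C g.
Proof.
  intros H1 H2. apply (is_O_weaken 1) with (3 := is_O_mult _ _ _ _ H1 H2); [lra | ].
  apply filter_forall. intros x. apply Rle_refl.
Qed.

Lemma is_O_Cmult_l (c : C) (f : T -> C) (g : T -> R) :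
  is_O F f g -> is_O F (fun x => c * f x)%C g.
Proof. apply is_O_mult_l, is_O_const. Qed.

Lemma is_O_minus (f1 f2 : T -> C) (g : T -> R) :
  is_O F f1 g -> is_O F f2 g -> is_O F (fun x => f1 x - f2 x)%C g.
Proof.
  intros H1 H2. apply (is_O_ext (fun x => f1 x + - (1) * f2 x)%C).
  - apply filter_forall. intros x. ring.
  - apply is_O_plus; [exact H1 | now apply is_O_Cmult_l].
Qed.

Lemma is_O_0 (g : T -> R) : is_O F (fun _ => RtoC 0) g.
Proof.
  exists 0. split; [lra | ]. apply filter_forall. intros x. rewrite Cmod_0. lra.
Qed.

Lemma is_O_Csum (f : nat -> T -> C) (g : T -> R) (n : nat) :
  (forall i, (i < n)%nat -> is_O F (f i) g) -> is_O F (fun x => Csum (fun i => f i x) n) g.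
Proof.
  induction n as [ | n IHn]; intros H; simpl.
  - apply is_O_0.
  - apply is_O_plus; auto.
Qed.

Lemma is_O_finite_uniform (f : nat -> T -> C) (g : T -> R) (n : nat) :
  (forall x, 0 <= g x) -> (forall i, (i < n)%nat -> is_O F (f i) g) ->
  exists K, 0 <= K /\ F (fun x => forall i, (i < n)%nat -> Cmod (f i x) <= K * g x).
Proof.
  intros Hg. induction n as [ | n IHn]; intros H.
  - exists 0. split; [lra | ]. apply filter_forall. intros x i Hi. lia.
  - destruct IHn as [K1 [HK1 H1]]; [auto | ]. destruct (H n) as [K2 [HK2 H2]]; [lia | ].
    exists (K1 + K2). split; [lra | ].
    generalize (filter_and _ _ H1 H2). apply filter_imp. intros x [Hx1 Hx2] i Hi.
    specialize (Hg x). destruct (Nat.eq_dec i n) as [-> | Hin].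
    + nra.
    + assert (Cmod (f i x) <= K1 * g x) by (apply Hx1; lia). nra.
Qed.

End LandauO.

Lemma is_O_comp {T U : Type} {F : (T -> Prop) -> Prop} {G : (U -> Prop) -> Prop}
    (phi : T -> U) (f : U -> C) (g : U -> R) :
  filterlim phi F G -> is_O G f g -> is_O F (fun x => f (phi x)) (fun x => g (phi x)).
Proof. intros Hphi [K [HK H]]. exists K. split; [exact HK | exact (Hphi _ H)]. Qed.

(** * Behaviour at infinity *)

Lemma infty_ge (N : R) : infty (fun x => N <= x).
Proof. exists N. intros x Hx. lra. Qed.

Lemma is_O_infty_bound (f : R -> C) (g : R -> R) :
  is_O infty f g -> exists K N, forall x, N <= x -> Cmod (f x) <= K * g x.
Proof.
  intros [K [_ [N H]]]. exists K, (N + 1). intros x Hx. apply H. lra.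
Qed.

Lemma sqrt_ge_1 (n : R) : 1 <= n -> 1 <= sqrt n.
Proof. intros Hn. rewrite <- sqrt_1. now apply sqrt_le_1_alt. Qed.

Lemma pow_le_exp (k : nat) (eps : R) :
  0 < eps -> exists K, 0 < K /\ forall x, 0 <= x -> x ^ k <= K * exp (eps * x).
Proof.
  intros Heps. assert (Hf := INR_fact_lt_0 k). assert (He := pow_lt eps k Heps).
  exists (INR (fact k) / eps ^ k). split; [now apply Rdiv_lt_0_compat | ].
  intros x Hx. assert (Hex : 0 <= eps * x) by nra.
  assert (Hterm : (eps * x) ^ k / INR (fact k) <= exp (eps * x)).
  { apply Rle_trans with (2 := exp_ge_taylor (eps * x) k Hex).
    destruct k as [ | k]; [simpl; lra | ]. simpl sum_f_R0.
    assert (0 <= sum_f_R0 (fun i => (eps * x) ^ i / INR (fact i)) k); [ | simpl in *; lra].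
    apply cond_pos_sum. intros i.
    apply Rdiv_le_0_compat; [now apply pow_le | apply INR_fact_lt_0]. }
  apply Rle_trans with (INR (fact k) / eps ^ k * ((eps * x) ^ k / INR (fact k))).
  - rewrite Rpow_mult_distr. right. field. lra.
  - apply Rmult_le_compat_l; [ | exact Hterm]. left. now apply Rdiv_lt_0_compat.
Qed.

Lemma pow_le_exp_uniform (n : nat) (eps : R) :
  0 < eps ->
  exists K, 0 < K /\ forall k x, (k <= n)%nat -> 0 <= x -> x ^ k <= K * exp (eps * x).
Proof.
  intros Heps. destruct (pow_le_exp n eps Heps) as [K [HK H]].
  exists (K * exp eps). split; [apply Rmult_lt_0_compat; [exact HK | apply exp_pos] | ].
  intros k x Hk Hx. apply Rle_trans with ((1 + x) ^ n).
  - apply Rle_trans with ((1 + x) ^ k); [apply pow_incr; lra | apply Rle_pow; [lra | exact Hk]].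
  - rewrite Rmult_assoc, <- exp_plus. replace (eps + eps * x) with (eps * (1 + x)) by ring.
    apply H. lra.
Qed.

Definition negligible (f : R -> C) : Prop := forall P : nat, is_O infty f (fun t => / t ^ P).

Lemma negligible_ext (f1 f2 : R -> C) :
  infty (fun t => f1 t = f2 t) -> negligible f1 -> negligible f2.
Proof. intros E H P. exact (is_O_ext _ _ _ E (H P)). Qed.

Lemma negligible_minus (f1 f2 : R -> C) :
  negligible f1 -> negligible f2 -> negligible (fun t => f1 t - f2 t)%C.
Proof. intros H1 H2 P. now apply is_O_minus. Qed.

Lemma negligible_Cmult_l (c : C) (f : R -> C) : negligible f -> negligible (fun t => c * f t)%C.
Proof. intros H P. now apply is_O_Cmult_l. Qed.

Lemma negligible_mult_l (k : nat) (f1 f2 : R -> C) :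
  is_O infty f1 (fun t => t ^ k) -> negligible f2 -> negligible (fun t => f1 t * f2 t)%C.
Proof.
  intros H1 H2 P. apply (is_O_weaken 1) with (3 := is_O_mult _ _ _ _ H1 (H2 (k + P)%nat)); [lra | ].
  apply filter_imp with (2 := infty_ge 1). intros t Ht. right.
  rewrite pow_add. field. split; apply pow_nonzero; lra.
Qed.

Lemma is_O_RtoC_pow (k : nat) : is_O infty (fun t => RtoC t ^ k)%C (fun t => t ^ k).
Proof.
  apply is_O_of_le, filter_imp with (2 := infty_ge 0). intros t Ht.
  rewrite Cmod_pow, Cmod_RtoC_nonneg by exact Ht. apply Rle_refl.
Qed.

Lemma negligible_le (M : R) (f1 f2 : R -> C) :
  infty (fun t => Cmod (f1 t) <= M * Cmod (f2 t)) -> negligible f2 -> negligible f1.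
Proof.
  intros Hle H P. destruct (H P) as [K [HK HP]]. exists (Rabs M * K).
  split; [apply Rmult_le_pos; [apply Rabs_pos | exact HK] | ].
  generalize (filter_and _ _ Hle HP). apply filter_imp. intros t [H1 H2].
  assert (HM := Rle_abs M). assert (H0 := Cmod_ge_0 (f2 t)). assert (HM0 := Rabs_pos M).
  apply Rle_trans with (1 := H1). rewrite Rmult_assoc.
  apply Rle_trans with (Rabs M * Cmod (f2 t)); [now apply Rmult_le_compat_r | ].
  now apply Rmult_le_compat_l.
Qed.

Lemma negligible_exp (c : R) (f : R -> C) :
  0 < c -> is_O infty f (fun t => exp (- c * t)) -> negligible f.
Proof.
  intros Hc H P. destruct (pow_le_exp P c Hc) as [K [HK HP]].
  apply (is_O_weaken K) with (3 := H); [lra | ].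
  apply filter_imp with (2 := infty_ge 1). intros t Ht.
  assert (HtP : 0 < t ^ P) by (apply pow_lt; lra).
  replace (- c * t) with (- (c * t)) by ring. rewrite exp_Ropp.
  apply (Rmult_le_reg_r (t ^ P)); [exact HtP | ].
  rewrite Rmult_assoc, Rinv_l, Rmult_1_r by lra.
  apply (Rmult_le_reg_r (exp (c * t))); [apply exp_pos | ].
  replace (/ exp (c * t) * t ^ P * exp (c * t)) with (t ^ P).
  - apply HP. lra.
  - field. apply Rgt_not_eq, exp_pos.
Qed.

Lemma negligible_RInt (f : R -> R -> C) (a b c M : R) :
  a <= b -> 0 < c -> infty (fun t => ex_RInt_C (f t) a b) ->
  infty (fun t => forall x, a < x < b -> Cmod (f t x) <= M * exp (- c * t)) ->
  negligible (fun t => RInt_C (f t) a b).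
Proof.
  intros Hab Hc Hint Hbound. apply (negligible_exp c); [exact Hc | ].
  exists (Rabs M * (b - a)). split; [apply Rmult_le_pos; [apply Rabs_pos | lra] | ].
  generalize (filter_and _ _ Hint Hbound). apply filter_imp. intros t [Ht1 Ht2].
  apply Rle_trans with (M * exp (- c * t) * (b - a)).
  - apply (Cmod_is_RInt_le_const (f t)); auto.
    now apply is_RInt_C_RInt.
  - assert (He := exp_pos (- c * t)). assert (HM := Rle_abs M).
    assert (M * (b - a) <= Rabs M * (b - a)) by (apply Rmult_le_compat_r; lra). nra.
Qed.

(** * Expansions in powers of a complex variable *)

Definition ps_trunc (a : nat -> C) (J : nat) (z : C) : C := Csum (fun j => a j * z ^ j)%C J.

Lemma ps_trunc_ext (a b : nat -> C) (J : nat) (z : C) :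
  (forall j, a j = b j) -> ps_trunc a J z = ps_trunc b J z.
Proof. intros E. apply Csum_ext. intros j _. now rewrite E. Qed.

Lemma ps_trunc_mult_l (c : C) (a : nat -> C) (J : nat) (z : C) :
  ps_trunc (fun j => c * a j)%C J z = (c * ps_trunc a J z)%C.
Proof. unfold ps_trunc. rewrite <- Csum_mult_l. apply Csum_ext. intros j _. ring. Qed.

Lemma ps_trunc_S_l (a : nat -> C) (J : nat) (z : C) :
  ps_trunc a (S J) z = (a 0%nat + z * ps_trunc (fun j => a (S j)) J z)%C.
Proof.
  unfold ps_trunc. rewrite Csum_S_l, <- Csum_mult_l. f_equal; [simpl; ring | ].
  apply Csum_ext. intros j _. rewrite Cpow_S. ring.
Qed.

Lemma ps_trunc_at_0 (a : nat -> C) (J : nat) : ps_trunc a (S J) 0 = a 0%nat.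
Proof. rewrite ps_trunc_S_l. ring. Qed.

Lemma is_derive_ps_trunc (a : nat -> C) (J : nat) (z : C) (s : R) :
  is_derive_C (fun t => ps_trunc a (S J) (RtoC t * z)) s
    (z * ps_trunc (fun j => RtoC (INR (S j)) * a (S j))%C J (RtoC s * z))%C.
Proof.
  apply (is_derive_ext (V := C_R_NormedModule)
    (fun t => a 0%nat + Csum (fun j => a (S j) * (RtoC t * z) ^ S j) J)%C).
  { intros t. unfold ps_trunc. rewrite Csum_S_l. f_equal. simpl. ring. }
  evar_last.
  - apply is_derive_Cplus; [apply is_derive_C_const | ].
    apply (is_derive_Csum (fun j t => a (S j) * (RtoC t * z) ^ S j)%C). intros j _.
    apply is_derive_Cmult_l, is_derive_Cpow, is_derive_dilation.
  - unfold ps_trunc. rewrite Cplus_0_l, <- Csum_mult_l. apply Csum_ext. intros j _. ring.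
Qed.

Lemma ps_trunc_remainder_le (F f : C -> C) (a : nat -> C) (J : nat) (z : C) (M : R) :
  (forall s, 0 <= s <= 1 ->
     is_derive_C (fun t => F (RtoC t * z)%C) s (z * f (RtoC s * z))%C) ->
  F 0%C = a 0%nat ->
  (forall s, 0 <= s <= 1 ->
     Cmod (f (RtoC s * z)
       - ps_trunc (fun j => RtoC (INR (S j)) * a (S j)) J (RtoC s * z))%C <= M) ->
  Cmod (F z - ps_trunc a (S J) z)%C <= Cmod z * M.
Proof.
  intros HF H0 HM.
  set (D := fun t => (F (RtoC t * z) - ps_trunc a (S J) (RtoC t * z))%C).
  replace (F z - ps_trunc a (S J) z)%C with (D 1 - D 0)%C.
  2: { unfold D. rewrite Cmult_1_l, Cmult_0_l, ps_trunc_at_0, H0. ring. }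
  replace (Cmod z * M) with (Cmod z * M * (1 - 0)) by ring.
  apply (mean_value_inequality D (fun t => z *
    (f (RtoC t * z) - ps_trunc (fun j => RtoC (INR (S j)) * a (S j)) J (RtoC t * z)))%C);
    [lra | | ].
  - intros s Hs. evar_last.
    + apply is_derive_Cminus; [now apply HF | apply is_derive_ps_trunc].
    + simpl. ring.
  - intros s Hs. rewrite Cmod_mult. apply Rmult_le_compat_l; [apply Cmod_ge_0 | now apply HM].
Qed.

Definition exp_coef (k : nat) : C := (/ RtoC (INR (fact k)))%C.

Lemma RtoC_fact_neq_0 (k : nat) : RtoC (INR (fact k)) <> 0%C.
Proof. apply RtoC_neq_0, INR_fact_neq_0. Qed.

Lemma RtoC_INR_S_neq_0 (k : nat) : RtoC (INR (S k)) <> 0%C.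
Proof. apply RtoC_neq_0, not_0_INR, Nat.neq_succ_0. Qed.

Lemma exp_coef_S (k : nat) : (RtoC (INR (S k)) * exp_coef (S k))%C = exp_coef k.
Proof.
  unfold exp_coef. change (fact (S k)) with (S k * fact k)%nat. rewrite mult_INR, RtoC_mult.
  field. split; [apply RtoC_fact_neq_0 | apply RtoC_INR_S_neq_0].
Qed.

Lemma Cmod_dilation_le (s : R) (z : C) : 0 <= s <= 1 -> Cmod (RtoC s * z)%C <= Cmod z.
Proof.
  intros Hs. rewrite Cmod_mult, Cmod_RtoC_nonneg by lra. assert (H := Cmod_ge_0 z). nra.
Qed.

Lemma Cexp_taylor (K : nat) (z : C) :
  Cmod (Cexp z - ps_trunc exp_coef K z)%C <= Cmod z ^ K * exp (Cmod z).
Proof.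
  revert z. induction K as [ | K IHK]; intros z.
  - unfold ps_trunc. simpl. unfold Cminus. rewrite Copp_0, Cplus_0_r, Rmult_1_l.
    apply Cmod_Cexp_le.
  - simpl pow. rewrite Rmult_assoc. apply (ps_trunc_remainder_le Cexp Cexp).
    + intros s _. apply is_derive_Cexp, is_derive_dilation.
    + rewrite Cexp_0. unfold exp_coef. simpl. field.
    + intros s Hs. rewrite (ps_trunc_ext _ exp_coef) by apply exp_coef_S.
      apply Rle_trans with (1 := IHK _). assert (H := Cmod_dilation_le s z Hs).
      apply Rmult_le_compat.
      * apply pow_le, Cmod_ge_0.
      * left. apply exp_pos.
      * apply pow_incr. split; [apply Cmod_ge_0 | exact H].
      * now apply exp_le_compat.
Qed.

Lemma near_0_iff (P : C -> Prop) :
  near_0 P <-> exists r, 0 < r /\ forall z, 0 < Cmod z <= r -> P z.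
Proof.
  assert (Hminus_0 : forall z, (z - 0)%C = z) by (intros z; ring).
  split.
  - intros H. apply locally_C_iff in H. destruct H as [r [Hr HP]].
    exists (r / 2). split; [lra | ]. intros z Hz. apply HP.
    + rewrite Hminus_0. lra.
    + now apply Cmod_gt_0.
  - intros [r [Hr HP]]. apply locally_C_iff. exists r. split; [exact Hr | ].
    intros z Hz Hz0. rewrite Hminus_0 in Hz. apply HP. split; [now apply Cmod_gt_0 | lra].
Qed.

Lemma near_0_Cmod_le (r : R) : 0 < r -> near_0 (fun z => Cmod z <= r).
Proof. intros Hr. apply near_0_iff. exists r. split; [exact Hr | ]. now intros z [_ Hz]. Qed.

Definition has_expansion (f : C -> C) (a : nat -> C) : Prop :=
  forall J, is_O near_0 (fun z => f z - ps_trunc a J z)%C (fun z => Cmod z ^ J).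

Lemma has_expansion_ext (f : C -> C) (a b : nat -> C) :
  (forall j, a j = b j) -> has_expansion f a -> has_expansion f b.
Proof.
  intros E H J. apply is_O_ext with (2 := H J). apply filter_forall. intros z.
  now rewrite (ps_trunc_ext a b).
Qed.

Lemma near_0_Cmod_pow_le_1 (k : nat) : near_0 (fun z => Cmod z ^ k <= 1).
Proof.
  apply filter_imp with (2 := near_0_Cmod_le 1 Rlt_0_1). intros z Hz.
  rewrite <- (pow1 k). apply pow_incr. split; [apply Cmod_ge_0 | exact Hz].
Qed.

Lemma is_O_Cpow_id (k : nat) : is_O near_0 (fun z => z ^ k)%C (fun z => Cmod z ^ k).
Proof.
  apply is_O_of_le, filter_forall. intros z. rewrite Cmod_pow. apply Rle_refl.
Qed.

Lemma ps_trunc_bounded (a : nat -> C) (J : nat) : is_O near_0 (ps_trunc a J) (fun _ => 1).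
Proof.
  apply (is_O_Csum (fun j z => a j * z ^ j)%C). intros j _. apply is_O_Cmult_l.
  apply (is_O_weaken 1) with (3 := is_O_Cpow_id j); [lra | ].
  apply filter_imp with (2 := near_0_Cmod_pow_le_1 j). intros z Hz. lra.
Qed.

Lemma has_expansion_of_S (f : C -> C) (a : nat -> C) :
  (forall J, is_O near_0 (fun z => f z - ps_trunc a (S J) z)%C (fun z => Cmod z ^ S J)) ->
  has_expansion f a.
Proof.
  intros H J. apply (is_O_ext (fun z => (f z - ps_trunc a (S J) z) + a J * z ^ J)%C).
  { apply filter_forall. intros z. unfold ps_trunc. simpl. ring. }
  apply is_O_plus; [ | apply is_O_Cmult_l, is_O_Cpow_id].
  apply (is_O_weaken 1) with (3 := H J); [lra | ].
  apply filter_imp with (2 := near_0_Cmod_le 1 Rlt_0_1). intros z Hz.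
  simpl. apply Rmult_le_compat_r; [apply pow_le, Cmod_ge_0 | exact Hz].
Qed.

Lemma has_expansion_bounded (f : C -> C) (a : nat -> C) :
  has_expansion f a -> is_O near_0 f (fun _ => 1).
Proof.
  intros H. apply is_O_ext with (2 := H 0%nat). apply filter_forall. intros z.
  unfold ps_trunc. simpl. ring.
Qed.

Lemma has_expansion_vanishing (f : C -> C) (a : nat -> C) :
  has_expansion f a -> a 0%nat = 0%C -> is_O near_0 f Cmod.
Proof.
  intros H H0. apply (is_O_weaken 1 f (fun z => Cmod z ^ 1)); [lra | | ].
  - apply filter_forall. intros z. simpl. lra.
  - apply is_O_ext with (2 := H 1%nat). apply filter_forall. intros z.
    unfold ps_trunc. simpl. rewrite H0. ring.
Qed.

Lemma ps_mul_S (a b : nat -> C) (j : nat) :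
  ps_mul a b (S j) = (a 0%nat * b (S j) + ps_mul (fun i => a (S i)) b j)%C.
Proof. unfold ps_mul. now rewrite Csum_S_l. Qed.

Lemma ps_trunc_ps_mul_S (a b : nat -> C) (J : nat) (z : C) :
  ps_trunc (ps_mul a b) (S J) z =
  (a 0%nat * ps_trunc b (S J) z + z * ps_trunc (ps_mul (fun i => a (S i)) b) J z)%C.
Proof.
  rewrite !ps_trunc_S_l, Cmult_plus_distr_l.
  replace (ps_mul a b 0) with (a 0%nat * b 0%nat)%C by (unfold ps_mul; simpl; ring).
  rewrite <- Cplus_assoc. f_equal.
  transitivity (z * (a 0%nat * ps_trunc (fun j => b (S j)) J z
    + ps_trunc (ps_mul (fun i => a (S i)) b) J z))%C; [ | ring].
  f_equal. unfold ps_trunc. rewrite <- Csum_mult_l, <- Csum_plus. apply Csum_ext. intros j _.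
  rewrite ps_mul_S. ring.
Qed.

Lemma ps_trunc_ps_mul (a b : nat -> C) (J : nat) :
  is_O near_0 (fun z => ps_trunc a J z * ps_trunc b J z - ps_trunc (ps_mul a b) J z)%C
    (fun z => Cmod z ^ J).
Proof.
  revert a. induction J as [ | J IHJ]; intros a.
  - apply (is_O_ext (fun _ => RtoC 0)); [ | apply is_O_0].
    apply filter_forall. intros z. unfold ps_trunc. simpl. ring.
  - set (a' := fun i => a (S i)).
    apply (is_O_ext (fun z => z ^ 1 * (ps_trunc a' J z * ps_trunc b J z - ps_trunc (ps_mul a' b) J z
      + ps_trunc a' J z * (b J * z ^ J)))%C).
    + apply filter_forall. intros z. rewrite ps_trunc_ps_mul_S, (ps_trunc_S_l a). fold a'.
      change (ps_trunc b (S J) z) with (ps_trunc b J z + b J * z ^ J)%C. ring.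
    + apply (is_O_weaken 1 _ (fun z => Cmod z ^ 1 * Cmod z ^ J)); [lra | | ].
      { apply filter_forall. intros z. rewrite <- pow_add. simpl. lra. }
      apply is_O_mult; [apply is_O_Cpow_id | ].
      apply is_O_plus; [apply IHJ | ].
      apply is_O_mult_l; [apply ps_trunc_bounded | apply is_O_Cmult_l, is_O_Cpow_id].
Qed.

Lemma has_expansion_mult (f g : C -> C) (a b : nat -> C) :
  has_expansion f a -> has_expansion g b -> has_expansion (fun z => f z * g z)%C (ps_mul a b).
Proof.
  intros Hf Hg J.
  apply (is_O_ext (fun z => f z * (g z - ps_trunc b J z) + ps_trunc b J z * (f z - ps_trunc a J z)
    + (ps_trunc a J z * ps_trunc b J z - ps_trunc (ps_mul a b) J z))%C).
  { apply filter_forall. intros z. ring. }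
  apply is_O_plus; [apply is_O_plus | ].
  - apply is_O_mult_l; [exact (has_expansion_bounded _ _ Hf) | apply Hg].
  - apply is_O_mult_l; [apply ps_trunc_bounded | apply Hf].
  - apply ps_trunc_ps_mul.
Qed.

Lemma has_expansion_1 : has_expansion (fun _ => 1%C) ps_one.
Proof.
  apply has_expansion_of_S. intros J. apply (is_O_ext (fun _ => RtoC 0)); [ | apply is_O_0].
  apply filter_forall. intros z. rewrite ps_trunc_S_l. unfold ps_trunc, ps_one.
  rewrite Csum_0; [simpl; ring | ]. intros j _. simpl. ring.
Qed.

Lemma has_expansion_pow (f : C -> C) (a : nat -> C) (k : nat) :
  has_expansion f a -> has_expansion (fun z => f z ^ k)%C (ps_pow a k).
Proof.
  intros H. induction k as [ | k IHk]; simpl.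
  - exact has_expansion_1.
  - now apply has_expansion_mult.
Qed.

Lemma has_expansion_tail (f : C -> C) (a : nat -> C) (m : nat) :
  has_expansion f a ->
  has_expansion (fun z => (f z - ps_trunc a (S m) z) / z ^ m)%C
    (fun j => if Nat.eqb j 0 then RtoC 0 else a (j + m)%nat).
Proof.
  intros H. apply has_expansion_of_S. intros J.
  destruct (H (S m + J)%nat) as [K [HK HO]]. exists K. split; [exact HK | ].
  apply near_0_iff in HO. destruct HO as [r [Hr HO]]. apply near_0_iff.
  exists r. split; [exact Hr | ]. intros z Hz.
  assert (Hz0 : z <> 0%C) by (apply Cmod_gt_0; lra).
  assert (Hzm : (z ^ m)%C <> 0%C) by now apply Cpow_nz.
  assert (Hm : 0 < Cmod z ^ m) by (apply pow_lt; lra).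
  replace (_ - _)%C with ((f z - ps_trunc a (S m + J) z) / z ^ m)%C.
  - rewrite Cmod_div, Cmod_pow by exact Hzm. apply (Rmult_le_reg_r (Cmod z ^ m)); [exact Hm | ].
    replace (K * Cmod z ^ S J * Cmod z ^ m) with (K * Cmod z ^ (S m + J)).
    + unfold Rdiv. rewrite Rmult_assoc, Rinv_l, Rmult_1_r by lra. now apply HO.
    + rewrite Rmult_assoc, <- pow_add. do 2 f_equal. lia.
  - set (tail := ps_trunc (fun j => a (S j + m)%nat) J z).
    replace (ps_trunc _ (S J) z) with (z * tail)%C
      by (rewrite ps_trunc_S_l; symmetry; apply Cplus_0_l).
    replace (ps_trunc a (S m + J) z) with (ps_trunc a (S m) z + z ^ m * (z * tail))%C;
      [now field | ].
    unfold tail, ps_trunc. rewrite Csum_add, <- !Csum_mult_l. f_equal. apply Csum_ext. intros j _.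
    rewrite Cpow_add_r, Cpow_S. replace (S m + j)%nat with (S j + m)%nat by lia. ring.
Qed.

Lemma Cexp_taylor_scaled (J : nat) (eps L : R) :
  0 < eps -> 0 <= L ->
  exists K, 0 <= K /\ forall r X y : C, Cmod y <= eps / 2 -> Cmod y <= L * Cmod r ->
    Cmod (Cexp (X * y) - ps_trunc exp_coef J (X * y))%C <= K * Cmod r ^ J * exp (eps * Cmod X).
Proof.
  intros Heps HL. destruct (pow_le_exp J (eps / 2)) as [K [HK H]]; [lra | ].
  assert (HLJ : 0 <= L ^ J) by now apply pow_le.
  exists (K * L ^ J). split; [nra | ]. intros r X y Hy Hyr.
  assert (HX := Cmod_ge_0 X). assert (Hr := Cmod_ge_0 r). assert (Hy0 := Cmod_ge_0 y).
  apply Rle_trans with (1 := Cexp_taylor J _). rewrite Cmod_mult.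
  replace (K * L ^ J * Cmod r ^ J * exp (eps * Cmod X)) with
    ((K * exp (eps / 2 * Cmod X)) * (L * Cmod r) ^ J * exp (eps / 2 * Cmod X)).
  2: { rewrite Rpow_mult_distr.
       replace (eps * Cmod X) with (eps / 2 * Cmod X + eps / 2 * Cmod X) by field.
       rewrite exp_plus. ring. }
  apply Rmult_le_compat.
  - apply pow_le. now apply Rmult_le_pos.
  - left. apply exp_pos.
  - rewrite Rpow_mult_distr. apply Rmult_le_compat.
    + now apply pow_le.
    + now apply pow_le.
    + now apply H.
    + apply pow_incr. lra.
  - apply exp_le_compat. nra.
Qed.

Lemma is_O_Cmod_small (f : C -> C) (eps : R) :
  0 < eps -> is_O near_0 f Cmod -> near_0 (fun z => Cmod (f z) <= eps).
Proof.
  intros Heps [K [HK H]]. assert (Hr : 0 < eps / (K + 1)) by (apply Rdiv_lt_0_compat; lra).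
  generalize (filter_and _ _ (near_0_Cmod_le _ Hr) H). apply filter_imp. intros z [Hzr Hz].
  apply Rle_trans with (1 := Hz). apply Rle_trans with ((K + 1) * (eps / (K + 1))).
  - assert (H0 := Cmod_ge_0 z). nra.
  - right. field. lra.
Qed.

Lemma Cmod_exp_coef_le_1 (k : nat) : Cmod (exp_coef k) <= 1.
Proof.
  unfold exp_coef. rewrite Cmod_inv, Cmod_RtoC_nonneg by (apply RtoC_fact_neq_0 || apply pos_INR).
  rewrite <- Rinv_1. apply Rinv_le_contravar; [lra | ]. apply (le_INR 1), lt_O_fact.
Qed.

Lemma Cexp_mult_remainder_split (X y q : C) (T : nat -> C) (J : nat) :
  (Cexp (X * y) * q - Csum (fun k => exp_coef k * X ^ k * T k) J =
   (Cexp (X * y) - ps_trunc exp_coef J (X * y)) * q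
     + Csum (fun k => exp_coef k * X ^ k * (y ^ k * q - T k)) J)%C.
Proof.
  unfold ps_trunc.
  rewrite (Csum_ext (fun k => exp_coef k * X ^ k * (y ^ k * q - T k))%C
    (fun k => q * (exp_coef k * (X * y) ^ k) - exp_coef k * X ^ k * T k)%C).
  - rewrite Csum_minus, Csum_mult_l. ring.
  - intros k _. rewrite Cpow_mult_l. ring.
Qed.

Lemma Cexp_mult_expansion (h q : C -> C) (a b : nat -> C) (J : nat) (eps : R) :
  0 < eps -> has_expansion h a -> a 0%nat = 0%C -> has_expansion q b ->
  exists K, 0 <= K /\ near_0 (fun z => forall X : C,
    Cmod (Cexp (X * h z) * q z -
          Csum (fun k => exp_coef k * X ^ k * ps_trunc (ps_mul (ps_pow a k) b) J z) J)%C
    <= K * Cmod z ^ J * exp (eps * Cmod X)).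
Proof.
  intros Heps Hh Ha0 Hq.
  assert (Hvan := has_expansion_vanishing _ _ Hh Ha0).
  assert (Hhalf := is_O_Cmod_small h (eps / 2) ltac:(lra) Hvan).
  destruct Hvan as [L [HL Hsmall]].
  destruct (has_expansion_bounded _ _ Hq) as [B [HB Hbounded]].
  destruct (is_O_finite_uniform (F := near_0)
    (fun k z => h z ^ k * q z - ps_trunc (ps_mul (ps_pow a k) b) J z)%C
    (fun z => Cmod z ^ J) J) as [M [HM Hterms]].
  { intros z. apply pow_le, Cmod_ge_0. }
  { intros k _. apply has_expansion_mult; [now apply has_expansion_pow | exact Hq]. }
  destruct (Cexp_taylor_scaled J eps L Heps HL) as [K1 [HK1 Hrem]].
  destruct (pow_le_exp_uniform J eps Heps) as [K2 [HK2 Hpow]].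
  exists (K1 * B + INR J * (K2 * M)). assert (HJ := pos_INR J). split.
  { apply Rplus_le_le_0_compat; repeat apply Rmult_le_pos; lra. }
  generalize (filter_and _ _ Hhalf (filter_and _ _ Hsmall (filter_and _ _ Hbounded Hterms))).
  apply filter_imp. intros z [Hh2 [Hhz [Hqz Htz]]] X.
  rewrite Cexp_mult_remainder_split. apply Rle_trans with (1 := Cmod_triangle _ _).
  set (E := exp (eps * Cmod X)). set (zJ := Cmod z ^ J).
  replace ((K1 * B + INR J * (K2 * M)) * zJ * E) with
    (K1 * zJ * E * B + INR J * (K2 * E * (M * zJ))) by ring.
  apply Rplus_le_compat.
  - rewrite Cmod_mult. apply Rmult_le_compat; try apply Cmod_ge_0; [now apply Hrem | lra].
  - apply Cmod_Csum_le. intros k Hk. rewrite Cmod_mult.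
    apply Rmult_le_compat; try apply Cmod_ge_0; [ | now apply Htz].
    rewrite Cmod_mult, Cmod_pow, <- (Rmult_1_l (K2 * E)).
    apply Rmult_le_compat; [apply Cmod_ge_0 | apply pow_le, Cmod_ge_0
      | apply Cmod_exp_coef_le_1 | ].
    apply Hpow; [lia | apply Cmod_ge_0].
Qed.

(** * Moments of the kernel exp (- a y^mu) *)

Definition kernel (mu : nat) (a : C) (t s : R) : C := Cexp (- a * RtoC (t * s) ^ mu)%C.

Lemma Cmod_kernel (mu : nat) (a : C) (t s : R) :
  Cmod (kernel mu a t s) = exp (- Re a * (t * s) ^ mu).
Proof.
  unfold kernel. rewrite Cmod_Cexp, <- RtoC_pow, re_scal_r, re_opp. reflexivity.
Qed.

Lemma kernel_at_0 (q : nat) (a : C) (t : R) : kernel (S q) a t 0 = 1%C.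
Proof. unfold kernel. rewrite Rmult_0_r, Cpow_S, Cmult_0_l, Cmult_0_r. apply Cexp_0. Qed.

Lemma is_derive_kernel (q : nat) (a : C) (t s : R) :
  is_derive_C (kernel (S q) a t) s
    (- (RtoC (INR (S q)) * a * RtoC t ^ S q) * (kernel (S q) a t s * RtoC s ^ q))%C.
Proof.
  evar_last.
  - apply is_derive_Cexp, is_derive_Cmult_l, is_derive_Cpow, is_derive_RtoC.
    apply (is_derive_scal (fun x => x) s t 1), (is_derive_id (K := R_AbsRing)).
  - change (Cexp _) with (kernel (S q) a t s).
    rewrite Rmult_1_r, RtoC_mult, Cpow_mult_l, (Cpow_S (RtoC t)). ring.
Qed.

Lemma continuous_kernel (mu : nat) (a : C) (t s : R) : continuous (kernel mu a t) s.
Proof.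
  destruct mu as [ | q].
  - apply continuous_const.
  - eapply continuous_is_derive_C, is_derive_kernel.
Qed.

Lemma continuous_kernel_monomial (mu : nat) (a : C) (t : R) (j : nat) (s : R) :
  continuous (fun x => kernel mu a t x * RtoC x ^ j)%C s.
Proof.
  apply continuous_Cmult; [apply continuous_kernel | ].
  eapply continuous_is_derive_C, is_derive_monomial.
Qed.

Definition moment (mu : nat) (a : C) (del : R) (i : nat) (t : R) : C :=
  RInt_C (fun s => kernel mu a t s * RtoC s ^ i)%C 0 del.

Lemma is_RInt_moment (mu : nat) (a : C) (del : R) (i : nat) (t : R) :
  0 <= del -> is_RInt_C (fun s => kernel mu a t s * RtoC s ^ i)%C 0 del (moment mu a del i t).
Proof.
  intros Hdel. apply is_RInt_C_RInt, ex_RInt_C_continuous; [exact Hdel | ].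
  intros x _. apply continuous_kernel_monomial.
Qed.

Lemma moment_recursion (q : nat) (a : C) (del : R) (j : nat) (t : R) :
  0 <= del ->
  (RtoC (INR (S q)) * a * RtoC t ^ S q * moment (S q) a del (q + j) t =
   RtoC (INR j) * moment (S q) a del (pred j) t + RtoC 0 ^ j
     - kernel (S q) a t del * RtoC del ^ j)%C.
Proof.
  intros Hdel. set (b := (RtoC (INR (S q)) * a * RtoC t ^ S q)%C).
  assert (E : (RtoC (INR j) * moment (S q) a del (pred j) t - b * moment (S q) a del (q + j) t =
    kernel (S q) a t del * RtoC del ^ j - kernel (S q) a t 0 * RtoC 0 ^ j)%C).
  { apply (is_RInt_C_unique (fun s => RtoC (INR j) * (kernel (S q) a t s * RtoC s ^ pred j)
      - b * (kernel (S q) a t s * RtoC s ^ (q + j)))%C 0 del).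
    - apply is_RInt_Cminus; now apply is_RInt_Cmult_l, is_RInt_moment.
    - apply (is_RInt_C_derive (fun s => kernel (S q) a t s * RtoC s ^ j)%C); [exact Hdel | | ].
      + intros s _. evar_last.
        * apply is_derive_Cmult; [apply is_derive_kernel | apply is_derive_monomial].
        * fold b. rewrite Cpow_add_r. ring.
      + intros s _. apply (continuous_minus (V := C_R_NormedModule));
          apply continuous_Cmult_l, continuous_kernel_monomial. }
  rewrite kernel_at_0, Cmult_1_l in E.
  transitivity (RtoC (INR j) * moment (S q) a del (pred j) t
    - (RtoC (INR j) * moment (S q) a del (pred j) t - b * moment (S q) a del (q + j) t))%C;
    [ring | ].
  rewrite E. ring.
Qed.

Lemma pow_ge_linear (q : nat) (y : R) : 0 <= y -> y - 1 <= y ^ S q.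
Proof.
  intros Hy. destruct (Rle_dec y 1) as [Hy1 | Hy1].
  - apply Rle_trans with 0; [lra | now apply pow_le].
  - apply Rle_trans with (y ^ 1); [simpl; lra | apply Rle_pow; [lra | lia]].
Qed.

Lemma negligible_kernel (q : nat) (a : C) (del : R) :
  0 < Re a -> 0 < del -> negligible (fun t => kernel (S q) a t del).
Proof.
  intros Ha Hdel. apply (negligible_exp (Re a * del)); [now apply Rmult_lt_0_compat | ].
  exists (exp (Re a)). split; [left; apply exp_pos | ].
  apply filter_imp with (2 := infty_ge 0). intros t Ht.
  rewrite Cmod_kernel, <- exp_plus. apply exp_le_compat.
  assert (H := pow_ge_linear q (t * del) ltac:(nra)). nra.
Qed.

(* The upper limit [del] is immaterial: it only contributes negligible terms. *)
Definition has_moment (mu : nat) (a : C) (del : R) (i : nat) (m : C) : Prop :=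
  negligible (fun t => moment mu a del i t - m / RtoC t ^ S i)%C.

Lemma is_O_inv_pow (k : nat) : is_O infty (fun t => / RtoC t ^ k)%C (fun t => / t ^ k).
Proof.
  apply is_O_of_le, filter_imp with (2 := infty_ge 1). intros t Ht.
  rewrite Cmod_inv, Cmod_pow, Cmod_RtoC_nonneg by (lra || apply Cpow_nz, RtoC_neq_0; lra).
  apply Rle_refl.
Qed.

Lemma inv_pow_le_1 (k : nat) (t : R) : 1 <= t -> / t ^ k <= 1.
Proof.
  intros Ht. rewrite <- Rinv_1. apply Rinv_le_contravar; [lra | now apply pow_R1_Rle].
Qed.

Lemma is_O_inv_pow_1 (k : nat) : is_O infty (fun t => / RtoC t ^ k)%C (fun _ => 1).
Proof.
  apply (is_O_weaken 1) with (3 := is_O_inv_pow k); [lra | ].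
  apply filter_imp with (2 := infty_ge 1). intros t Ht. rewrite Rmult_1_l. now apply inv_pow_le_1.
Qed.

Lemma infty_neq_0 : infty (fun t => RtoC t <> 0%C).
Proof. apply filter_imp with (2 := infty_ge 1). intros t Ht. apply RtoC_neq_0. lra. Qed.

Lemma has_moment_pred_exponent (q : nat) (a : C) (del : R) :
  0 < Re a -> 0 < del -> has_moment (S q) a del q (/ (RtoC (INR (S q)) * a))%C.
Proof.
  intros Ha Hdel. assert (Ha0 := Re_pos_neq_0 a Ha). assert (Hq := RtoC_INR_S_neq_0 q).
  apply (negligible_ext (fun t =>
    - / (RtoC (INR (S q)) * a) * (/ RtoC t ^ S q * kernel (S q) a t del))%C).
  - apply filter_imp with (2 := infty_neq_0). intros t Ht.
    assert (E := moment_recursion q a del 0 t ltac:(lra)). rewrite Nat.add_0_r in E.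
    change (RtoC (INR 0)) with (RtoC 0) in E. rewrite Cmult_0_l, Cplus_0_l in E.
    change (RtoC 0 ^ 0)%C with (RtoC 1) in E.
    change (RtoC del ^ 0)%C with (RtoC 1) in E. rewrite Cmult_1_r in E.
    assert (Htq : (RtoC t ^ S q)%C <> 0%C) by now apply Cpow_nz.
    transitivity ((RtoC (INR (S q)) * a * RtoC t ^ S q * moment (S q) a del q t)
      / (RtoC (INR (S q)) * a * RtoC t ^ S q) - / (RtoC (INR (S q)) * a) / RtoC t ^ S q)%C.
    + rewrite E. field. auto.
    + field. auto.
  - apply negligible_Cmult_l, (negligible_mult_l 0); [apply is_O_inv_pow_1 | ].
    now apply negligible_kernel.
Qed.

Lemma has_moment_add_exponent (q : nat) (a : C) (del : R) (i : nat) (m : C) :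
  0 < Re a -> 0 < del -> has_moment (S q) a del i m ->
  has_moment (S q) a del (q + S i) (RtoC (INR (S i)) * m / (RtoC (INR (S q)) * a))%C.
Proof.
  intros Ha Hdel Hm. assert (Ha0 := Re_pos_neq_0 a Ha). assert (Hq := RtoC_INR_S_neq_0 q).
  apply (negligible_ext (fun t => / (RtoC (INR (S q)) * a) * (/ RtoC t ^ S q *
    (RtoC (INR (S i)) * (moment (S q) a del i t - m / RtoC t ^ S i)
      - RtoC del ^ S i * kernel (S q) a t del)))%C).
  - apply filter_imp with (2 := infty_neq_0). intros t Ht.
    assert (E := moment_recursion q a del (S i) t ltac:(lra)). simpl pred in E.
    rewrite (Cpow_S (RtoC 0)), Cmult_0_l, Cplus_0_r in E.
    assert (Htq : (RtoC t ^ S q)%C <> 0%C) by now apply Cpow_nz.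
    assert (Hti : (RtoC t ^ S i)%C <> 0%C) by now apply Cpow_nz.
    replace (S (q + S i)) with (S q + S i)%nat by reflexivity. rewrite (Cpow_add_r _ (S q)).
    transitivity ((RtoC (INR (S q)) * a * RtoC t ^ S q * moment (S q) a del (q + S i) t)
      / (RtoC (INR (S q)) * a * RtoC t ^ S q)
      - RtoC (INR (S i)) * m / (RtoC (INR (S q)) * a) / (RtoC t ^ S q * RtoC t ^ S i))%C.
    + rewrite E. field. auto.
    + field. auto.
  - apply negligible_Cmult_l, (negligible_mult_l 0); [apply is_O_inv_pow_1 | ].
    apply negligible_minus; apply negligible_Cmult_l; [exact Hm | now apply negligible_kernel].
Qed.

Lemma has_moment_exp (a : C) (del : R) (i : nat) :
  0 < Re a -> 0 < del -> has_moment 1 a del i (RtoC (INR (fact i)) / a ^ S i)%C.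
Proof.
  intros Ha Hdel. assert (Ha0 := Re_pos_neq_0 a Ha). induction i as [ | i IHi].
  - replace (RtoC (INR (fact 0)) / a ^ 1)%C with (/ (RtoC (INR 1) * a))%C by (simpl; now field).
    now apply has_moment_pred_exponent.
  - replace (RtoC (INR (fact (S i))) / a ^ S (S i))%C
      with (RtoC (INR (S i)) * (RtoC (INR (fact i)) / a ^ S i) / (RtoC (INR 1) * a))%C.
    + now apply (has_moment_add_exponent 0).
    + change (fact (S i)) with (S i * fact i)%nat. rewrite mult_INR, RtoC_mult, (Cpow_S a (S i)).
      change (INR 1) with 1. field. split; [now apply Cpow_nz | exact Ha0].
Qed.

(** * Watson's lemma *)

Definition watson_coef (mu : nat) (c : C) (ha qb m : nat -> C) (j : nat) : C :=
  Csum (fun k => exp_coef k * c ^ k * ps_mul (ps_pow ha k) qb j * m (mu * k + j)%nat)%C (S j).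

Definition watson_integrand (mu : nat) (a c d : C) (h q : C -> C) (t s : R) : C :=
  (kernel mu a t s * (Cexp (c * RtoC (t * s) ^ mu * h (RtoC s * d)) * q (RtoC s * d)))%C.

Lemma ps_pow_low_order (a : nat -> C) (k n : nat) :
  a 0%nat = 0%C -> (n < k)%nat -> ps_pow a k n = 0%C.
Proof.
  intros H0. revert n. induction k as [ | k IHk]; intros n Hn; [lia | ].
  simpl. unfold ps_mul. rewrite Csum_S_l, H0, Csum_0; [ring | ].
  intros i Hi. rewrite IHk by lia. ring.
Qed.

Lemma ps_mul_pow_low_order (a b : nat -> C) (k n : nat) :
  a 0%nat = 0%C -> (n < k)%nat -> ps_mul (ps_pow a k) b n = 0%C.
Proof.
  intros H0 Hn. apply Csum_0. intros i Hi. rewrite ps_pow_low_order by (auto; lia). ring.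
Qed.

Lemma negligible_Csum (f : nat -> R -> C) (n : nat) :
  (forall i, (i < n)%nat -> negligible (f i)) -> negligible (fun t => Csum (fun i => f i t) n).
Proof. intros H P. apply is_O_Csum. intros i Hi. now apply H. Qed.

Lemma pow_mult_exp_neg_pow_le (q i : nat) (b : R) :
  0 < b -> exists K, 0 < K /\
    forall y, 0 <= y -> y ^ i * exp (- b * y ^ S q) <= K * exp (- (b / 2) * y).
Proof.
  intros Hb. destruct (pow_le_exp i (b / 2)) as [K [HK Hpow]]; [lra | ].
  exists (K * exp b). split; [apply Rmult_lt_0_compat; [exact HK | apply exp_pos] | ].
  intros y Hy. apply Rle_trans with (K * exp (b / 2 * y) * exp (b - b * y)).
  - apply Rmult_le_compat; [now apply pow_le | left; apply exp_pos | now apply Hpow | ].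
    apply exp_le_compat. assert (Hlinear := pow_ge_linear q y Hy). nra.
  - rewrite !Rmult_assoc, <- !exp_plus. apply Rmult_le_compat_l; [lra | ].
    apply exp_le_compat. lra.
Qed.

Lemma is_RInt_exp_neg (b t del : R) : 0 < b -> 0 < t ->
  is_RInt (fun s => exp (- b * (t * s))) 0 del (/ (b * t) * (1 - exp (- b * (t * del)))).
Proof.
  intros Hb Ht.
  set (E := fun s => - / (b * t) * exp (- b * (t * s))).
  replace (/ (b * t) * (1 - exp (- b * (t * del)))) with (minus (E del) (E 0)).
  - apply (is_RInt_derive (V := R_CompleteNormedModule)).
    + intros x _. unfold E. auto_derive; [trivial | ]. field. lra.
    + intros x _. apply (ex_derive_continuous (K := R_AbsRing) (V := R_NormedModule)).
      auto_derive. trivial.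
  - unfold E, minus, plus, opp. simpl. rewrite !Rmult_0_r, exp_0. ring.
Qed.

Section Watson.

Variables (p : nat) (a c d : C) (h q : C -> C) (ha qb m : nat -> C) (J : nat).

Let mu : nat := S p.
Let coef (k j : nat) : C := (exp_coef k * c ^ k * ps_mul (ps_pow ha k) qb j * d ^ j)%C.
Let truncated (t s : R) : C :=
  Csum (fun k => exp_coef k * (c * RtoC (t * s) ^ mu) ^ k
                 * ps_trunc (ps_mul (ps_pow ha k) qb) J (RtoC s * d))%C J.

Let moment_sum (del t : R) : C :=
  Csum (fun k => Csum (fun j =>
    coef k j * RtoC t ^ (mu * k) * moment mu a del (mu * k + j) t)%C J) J.

Hypothesis Re_a_pos : 0 < Re a.
Hypothesis d_neq_0 : d <> 0%C.
Hypothesis h_expansion : has_expansion h ha.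
Hypothesis ha_0 : ha 0%nat = 0%C.
Hypothesis q_expansion : has_expansion q qb.

Lemma watson_truncation_le :
  exists r K, 0 < r /\ 0 <= K /\ forall t s, 0 < t -> 0 < s <= r ->
    Cmod (watson_integrand mu a c d h q t s - kernel mu a t s * truncated t s)%C
    <= K * (s ^ J * exp (- (Re a / 2) * (t * s) ^ mu)).
Proof.
  assert (Hc := Cmod_ge_0 c). assert (Hd : 0 < Cmod d) by now apply Cmod_gt_0.
  set (eps := Re a / 2 / (Cmod c + 1)).
  assert (Heps : 0 < eps) by (unfold eps; repeat apply Rdiv_lt_0_compat; lra).
  assert (Heps_c : eps * Cmod c <= Re a / 2).
  { apply Rle_trans with (eps * (Cmod c + 1)); [nra | ]. right. unfold eps. field. lra. }
  destruct (Cexp_mult_expansion h q ha qb J eps Heps h_expansion ha_0 q_expansion)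
    as [K [HK Hexpansion]].
  apply near_0_iff in Hexpansion. destruct Hexpansion as [r [Hr Hexpansion]].
  exists (r / Cmod d), (K * Cmod d ^ J). split; [now apply Rdiv_lt_0_compat | ].
  split; [apply Rmult_le_pos; [exact HK | apply pow_le; lra] | ]. intros t s Ht Hs.
  assert (Hts : 0 <= t * s) by nra.
  assert (Hsd : Cmod (RtoC s * d)%C = s * Cmod d) by (rewrite Cmod_mult, Cmod_RtoC_nonneg; lra).
  assert (Hz : 0 < Cmod (RtoC s * d)%C <= r).
  { rewrite Hsd. split; [nra | ]. apply Rle_trans with (r / Cmod d * Cmod d); [nra | ].
    right. field. lra. }
  specialize (Hexpansion _ Hz (c * RtoC (t * s) ^ mu)%C).
  rewrite Hsd, (Cmod_mult c), Cmod_pow, (Cmod_RtoC_nonneg (t * s) Hts) in Hexpansion.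
  fold (truncated t s) in Hexpansion. set (y := t * s) in *.
  assert (Hy : 0 <= y ^ mu) by now apply pow_le.
  unfold watson_integrand. fold y. set (E := (Cexp _ * q _)%C) in *.
  replace (kernel mu a t s * E - kernel mu a t s * truncated t s)%C
    with (kernel mu a t s * (E - truncated t s))%C by ring.
  rewrite Cmod_mult, Cmod_kernel. fold y.
  apply Rle_trans with
    (exp (- Re a * y ^ mu) * (K * (s * Cmod d) ^ J * exp (eps * (Cmod c * y ^ mu)))).
  { apply Rmult_le_compat_l; [left; apply exp_pos | exact Hexpansion]. }
  replace (exp (- Re a * y ^ mu) * (K * (s * Cmod d) ^ J * exp (eps * (Cmod c * y ^ mu))))
    with (K * Cmod d ^ J * (s ^ J * exp (- Re a * y ^ mu + eps * (Cmod c * y ^ mu))))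
    by (rewrite exp_plus, Rpow_mult_distr; ring).
  apply Rmult_le_compat_l; [apply Rmult_le_pos; [exact HK | apply pow_le; lra] | ].
  apply Rmult_le_compat_l; [apply pow_le; lra | ]. apply exp_le_compat. nra.
Qed.

Lemma watson_truncation_le_exp :
  exists r K, 0 < r /\ 0 <= K /\ forall t s, 0 < t -> 0 < s <= r ->
    Cmod (watson_integrand mu a c d h q t s - kernel mu a t s * truncated t s)%C
    <= K / t ^ J * exp (- (Re a / 4) * (t * s)).
Proof.
  destruct watson_truncation_le as [r [K [Hr [HK Hle]]]].
  destruct (pow_mult_exp_neg_pow_le p J (Re a / 2)) as [L [HL Hdecay]]; [lra | ].
  exists r, (K * L). split; [exact Hr | ]. split; [nra | ]. intros t s Ht Hs.
  assert (HtJ : 0 < t ^ J) by now apply pow_lt.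
  apply Rle_trans with (1 := Hle t s Ht Hs).
  specialize (Hdecay (t * s) ltac:(nra)). rewrite Rpow_mult_distr in Hdecay. fold mu in Hdecay.
  replace (K * L / t ^ J * exp (- (Re a / 4) * (t * s)))
    with (K * (L * exp (- (Re a / 2 / 2) * (t * s)) / t ^ J)).
  - apply Rmult_le_compat_l; [exact HK | ].
    apply (Rmult_le_reg_l (t ^ J)); [exact HtJ | ]. rewrite <- Rmult_assoc.
    apply Rle_trans with (1 := Hdecay). right. field. lra.
  - replace (Re a / 2 / 2) with (Re a / 4) by field. field. lra.
Qed.

Lemma is_RInt_truncated (del t : R) :
  0 <= del ->
  is_RInt_C (fun s => kernel mu a t s * truncated t s)%C 0 del (moment_sum del t).
Proof.
  intros Hdel.
  apply (is_RInt_ext (V := C_R_NormedModule) (fun s => Csum (fun k => Csum (fun j =>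
    coef k j * RtoC t ^ (mu * k) * (kernel mu a t s * RtoC s ^ (mu * k + j))) J) J)%C).
  - intros s _. unfold truncated. rewrite <- Csum_mult_l. apply Csum_ext. intros k _.
    unfold ps_trunc. rewrite <- !Csum_mult_l. apply Csum_ext. intros j _. unfold coef.
    rewrite RtoC_mult, !Cpow_mult_l, <- !Cpow_mult_r, Cpow_add_r. ring.
  - apply (is_RInt_Csum (fun k s => Csum (fun j =>
      coef k j * RtoC t ^ (mu * k) * (kernel mu a t s * RtoC s ^ (mu * k + j))) J)%C). intros k _.
    apply (is_RInt_Csum (fun j s =>
      coef k j * RtoC t ^ (mu * k) * (kernel mu a t s * RtoC s ^ (mu * k + j)))%C). intros j _.
    now apply is_RInt_Cmult_l, is_RInt_moment.
Qed.

Lemma moment_sum_expansion (del : R) :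
  (forall i, has_moment mu a del i (m i)) ->
  negligible (fun t =>
    moment_sum del t - Csum (fun j => d ^ j / RtoC t ^ S j * watson_coef mu c ha qb m j) J)%C.
Proof.
  intros Hm. unfold moment_sum.
  apply (negligible_ext (fun t => Csum (fun k => Csum (fun j => coef k j * (RtoC t ^ (mu * k) *
    (moment mu a del (mu * k + j) t - m (mu * k + j)%nat / RtoC t ^ S (mu * k + j)))) J) J)%C).
  - apply filter_imp with (2 := infty_neq_0). intros t Ht.
    rewrite (Csum_ext (fun j => d ^ j / RtoC t ^ S j * watson_coef mu c ha qb m j)%C
      (fun j => Csum (fun k => coef k j * m (mu * k + j)%nat / RtoC t ^ S j) J)%C).
    + rewrite (Csum_exchange (fun j k => coef k j * m (mu * k + j)%nat / RtoC t ^ S j)%C J J).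
      rewrite <- Csum_minus. apply Csum_ext. intros k _.
      rewrite <- Csum_minus. apply Csum_ext. intros j _.
      replace (S (mu * k + j)) with (mu * k + S j)%nat by lia.
      rewrite (Cpow_add_r _ (mu * k)). field. split; now apply Cpow_nz.
    + intros j Hj. unfold watson_coef.
      rewrite <- (Csum_trailing_0 _ (S j) J), <- Csum_mult_l; [ | lia | ].
      * apply Csum_ext. intros k _. unfold coef, Cdiv. ring.
      * intros k Hk. rewrite ps_mul_pow_low_order by (auto; lia). ring.
  - apply (negligible_Csum (fun k t => Csum (fun j => coef k j * (RtoC t ^ (mu * k) *
      (moment mu a del (mu * k + j) t - m (mu * k + j)%nat / RtoC t ^ S (mu * k + j)))) J)%C).
    intros k _.
    apply (negligible_Csum (fun j t => coef k j * (RtoC t ^ (mu * k) *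
      (moment mu a del (mu * k + j) t - m (mu * k + j)%nat / RtoC t ^ S (mu * k + j))))%C).
    intros j _. apply negligible_Cmult_l, (negligible_mult_l (mu * k)); [apply is_O_RtoC_pow | ].
    apply Hm.
Qed.

Lemma watson_lemma :
  exists r, 0 < r /\ forall (del : R) (g : R -> R -> C), 0 < del <= r ->
  (forall i, has_moment mu a del i (m i)) ->
  (forall t, 0 < t -> ex_RInt_C (g t) 0 del) ->
  (forall t s, 0 < t -> 0 < s < del -> g t s = watson_integrand mu a c d h q t s) ->
  is_O infty
    (fun t => RInt_C (g t) 0 del
       - Csum (fun j => d ^ j / RtoC t ^ S j * watson_coef mu c ha qb m j) J)%C
    (fun t => / t ^ S J).
Proof.
  destruct watson_truncation_le_exp as [r [K [Hr [HK Hle]]]].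
  exists r. split; [exact Hr | ]. intros del g Hdel Hm Hint Hg.
  apply (is_O_ext (fun t => (RInt_C (g t) 0 del - moment_sum del t) + (moment_sum del t
    - Csum (fun j => d ^ j / RtoC t ^ S j * watson_coef mu c ha qb m j) J))%C).
  { apply filter_forall. intros t. ring. }
  apply is_O_plus; [ | now apply moment_sum_expansion].
  exists (K * (4 / Re a)). assert (H4 : 0 < 4 / Re a) by (apply Rdiv_lt_0_compat; lra).
  split; [nra | ]. apply filter_imp with (2 := infty_ge 1). intros t Ht.
  assert (HtJ : 0 < t ^ J) by (apply pow_lt; lra).
  apply Rle_trans with (K / t ^ J * (/ (Re a / 4 * t) * (1 - exp (- (Re a / 4) * (t * del))))).
  - apply (Cmod_is_RInt_le (fun s => g t s - kernel mu a t s * truncated t s)%C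
      (fun s => K / t ^ J * exp (- (Re a / 4) * (t * s))) 0 del); [lra | | | ].
    + intros s Hs. rewrite Hg by lra. apply Hle; lra.
    + apply is_RInt_Cminus; [ | apply is_RInt_truncated; lra].
      apply is_RInt_C_RInt, Hint. lra.
    + apply (is_RInt_scal (V := R_NormedModule)), is_RInt_exp_neg; lra.
  - replace (K * (4 / Re a) * / t ^ S J) with (K / t ^ J * (/ (Re a / 4 * t) * 1))
      by (simpl; field; lra).
    apply Rmult_le_compat_l; [now apply Rdiv_le_0_compat | ].
    apply Rmult_le_compat_l; [left; apply Rinv_0_lt_compat; nra | ].
    assert (He := exp_pos (- (Re a / 4) * (t * del))). lra.
Qed.

End Watson.

(** * The Gaussian integral *)

Definition gauss_integral (x : R) : R := RInt (fun y => exp (- (y * y / 2))) 0 x.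

(* [gauss_integral x ^ 2 + 2 * gauss_complement x] does not depend on [x], and
   [gauss_complement] vanishes at infinity. *)
Definition gauss_complement (x : R) : R :=
  RInt (fun u => exp (- (x * x * (1 + u * u) / 2)) / (1 + u * u)) 0 1.

Lemma continuous_gauss (y : R) : continuous (fun y => exp (- (y * y / 2))) y.
Proof.
  apply (ex_derive_continuous (K := R_AbsRing) (V := R_NormedModule)). auto_derive. trivial.
Qed.

Lemma ex_RInt_gauss (a b : R) : ex_RInt (fun y => exp (- (y * y / 2))) a b.
Proof.
  apply (ex_RInt_continuous (V := R_CompleteNormedModule)). intros y _. apply continuous_gauss.
Qed.

Lemma ex_RInt_gauss_complement (x : R) :
  ex_RInt (fun u => exp (- (x * x * (1 + u * u) / 2)) / (1 + u * u)) 0 1.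
Proof.
  apply (ex_RInt_continuous (V := R_CompleteNormedModule)). intros u _.
  apply (ex_derive_continuous (K := R_AbsRing) (V := R_NormedModule)). auto_derive. nra.
Qed.

Lemma is_derive_gauss_integral (x : R) : is_derive gauss_integral x (exp (- (x * x / 2))).
Proof.
  apply (is_derive_RInt (V := R_NormedModule) (fun y => exp (- (y * y / 2))) gauss_integral 0).
  - apply filter_forall. intros b.
    apply (RInt_correct (V := R_CompleteNormedModule)), ex_RInt_gauss.
  - apply continuous_gauss.
Qed.

Lemma is_derive_gauss_complement_integrand (u x : R) :
  is_derive (fun x => exp (- (x * x * (1 + u * u) / 2)) / (1 + u * u)) x
    (- x * exp (- (x * x * (1 + u * u) / 2))).
Proof.
  assert (Hu : 0 < 1 + u * u) by nra. auto_derive; [trivial | ].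
  replace (- (x * x * (1 + u * u) * / 2)) with (- (x * x * (1 + u * u) / 2)) by (unfold Rdiv; ring).
  field. lra.
Qed.

Lemma is_derive_gauss_complement (x : R) :
  is_derive gauss_complement x (RInt (fun u => - x * exp (- (x * x * (1 + u * u) / 2))) 0 1).
Proof.
  assert (HD : forall u y, Derive (fun x => exp (- (x * x * (1 + u * u) / 2)) / (1 + u * u)) y =
    - y * exp (- (y * y * (1 + u * u) / 2))).
  { intros u y. apply is_derive_unique, is_derive_gauss_complement_integrand. }
  rewrite <-
    (RInt_ext (fun u => Derive (fun x => exp (- (x * x * (1 + u * u) / 2)) / (1 + u * u)) x))
    by (intros u _; apply HD).
  apply (is_derive_RInt_param (fun x u => exp (- (x * x * (1 + u * u) / 2)) / (1 + u * u))).
  - apply filter_forall. intros y u _. eexists. apply is_derive_gauss_complement_integrand.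
  - intros u _. apply (continuity_2d_pt_ext (fun y u => - y * exp (- (y * y * (1 + u * u) / 2)))).
    { intros y u'. now rewrite HD. }
    apply continuity_2d_pt_mult; [apply continuity_2d_pt_opp, continuity_2d_pt_id1 | ].
    apply (continuity_1d_2d_pt_comp exp (fun y u => - (y * y * (1 + u * u) / 2))).
    { apply derivable_continuous_pt, derivable_pt_exp. }
    unfold Rdiv. repeat first [ apply continuity_2d_pt_opp | apply continuity_2d_pt_mult
      | apply continuity_2d_pt_plus | apply continuity_2d_pt_const
      | apply continuity_2d_pt_id1 | apply continuity_2d_pt_id2 ].
  - apply filter_forall. intros y. apply ex_RInt_gauss_complement.
Qed.

Lemma RInt_gauss_complement_derivative (x : R) :
  RInt (fun u => - x * exp (- (x * x * (1 + u * u) / 2))) 0 1 =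
  - (exp (- (x * x / 2)) * gauss_integral x).
Proof.
  assert (H := RInt_correct (V := R_CompleteNormedModule) _ _ _
    (ex_RInt_gauss (x * 0 + 0) (x * 1 + 0))).
  apply (is_RInt_comp_lin (V := R_NormedModule)) in H.
  apply (is_RInt_scal (V := R_NormedModule) _ _ _ (- exp (- (x * x / 2)))) in H.
  apply is_RInt_unique. evar_last.
  - apply is_RInt_ext with (2 := H). intros u _. unfold scal; simpl; unfold mult; simpl.
    replace (- (x * x * (1 + u * u) / 2))
      with (- (x * x / 2) + - ((x * u + 0) * (x * u + 0) / 2)) by field.
    rewrite exp_plus. ring.
  - rewrite Rmult_0_r, Rmult_1_r, !Rplus_0_r. fold (gauss_integral x).
    unfold scal; simpl; unfold mult; simpl. ring.
Qed.

Lemma RInt_inv_1_plus_sqr : RInt (fun u => / (1 + u²)) 0 1 = PI / 4.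
Proof.
  apply is_RInt_unique. replace (PI / 4) with (minus (atan 1) (atan 0)).
  - apply (is_RInt_derive (V := R_CompleteNormedModule)).
    + intros u _. apply is_derive_atan.
    + intros u _. apply (ex_derive_continuous (K := R_AbsRing) (V := R_NormedModule)).
      unfold Rsqr. auto_derive. nra.
  - rewrite atan_1, atan_0. unfold minus, plus, opp. simpl. ring.
Qed.

Lemma gauss_integral_complement (x : R) :
  0 <= x -> gauss_integral x * gauss_integral x + 2 * gauss_complement x = PI / 2.
Proof.
  intros Hx. set (G := fun x => gauss_integral x * gauss_integral x + 2 * gauss_complement x).
  assert (G0 : G 0 = PI / 2).
  { unfold G, gauss_integral, gauss_complement. rewrite RInt_point.
    rewrite (RInt_ext _ (fun u => / (1 + u²))).
    - rewrite RInt_inv_1_plus_sqr. unfold zero. simpl. field.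
    - intros u _. replace (- (0 * 0 * (1 + u * u) / 2)) with 0 by field.
      rewrite exp_0. apply Rmult_1_l. }
  change (G x = PI / 2). destruct Hx as [Hx | <-]; [ | exact G0].
  rewrite <- G0. symmetry. apply (eq_is_derive (V := R_NormedModule) G 0 x); [ | exact Hx].
  intros t _. assert (HA := is_derive_gauss_integral t).
  assert (HB := is_derive_gauss_complement t).
  rewrite RInt_gauss_complement_derivative in HB. evar_last.
  - apply (is_derive_plus (V := R_NormedModule)).
    + exact (is_derive_mult _ _ _ _ _ HA HA Rmult_comm).
    + exact (is_derive_scal _ _ 2 _ HB).
  - unfold plus, mult, zero. simpl. ring.
Qed.

Lemma gauss_complement_bounds (x : R) : 0 <= gauss_complement x <= exp (- (x * x / 2)).
Proof.
  assert (Hex := ex_RInt_gauss_complement x). unfold gauss_complement. split.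
  - apply RInt_ge_0; [lra | exact Hex | ]. intros u _.
    apply Rdiv_le_0_compat; [left; apply exp_pos | nra].
  - replace (exp (- (x * x / 2))) with (RInt (fun _ => exp (- (x * x / 2))) 0 1).
    2: { rewrite RInt_const. unfold scal; simpl; unfold mult; simpl. ring. }
    apply RInt_le; [lra | exact Hex | apply (ex_RInt_const (V := R_NormedModule)) | ].
    intros u _. assert (He := exp_pos (- (x * x * (1 + u * u) / 2))).
    apply Rle_trans with (exp (- (x * x * (1 + u * u) / 2))).
    + apply Rle_div_l; nra.
    + apply exp_le_compat. assert (0 <= x * x * (u * u)) by (apply Rmult_le_pos; nra). lra.
Qed.

Lemma gauss_integral_limit (x : R) :
  0 <= x -> Rabs (gauss_integral x - sqrt (PI / 2)) <= 2 * exp (- (x * x / 2)).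
Proof.
  intros Hx. assert (E := gauss_integral_complement x Hx). assert (HB := gauss_complement_bounds x).
  assert (HA : 0 <= gauss_integral x).
  { apply RInt_ge_0; [exact Hx | apply ex_RInt_gauss | ]. intros; left; apply exp_pos. }
  assert (HP : 1 <= PI / 2) by (generalize PI2_1; unfold PI2; lra).
  assert (Hs : sqrt (PI / 2) * sqrt (PI / 2) = PI / 2) by (apply sqrt_sqrt; lra).
  assert (Hs1 : 1 <= sqrt (PI / 2)) by (rewrite <- sqrt_1; now apply sqrt_le_1_alt).
  set (r := sqrt (PI / 2)) in *.
  assert (Hfactor : (r - gauss_integral x) * (r + gauss_integral x) = 2 * gauss_complement x)
    by lra.
  assert (0 <= r - gauss_integral x) by (apply Rnot_lt_le; intro; nra).
  rewrite Rabs_minus_sym, Rabs_pos_eq by lra. nra.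
Qed.

Lemma kernel_gauss (t s : R) : kernel 2 (/ 2) t s = RtoC (exp (- (t * s * (t * s) / 2))).
Proof.
  rewrite <- Cexp_RtoC. unfold kernel. f_equal. apply injective_projections; simpl; field.
Qed.

Lemma moment_gauss_0 (del t : R) :
  0 < t -> 0 <= del -> moment 2 (/ 2) del 0 t = RtoC (/ t * gauss_integral (t * del)).
Proof.
  intros Ht Hdel. apply (is_RInt_C_unique _ _ _ _ _ (is_RInt_moment _ _ _ _ _ Hdel)).
  apply (is_RInt_ext (V := C_R_NormedModule) (fun s => RtoC (exp (- (t * s * (t * s) / 2))))).
  { intros s _. rewrite kernel_gauss. simpl. now rewrite Cmult_1_r. }
  apply is_RInt_RtoC. set (G := fun s => / t * gauss_integral (t * s)).
  replace (/ t * gauss_integral (t * del)) with (minus (G del) (G 0)).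
  - apply (is_RInt_derive (V := R_CompleteNormedModule)).
    + intros s _. evar_last.
      * apply (is_derive_scal (fun s => gauss_integral (t * s))).
        apply (is_derive_comp gauss_integral); [apply is_derive_gauss_integral | ].
        apply (is_derive_scal (fun s => s)), (is_derive_id (K := R_AbsRing)).
      * unfold scal, one; simpl; unfold mult; simpl. field. lra.
    + intros s _. apply (ex_derive_continuous (K := R_AbsRing) (V := R_NormedModule)).
      auto_derive. trivial.
  - unfold G, minus, plus, opp. simpl. rewrite Rmult_0_r. unfold gauss_integral at 2.
    rewrite RInt_point. unfold zero. simpl. ring.
Qed.

Lemma has_moment_gauss_0 (del : R) : 0 < del -> has_moment 2 (/ 2) del 0 (RtoC (sqrt (PI / 2))).
Proof.
  intros Hdel.
  apply (negligible_le 2 _ (fun t => kernel 2 (/ 2) t del)).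
  2: { apply negligible_kernel; [simpl; lra | exact Hdel]. }
  apply filter_imp with (2 := infty_ge 1). intros t Ht. rewrite moment_gauss_0 by lra.
  rewrite Cpow_1_r, <- RtoC_div, <- RtoC_minus, kernel_gauss, !Cmod_R by lra.
  rewrite (Rabs_pos_eq (exp _)) by (left; apply exp_pos).
  replace (/ t * gauss_integral (t * del) - sqrt (PI / 2) / t)
    with (/ t * (gauss_integral (t * del) - sqrt (PI / 2))) by (field; lra).
  rewrite Rabs_mult, Rabs_pos_eq by (left; apply Rinv_0_lt_compat; lra).
  assert (Hlim := gauss_integral_limit (t * del) ltac:(nra)).
  assert (Hinv := inv_pow_le_1 1 t Ht). rewrite pow_1 in Hinv.
  apply Rle_trans with (2 := Hlim). rewrite <- (Rmult_1_l (Rabs _)) at 2.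
  apply Rmult_le_compat_r; [apply Rabs_pos | exact Hinv].
Qed.

Definition gauss_moment (i : nat) : C :=
  if Nat.even i then RtoC (INR (dfact (i - 1)) * sqrt (PI / 2)) else RtoC (INR (dfact (i - 1))).

Lemma gauss_moment_SS (i : nat) :
  gauss_moment (S (S i)) = (RtoC (INR (S i)) * gauss_moment i)%C.
Proof.
  assert (E : INR (dfact (S (S i) - 1)) = INR (S i) * INR (dfact (i - 1))).
  { rewrite <- mult_INR. f_equal. destruct i as [ | i]; [reflexivity | ].
    replace (S (S (S i)) - 1)%nat with (S (S i)) by lia. now replace (S i - 1)%nat with i by lia. }
  unfold gauss_moment. change (Nat.even (S (S i))) with (Nat.even i). rewrite E.
  destruct (Nat.even i); rewrite !RtoC_mult; ring.
Qed.

Lemma has_moment_gauss (del : R) (i : nat) : 0 < del -> has_moment 2 (/ 2) del i (gauss_moment i).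
Proof.
  intros Hdel. assert (Hhalf : 0 < Re (/ 2)) by (simpl; lra).
  assert (E2 : (RtoC (INR 2) * / 2)%C = 1%C) by (replace (INR 2) with 2 by (simpl; ring); field).
  assert (H : has_moment 2 (/ 2) del i (gauss_moment i)
    /\ has_moment 2 (/ 2) del (S i) (gauss_moment (S i))); [ | apply H].
  induction i as [ | i [IH1 IH2]]; split.
  - unfold gauss_moment. simpl. rewrite Rmult_1_l. now apply has_moment_gauss_0.
  - assert (H := has_moment_pred_exponent 1 (/ 2) del Hhalf Hdel). rewrite E2 in H.
    now replace (/ 1)%C with (gauss_moment 1) in H by (unfold gauss_moment; simpl; field).
  - exact IH2.
  - assert (H := has_moment_add_exponent 1 (/ 2) del i _ Hhalf Hdel IH1). rewrite E2 in H.
    rewrite gauss_moment_SS. now replace (RtoC (INR (S i)) * gauss_moment i / 1)%C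
      with (RtoC (INR (S i)) * gauss_moment i)%C in H by field.
Qed.

(** * The logarithm and powers near 1 *)

Lemma Clog_1 : Clog 1 = 0%C.
Proof.
  unfold Clog, Carg. rewrite Cmod_1, ln_1, re_RtoC, im_RtoC.
  destruct (Rlt_dec 0 1) as [_ | H]; [ | lra]. unfold Rdiv. rewrite Rmult_0_l, atan_0. reflexivity.
Qed.

Lemma Clog_RtoC (x : R) : 0 < x -> Clog (RtoC x) = RtoC (ln x).
Proof.
  intros Hx. unfold Clog, Carg. rewrite Cmod_RtoC_nonneg, re_RtoC, im_RtoC by lra.
  destruct (Rlt_dec 0 x) as [_ | H]; [ | lra]. unfold Rdiv. rewrite Rmult_0_l, atan_0. reflexivity.
Qed.

Lemma Clog_right_half_plane (z : C) :
  0 < Re z -> Clog z = (/ 2 * ln (Re z * Re z + Im z * Im z), atan (Im z / Re z)).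
Proof.
  intros Hz. unfold Clog, Carg. destruct (Rlt_dec 0 (Re z)) as [_ | H]; [ | contradiction].
  f_equal. assert (Hm : 0 < Cmod z) by now apply Cmod_gt_0, Re_pos_neq_0.
  replace (Re z * Re z + Im z * Im z) with (Cmod z * Cmod z).
  - rewrite ln_mult by exact Hm. field.
  - assert (E := Cmod2_alt z). simpl in E. lra.
Qed.

Lemma Cexp_Clog (z : C) : 0 < Re z -> Cexp (Clog z) = z.
Proof.
  intros Hz. assert (Hm : 0 < Cmod z) by now apply Cmod_gt_0, Re_pos_neq_0.
  unfold Cexp, Clog, Carg; simpl. destruct (Rlt_dec 0 (Re z)) as [_ | H]; [ | contradiction].
  rewrite exp_ln by exact Hm.
  assert (Hq : sqrt (1 + (Im z / Re z)²) = Cmod z / Re z).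
  { replace (1 + (Im z / Re z)²) with ((Cmod z / Re z)²).
    - apply sqrt_Rsqr. left. now apply Rdiv_lt_0_compat.
    - apply (Rmult_eq_reg_r (Re z * Re z)); [ | nra]. unfold Rsqr.
      transitivity (Cmod z ^ 2); [field; lra | ]. rewrite Cmod2_alt. field. lra. }
  rewrite cos_atan, sin_atan, Hq. apply injective_projections; simpl.
  - change (Cmod z * (1 / (Cmod z / Re z)) = Re z). field. lra.
  - change (Cmod z * (Im z / Re z / (Cmod z / Re z)) = Im z). field. lra.
Qed.

Lemma is_derive_Clog (f : R -> C) (x : R) (l : C) :
  0 < Re (f x) -> is_derive_C f x l -> is_derive_C (fun t => Clog (f t)) x (l / f x)%C.
Proof.
  intros Hpos Hf. assert (Hc := continuous_is_derive_C _ _ _ Hf).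
  apply is_derive_C_iff in Hf. destruct Hf as [Hu Hw].
  apply continuous_C_iff in Hc. destruct Hc as [Hc _].
  set (u := fun t => Re (f t)) in *. set (w := fun t => Im (f t)) in *.
  change (0 < u x) in Hpos. assert (Hs : 0 < u x * u x + w x * w x) by nra.
  assert (Hloc : locally x (fun t => 0 < u t)) by (apply Hc, open_gt, Hpos).
  assert (Ed : (l / f x)%C = ((Re l * u x + Im l * w x) / (u x * u x + w x * w x),
                             (Im l * u x - Re l * w x) / (u x * u x + w x * w x))).
  { unfold u, w, Re, Im in *. apply injective_projections; simpl; field; nra. }
  rewrite Ed. apply is_derive_C_iff.
  assert (Eu : ex_derive u x) by now exists (Re l).
  assert (Ew : ex_derive w x) by now exists (Im l).
  assert (Du : Derive (fun t => u t) x = Re l) by now apply is_derive_unique.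
  assert (Dw : Derive (fun t => w t) x = Im l) by now apply is_derive_unique.
  split.
  - apply (is_derive_ext_loc (fun t => / 2 * ln (u t * u t + w t * w t))).
    + apply filter_imp with (2 := Hloc). intros t Ht. now rewrite Clog_right_half_plane.
    + auto_derive; [repeat split; trivial | ]. rewrite Du, Dw. simpl. field. lra.
  - apply (is_derive_ext_loc (fun t => atan (w t / u t))).
    + apply filter_imp with (2 := Hloc). intros t Ht. now rewrite Clog_right_half_plane.
    + auto_derive; [repeat split; trivial; lra | ]. rewrite Du, Dw. simpl. field. split; nra.
Qed.

Lemma half_le_Re_1_minus (z : C) : Cmod z <= / 2 -> / 2 <= Re (1 - z)%C.
Proof.
  intros Hz. assert (H := Re_le_Cmod z). unfold Cminus. rewrite re_plus, re_opp, re_RtoC. lra.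
Qed.

Lemma one_minus_neq_0 (z : C) : Cmod z <= / 2 -> (1 - z)%C <> 0%C.
Proof. intros Hz. apply Re_pos_neq_0. assert (H := half_le_Re_1_minus z Hz). lra. Qed.

Lemma Cmod_inv_1_minus_le (z : C) : Cmod z <= / 2 -> Cmod (/ (1 - z))%C <= 2.
Proof.
  intros Hz. rewrite Cmod_inv by now apply one_minus_neq_0. rewrite <- (Rinv_inv 2).
  apply Rinv_le_contravar; [lra | ]. apply Rle_trans with (2 := Re_le_Cmod _).
  now apply half_le_Re_1_minus.
Qed.

Lemma is_derive_Clog_1_minus (z : C) (s : R) :
  Cmod (RtoC s * z)%C <= / 2 ->
  is_derive_C (fun t => Clog (1 - RtoC t * z)) s (z * - / (1 - RtoC s * z))%C.
Proof.
  intros Hs. evar_last.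
  - apply (is_derive_Clog (fun t => 1 - RtoC t * z)%C).
    + assert (H := half_le_Re_1_minus _ Hs). lra.
    + apply is_derive_Cminus; [apply is_derive_C_const | apply is_derive_dilation].
  - unfold Cdiv. ring.
Qed.

Definition log_coef (j : nat) : C := if Nat.eqb j 0 then RtoC 0 else RtoC (/ INR j).

Lemma geometric_remainder (z : C) (J : nat) :
  (1 - z)%C <> 0%C -> (/ (1 - z) - ps_trunc (fun _ => RtoC 1) J z = z ^ J * / (1 - z))%C.
Proof.
  intros Hz. unfold ps_trunc. induction J as [ | J IHJ]; [simpl; ring | ].
  simpl Csum. transitivity (/ (1 - z) - Csum (fun j => 1 * z ^ j) J - z ^ J)%C; [ring | ].
  rewrite IHJ, Cpow_S. now field.
Qed.

Lemma Clog_taylor (J : nat) (z : C) :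
  Cmod z <= / 2 -> Cmod (- Clog (1 - z) - ps_trunc log_coef (S J) z)%C <= 2 * Cmod z ^ S J.
Proof.
  intros Hz. replace (2 * Cmod z ^ S J) with (Cmod z * (Cmod z ^ J * 2)) by (simpl; ring).
  assert (Hsz : forall s, 0 <= s <= 1 -> Cmod (RtoC s * z)%C <= / 2).
  { intros s Hs. apply Rle_trans with (1 := Cmod_dilation_le s z Hs), Hz. }
  apply (ps_trunc_remainder_le (fun z => - Clog (1 - z))%C (fun z => / (1 - z))%C).
  - intros s Hs. evar_last.
    + apply (is_derive_opp (V := C_R_NormedModule)), is_derive_Clog_1_minus. auto.
    + change (- (z * - / (1 - RtoC s * z)) = z * / (1 - RtoC s * z))%C. ring.
  - unfold Cminus. rewrite Copp_0, Cplus_0_r, Clog_1. apply Copp_0.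
  - intros s Hs. rewrite (ps_trunc_ext _ (fun _ => RtoC 1)).
    + rewrite geometric_remainder, Cmod_mult, Cmod_pow by (apply one_minus_neq_0; auto).
      apply Rmult_le_compat.
      * apply pow_le, Cmod_ge_0.
      * apply Cmod_ge_0.
      * apply pow_incr. split; [apply Cmod_ge_0 | now apply Cmod_dilation_le].
      * apply Cmod_inv_1_minus_le. auto.
    + intros j. unfold log_coef. rewrite RtoC_inv by (apply not_0_INR; lia).
      apply Cinv_r, RtoC_INR_S_neq_0.
Qed.

Lemma has_expansion_neg_Clog : has_expansion (fun z => - Clog (1 - z))%C log_coef.
Proof.
  apply has_expansion_of_S. intros J. exists 2. split; [lra | ].
  apply filter_imp with (2 := near_0_Cmod_le (/ 2) ltac:(lra)). apply Clog_taylor.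
Qed.

Lemma Cmod_Clog_1_minus_le (z : C) : Cmod z <= / 2 -> Cmod (Clog (1 - z)) <= 1.
Proof.
  intros Hz. assert (H := Clog_taylor 0 z Hz). rewrite <- Cmod_opp.
  replace (- Clog (1 - z) - ps_trunc log_coef 1 z)%C with (- Clog (1 - z))%C in H.
  - simpl in H. lra.
  - unfold ps_trunc, log_coef. simpl. ring.
Qed.

Definition binomial_coef (v : C) (j : nat) : C := (msign j * Cbinom v j)%C.

Lemma falling_S_l (v : C) (j : nat) : falling v (S j) = (v * falling (v - 1) j)%C.
Proof.
  induction j as [ | j IHj]; [simpl; ring | ].
  change (falling v (S (S j))) with (falling v (S j) * (v - RtoC (INR (S j))))%C.
  rewrite IHj, S_INR, RtoC_plus. simpl. ring.
Qed.

Lemma binomial_coef_S (v : C) (j : nat) :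
  (RtoC (INR (S j)) * binomial_coef v (S j) = - v * binomial_coef (v - 1) j)%C.
Proof.
  unfold binomial_coef, Cbinom, msign. rewrite falling_S_l.
  change (fact (S j)) with (S j * fact j)%nat. rewrite mult_INR, RtoC_mult, Cpow_S. field.
  split; [apply RtoC_fact_neq_0 | apply RtoC_INR_S_neq_0].
Qed.

Lemma binomial_coef_0 (v : C) : binomial_coef v 0 = 1%C.
Proof. unfold binomial_coef, Cbinom, msign. simpl. field. Qed.

Lemma is_derive_power_1_minus (v z : C) (s : R) :
  Cmod (RtoC s * z)%C <= / 2 ->
  is_derive_C (fun t => Cexp (v * Clog (1 - RtoC t * z))) s
    (z * (- v * Cexp ((v - 1) * Clog (1 - RtoC s * z))))%C.
Proof.
  intros Hs. evar_last.
  - apply is_derive_Cexp, is_derive_Cmult_l, is_derive_Clog_1_minus, Hs.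
  - assert (H := half_le_Re_1_minus _ Hs). assert (Hn := one_minus_neq_0 _ Hs). cbv beta.
    replace (v * Clog (1 - RtoC s * z))%C
      with ((v - 1) * Clog (1 - RtoC s * z) + Clog (1 - RtoC s * z))%C by ring.
    rewrite Cexp_plus, Cexp_Clog by lra. now field.
Qed.

Lemma binomial_remainder (N : nat) : forall v : C,
  exists K, 0 <= K /\ forall z, Cmod z <= / 2 ->
    Cmod (Cexp (v * Clog (1 - z)) - ps_trunc (binomial_coef v) N z)%C <= K * Cmod z ^ N.
Proof.
  induction N as [ | N IHN]; intros v.
  - exists (exp (Cmod v)). split; [left; apply exp_pos | ]. intros z Hz.
    unfold ps_trunc. simpl. unfold Cminus at 1. rewrite Copp_0, Cplus_0_r, Rmult_1_r.
    apply Rle_trans with (1 := Cmod_Cexp_le _), exp_le_compat. rewrite Cmod_mult.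
    assert (H := Cmod_Clog_1_minus_le z Hz). assert (Hv := Cmod_ge_0 v). nra.
  - destruct (IHN (v - 1)%C) as [K [HK H]]. assert (Hv := Cmod_ge_0 v).
    exists (Cmod v * K). split; [nra | ]. intros z Hz.
    replace (Cmod v * K * Cmod z ^ S N) with (Cmod z * (Cmod v * (K * Cmod z ^ N)))
      by (simpl; ring).
    assert (Hsz : forall s, 0 <= s <= 1 -> Cmod (RtoC s * z)%C <= / 2).
    { intros s Hs. apply Rle_trans with (1 := Cmod_dilation_le s z Hs), Hz. }
    apply (ps_trunc_remainder_le (fun z => Cexp (v * Clog (1 - z)))
      (fun z => - v * Cexp ((v - 1) * Clog (1 - z)))%C).
    + intros s Hs. apply is_derive_power_1_minus. auto.
    + unfold Cminus. rewrite Copp_0, Cplus_0_r, Clog_1, Cmult_0_r, Cexp_0.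
      symmetry. apply binomial_coef_0.
    + intros s Hs.
      rewrite (ps_trunc_ext _ (fun j => - v * binomial_coef (v - 1) j)%C) by apply binomial_coef_S.
      rewrite ps_trunc_mult_l.
      replace (_ - _)%C with (- v * (Cexp ((v - 1) * Clog (1 - RtoC s * z))
        - ps_trunc (binomial_coef (v - 1)) N (RtoC s * z)))%C by ring.
      rewrite Cmod_mult, Cmod_opp. apply Rmult_le_compat_l; [exact Hv | ].
      apply Rle_trans with (1 := H _ (Hsz s Hs)). apply Rmult_le_compat_l; [exact HK | ].
      apply pow_incr. split; [apply Cmod_ge_0 | now apply Cmod_dilation_le].
Qed.

Lemma has_expansion_power (v : C) :
  has_expansion (fun z => Cexp (v * Clog (1 - z))) (binomial_coef v).
Proof.
  intros N. destruct (binomial_remainder N v) as [K [HK H]]. exists K. split; [exact HK | ].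
  apply filter_imp with (2 := near_0_Cmod_le (/ 2) ltac:(lra)). exact H.
Qed.

Definition log_tail (m : nat) (z : C) : C :=
  ((- Clog (1 - z) - ps_trunc log_coef (S m) z) / z ^ m)%C.

Definition log_tail_coef (m j : nat) : C :=
  if Nat.eqb j 0 then RtoC 0 else RtoC (/ INR (j + m)).

Lemma has_expansion_log_tail (m : nat) : has_expansion (log_tail m) (log_tail_coef m).
Proof.
  apply has_expansion_ext with (2 := has_expansion_tail _ _ m has_expansion_neg_Clog).
  intros [ | j]; reflexivity.
Qed.

Lemma Clog_1_minus_split (m : nat) (z : C) :
  z <> 0%C -> Clog (1 - z) = (- ps_trunc log_coef (S m) z - z ^ m * log_tail m z)%C.
Proof. intros Hz. unfold log_tail. field. now apply Cpow_nz. Qed.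

(** * Identification of the coefficients *)

Lemma msign_sqr (k : nat) : (msign k * msign k = 1)%C.
Proof.
  unfold msign. rewrite <- Cpow_mult_l. replace (-1 * -1)%C with (RtoC 1) by ring. apply Cpow_1_l.
Qed.

Lemma msign_add (j k : nat) : msign (j + k) = (msign j * msign k)%C.
Proof. apply Cpow_add_r. Qed.

Lemma msign_neq_0 (k : nat) : msign k <> 0%C.
Proof. apply Cpow_nz, RtoC_neq_0. lra. Qed.

Lemma inv_msign (k : nat) : (/ msign k)%C = msign k.
Proof.
  assert (H := msign_neq_0 k). transitivity (msign k * msign k / msign k)%C; [ | now field].
  rewrite msign_sqr. unfold Cdiv. ring.
Qed.

Lemma msign_sub (j i : nat) : (i <= j)%nat -> msign (j - i) = (msign j * msign i)%C.
Proof.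
  intros Hij. replace j with (j - i + i)%nat at 2 by lia.
  rewrite msign_add, <- Cmult_assoc, msign_sqr. ring.
Qed.

Lemma msign_even (r : nat) : msign (2 * r) = 1%C.
Proof. simpl. rewrite Nat.add_0_r, msign_add. apply msign_sqr. Qed.

Lemma msign_1 : msign 1 = (- (1))%C.
Proof. unfold msign. simpl. ring. Qed.

Lemma Cpow_opp (z : C) (k : nat) : ((- z) ^ k = msign k * z ^ k)%C.
Proof. unfold msign. rewrite <- Cpow_mult_l. f_equal. ring. Qed.

Lemma binomial_convolution (a : nat -> C) (v : C) (X : nat -> C) (r : nat) :
  a 0%nat = 0%C ->
  Csum (fun k => X k * ps_mul (ps_pow a k) (binomial_coef v) r)%C (S r) =
  (msign r * Csum (fun i => msign i * Cbinom v (r - i) * Csum (fun k => X k * ps_pow a k i) (S i))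
     (S r))%C.
Proof.
  intros Ha.
  rewrite (Csum_ext _
    (fun k => Csum (fun i => X k * (ps_pow a k i * binomial_coef v (r - i))) (S r))%C).
  2: { intros k _. unfold ps_mul. now rewrite Csum_mult_l. }
  rewrite Csum_exchange, <- Csum_mult_l. apply Csum_ext. intros i Hi.
  rewrite (Csum_trailing_0 _ (S i) (S r)); [ | lia | ].
  - rewrite <- !Csum_mult_l. apply Csum_ext. intros k _.
    unfold binomial_coef. rewrite (msign_sub r i) by lia. ring.
  - intros k Hk. rewrite ps_pow_low_order by (auto; lia). ring.
Qed.

Lemma watson_coef_reweight (mu p : nat) (c v c0 c1 : C) (m Y : nat -> C) (r : nat) :
  (forall k, c0 * msign r * (exp_coef k * c ^ k * m (mu * k + r)%nat) = c1 * Y k)%C ->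
  (c0 * watson_coef mu c (log_tail_coef p) (binomial_coef v) m r =
   c1 * Csum (fun i => msign i * Cbinom v (r - i) *
          Csum (fun k => Y k * ps_pow (log_tail_coef p) k i) (S i)) (S r))%C.
Proof.
  intros HY.
  assert (E : watson_coef mu c (log_tail_coef p) (binomial_coef v) m r =
    Csum (fun k => exp_coef k * c ^ k * m (mu * k + r)%nat
                   * ps_mul (ps_pow (log_tail_coef p) k) (binomial_coef v) r)%C (S r))
    by (apply Csum_ext; intros k _; ring).
  rewrite E, binomial_convolution, Cmult_assoc, <- !Csum_mult_l by reflexivity.
  apply Csum_ext. intros i _.
  transitivity (msign i * Cbinom v (r - i) * (c0 * msign r *
    Csum (fun k => exp_coef k * c ^ k * m (mu * k + r)%nat
      * ps_pow (log_tail_coef p) k i) (S i)))%C;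
    [ring | ].
  transitivity (msign i * Cbinom v (r - i) *
    (c1 * Csum (fun k => Y k * ps_pow (log_tail_coef p) k i) (S i)))%C; [ | ring].
  f_equal. rewrite <- !Csum_mult_l. apply Csum_ext. intros k _.
  rewrite !Cmult_assoc, <- HY. ring.
Qed.

Lemma watson_coef_Ucoef (w v d : C) (r : nat) :
  (1 - w)%C <> 0%C -> d <> 0%C ->
  (w * d * d ^ r * watson_coef 1 (- d) (log_tail_coef 1) (binomial_coef v)
     (fun i => RtoC (INR (fact i)) / ((1 - w) * d) ^ S i) r = Ucoef r w v - kdelta r)%C.
Proof.
  intros Hw Hd. unfold Ucoef. set (total := Csum _ (S r)).
  replace (kdelta r - total - kdelta r)%C with (- (1) * total)%C by ring.
  apply (watson_coef_reweight 1 1 (- d) v (w * d * d ^ r) (- (1))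
    _ (fun k => w / (w - 1) ^ (r + k + 1) * (RtoC (INR (fact (r + k))) / RtoC (INR (fact k))))%C).
  intros k. replace (1 * k + r)%nat with (r + k)%nat by lia.
  assert (Hw1 : (w - 1)%C <> 0%C).
  { intros E. apply Hw. replace (1 - w)%C with (- (w - 1))%C by ring. rewrite E. ring. }
  replace (1 - w)%C with (- (w - 1))%C by ring.
  rewrite Cpow_mult_l, !Cpow_opp, Nat.add_1_r, !Cpow_S.
  change (S (r + k)) with (1 + (r + k))%nat. rewrite !msign_add, msign_1, (Cpow_add_r d).
  unfold exp_coef.
  assert (Hr := msign_neq_0 r). assert (Hk := msign_neq_0 k). assert (Hf := RtoC_fact_neq_0 k).
  assert (Hdr : (d ^ r)%C <> 0%C) by now apply Cpow_nz.
  assert (Hdk : (d ^ k)%C <> 0%C) by now apply Cpow_nz.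
  assert (Hwk : ((w - 1) ^ (r + k))%C <> 0%C) by now apply Cpow_nz.
  field. tauto.
Qed.

Definition saddle_coef (v : C) (j : nat) : C :=
  watson_coef 2 (- (1)) (log_tail_coef 2) (binomial_coef v) gauss_moment j.

Lemma saddle_coef_even (v : C) (r : nat) :
  saddle_coef v (2 * r) = (RtoC (sqrt (PI / 2)) * gam r v)%C.
Proof.
  rewrite <- (Cmult_1_l (saddle_coef v (2 * r))).
  apply (watson_coef_reweight 2 2 (- (1)) v 1 (RtoC (sqrt (PI / 2))) gauss_moment
    (fun k => RtoC (INR (dfact (2 * r + 2 * k - 1))) / (msign k * RtoC (INR (fact k))))%C).
  intros k. unfold gauss_moment, exp_coef.
  replace (2 * k + 2 * r)%nat with (2 * (r + k))%nat by lia. rewrite Nat.even_even.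
  replace (2 * r + 2 * k)%nat with (2 * (r + k))%nat by lia.
  rewrite Cpow_opp, Cpow_1_l, msign_even, RtoC_mult, <- (inv_msign k) at 1.
  field. split; [apply RtoC_fact_neq_0 | apply msign_neq_0].
Qed.

Lemma saddle_coef_odd (v : C) (r : nat) : saddle_coef v (2 * r + 1) = (rho r v - kdelta r)%C.
Proof.
  rewrite <- (Cmult_1_l (saddle_coef v (2 * r + 1))). unfold rho. set (total := Csum _ _).
  replace (kdelta r - total - kdelta r)%C with (- (1) * total)%C by ring. unfold total.
  apply (watson_coef_reweight 2 2 (- (1)) v 1 (- (1)) gauss_moment
    (fun k => RtoC (INR (dfact (2 * r + 2 * k))) / (msign k * RtoC (INR (fact k))))%C).
  intros k. unfold gauss_moment, exp_coef.
  replace (2 * k + (2 * r + 1))%nat with (2 * (r + k) + 1)%nat by lia. rewrite Nat.even_odd.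
  replace (2 * (r + k) + 1 - 1)%nat with (2 * r + 2 * k)%nat by lia.
  rewrite Cpow_opp, Cpow_1_l, msign_add, msign_even, msign_1, <- (inv_msign k) at 1.
  field. split; [apply RtoC_fact_neq_0 | apply msign_neq_0].
Qed.

(** * Contributions of an endpoint and of half a saddle *)

(* At [z = s d], the integrand of [e^(n w) int e^(- n w u) u^(n + v) du] near the endpoint
   [u = 1], in the coordinate [u = 1 - z]. *)
Definition ray_integrand (n : R) (w v d : C) (s : R) : C :=
  Cexp (RtoC n * (w * (RtoC s * d)) + (RtoC n + v) * Clog (1 - RtoC s * d)).

Lemma continuous_ray_integrand (n : R) (w v d : C) (s : R) :
  Cmod (RtoC s * d)%C <= / 2 -> continuous (ray_integrand n w v d) s.
Proof.
  intros Hs. eapply continuous_is_derive_C, is_derive_Cexp, is_derive_Cplus.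
  - apply is_derive_Cmult_l, is_derive_Cmult_l, is_derive_dilation.
  - apply is_derive_Cmult_l, is_derive_Clog_1_minus, Hs.
Qed.

Lemma ex_RInt_ray_integrand (n : R) (w v d : C) (del : R) :
  0 <= del -> del * Cmod d <= / 2 -> ex_RInt_C (ray_integrand n w v d) 0 del.
Proof.
  intros Hdel Hd. apply ex_RInt_C_continuous; [exact Hdel | ]. intros s Hs.
  apply continuous_ray_integrand. rewrite Cmod_mult, Cmod_RtoC_nonneg by lra.
  assert (H := Cmod_ge_0 d). nra.
Qed.

Lemma exists_mult_Cmod_le_half (d : C) (r : R) :
  0 < r -> exists r', 0 < r' <= r /\ forall del, 0 < del <= r' -> del * Cmod d <= / 2.
Proof.
  intros Hr. assert (Hd := Cmod_ge_0 d).
  exists (Rmin r (/ 2 / (Cmod d + 1))). split.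
  - split; [ | apply Rmin_l]. apply Rmin_pos; [exact Hr | apply Rdiv_lt_0_compat; lra].
  - intros del [Hdel1 Hdel2]. apply Rle_trans with (/ 2 / (Cmod d + 1) * (Cmod d + 1)).
    + assert (Hmin := Rmin_r r (/ 2 / (Cmod d + 1))). nra.
    + right. field. lra.
Qed.

Lemma is_O_mult_id (f : R -> C) (k : nat) :
  is_O infty f (fun n => / n ^ S k) -> is_O infty (fun n => RtoC n * f n)%C (fun n => / n ^ k).
Proof.
  intros H. apply (is_O_weaken 1 _ (fun n => n ^ 1 * / n ^ S k)); [lra | | ].
  - apply filter_imp with (2 := infty_ge 1). intros n Hn. right. simpl. field.
    split; [apply pow_nonzero | ]; lra.
  - apply is_O_mult with (2 := H).
    apply is_O_ext with (2 := is_O_RtoC_pow 1). apply filter_forall. intros n. apply Cpow_1_r.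
Qed.

Lemma ray_integrand_linear (n : R) (w v d : C) (s : R) :
  (RtoC s * d)%C <> 0%C ->
  ray_integrand n w v d s =
  watson_integrand 1 ((1 - w) * d) (- d) d (log_tail 1) (fun z => Cexp (v * Clog (1 - z))) n s.
Proof.
  intros Hz. unfold ray_integrand, watson_integrand, kernel. rewrite <- !Cexp_plus. f_equal.
  rewrite (Cmult_plus_distr_r (RtoC n)), (Clog_1_minus_split 1 _ Hz) at 1.
  unfold ps_trunc, log_coef. simpl. rewrite Rinv_1, RtoC_mult. ring.
Qed.

Lemma endpoint_contribution (w v d : C) (N : nat) :
  d <> 0%C -> 0 < Re ((1 - w) * d)%C ->
  exists r, 0 < r /\ forall del, 0 < del <= r -> del * Cmod d <= / 2 /\
    is_O infty
      (fun n => RtoC n * (w * d * RInt_C (ray_integrand n w v d) 0 del)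
         - Csum (fun r => (Ucoef r w v - kdelta r) / RtoC n ^ r) N)%C
      (fun n => / n ^ N).
Proof.
  intros Hd Ha. set (a := ((1 - w) * d)%C) in *.
  assert (Hw : (1 - w)%C <> 0%C).
  { intros E. unfold a in Ha. rewrite E, Cmult_0_l in Ha. simpl in Ha. lra. }
  destruct (watson_lemma 0 a (- d) d (log_tail 1) (fun z => Cexp (v * Clog (1 - z)))
    (log_tail_coef 1) (binomial_coef v) (fun i => RtoC (INR (fact i)) / a ^ S i)%C N
    Ha Hd (has_expansion_log_tail 1) eq_refl (has_expansion_power v)) as [r0 [Hr0 H]].
  destruct (exists_mult_Cmod_le_half d r0 Hr0) as [r [[Hr Hrr] Hhalf]].
  exists r. split; [exact Hr | ]. intros del Hdel.
  specialize (Hhalf del Hdel). split; [exact Hhalf | ].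
  specialize (H del (fun n => ray_integrand n w v d) ltac:(lra)).
  apply (is_O_ext (fun n => RtoC n * (w * d * (RInt_C (ray_integrand n w v d) 0 del
    - Csum (fun j => d ^ j / RtoC n ^ S j * watson_coef 1 (- d) (log_tail_coef 1) (binomial_coef v)
        (fun i => RtoC (INR (fact i)) / a ^ S i) j) N)))%C).
  - apply filter_imp with (2 := infty_neq_0). intros n Hn.
    transitivity (RtoC n * (w * d * RInt_C (ray_integrand n w v d) 0 del) -
      RtoC n * w * d * Csum (fun j => d ^ j / RtoC n ^ S j * watson_coef 1 (- d) (log_tail_coef 1)
        (binomial_coef v) (fun i => RtoC (INR (fact i)) / a ^ S i) j) N)%C; [ring | ].
    f_equal. f_equal. rewrite <- Csum_mult_l. apply Csum_ext. intros j _.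
    rewrite <- (watson_coef_Ucoef w v d j Hw Hd). fold a. rewrite Cpow_S. field.
    split; [now apply Cpow_nz | exact Hn].
  - apply is_O_mult_id, is_O_Cmult_l, H.
    + intros i. now apply has_moment_exp.
    + intros n _. apply ex_RInt_ray_integrand; lra.
    + intros n s Hn Hs. apply ray_integrand_linear, Cmult_neq_0; [apply RtoC_neq_0; lra | exact Hd].
Qed.

Lemma ray_integrand_saddle (t : R) (v d : C) (s : R) :
  (d * d = 1)%C -> (RtoC s * d)%C <> 0%C ->
  ray_integrand (t * t) 1 v d s =
  watson_integrand 2 (/ 2) (- (1)) d (log_tail 2) (fun z => Cexp (v * Clog (1 - z))) t s.
Proof.
  intros Hdd Hz. unfold ray_integrand, watson_integrand, kernel. rewrite <- !Cexp_plus. f_equal.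
  rewrite (Cmult_plus_distr_r (RtoC (t * t))), (Clog_1_minus_split 2 _ Hz) at 1.
  unfold ps_trunc, log_coef. simpl. rewrite Rinv_1, !RtoC_mult.
  set (h := log_tail 2 _). set (L := Clog _). rewrite RtoC_inv by lra.
  replace (RtoC (1 + 1)) with (RtoC 2) by (f_equal; ring).
  transitivity (RtoC t * RtoC t * (- (/ 2) * (RtoC s * RtoC s * (d * d))
    - RtoC s * RtoC s * (d * d) * h) + v * L)%C; [ring | ].
  rewrite Hdd. ring.
Qed.

Lemma sq2pin_sqr (t : R) : 0 <= t -> sq2pin (t * t) = (2 * (RtoC t * RtoC (sqrt (PI / 2))))%C.
Proof.
  intros Ht. unfold sq2pin. rewrite <- !RtoC_mult. f_equal. assert (HP := PI_RGT_0).
  replace (2 * PI * (t * t)) with ((2 * t) * (2 * t) * (PI / 2)) by field.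
  rewrite sqrt_mult, sqrt_square by nra. ring.
Qed.

Definition half_saddle_term (v d : C) (n : R) (r : nat) : C :=
  (/ RtoC n ^ r * (d * (rho r v - kdelta r) + gam r v / 2 * sq2pin n))%C.

Lemma saddle_partial_sum (v d : C) (N : nat) (t : R) :
  (d * d = 1)%C -> 0 < t ->
  (RtoC (t * t) * Csum (fun j => d ^ j / RtoC t ^ S j * saddle_coef v j) (2 * N) =
   Csum (half_saddle_term v d (t * t)) N)%C.
Proof.
  intros Hdd Ht. assert (Ht0 : RtoC t <> 0%C) by (apply RtoC_neq_0; lra).
  rewrite Csum_pairs, <- Csum_mult_l. apply Csum_ext. intros r _.
  assert (Hd2 : (d ^ (2 * r) = 1)%C).
  { rewrite Cpow_mult_r. simpl Cpow at 2. rewrite Cmult_1_r, Hdd. apply Cpow_1_l. }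
  unfold half_saddle_term. rewrite saddle_coef_even, saddle_coef_odd,
    sq2pin_sqr, !Nat.add_1_r by lra.
  rewrite !Cpow_S, Hd2, RtoC_mult, Cpow_mult_r. simpl (RtoC t ^ 2)%C. rewrite !Cmult_1_r.
  field. split; [now apply Cpow_nz, Cmult_neq_0 | exact Ht0].
Qed.

Lemma sqr_div_odd_pow (t : R) (N : nat) : 0 < t -> t ^ 2 * / t ^ S (2 * N) = t / (t * t) ^ N.
Proof.
  intros Ht. assert (HN : 0 < (t * t) ^ N) by (apply pow_lt; nra).
  replace (t ^ S (2 * N)) with (t * (t * t) ^ N).
  - field. lra.
  - change (t ^ S (2 * N)) with (t * t ^ (2 * N)).
    rewrite pow_mult. simpl (t ^ 2). now rewrite Rmult_1_r.
Qed.

Lemma half_saddle_contribution (v d : C) (N : nat) :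
  (d * d = 1)%C ->
  exists r, 0 < r /\ forall del, 0 < del <= r ->
    is_O infty
      (fun n => RtoC n * RInt_C (ray_integrand n 1 v d) 0 del - Csum (half_saddle_term v d n) N)%C
      (fun n => sqrt n / n ^ N).
Proof.
  intros Hdd.
  assert (Hd : d <> 0%C).
  { intros E. rewrite E, Cmult_0_l in Hdd. symmetry in Hdd. exact (C1_nz Hdd). }
  assert (Hhalf : 0 < Re (/ 2)) by (simpl; lra).
  destruct (watson_lemma 1 (/ 2) (- (1)) d (log_tail 2) (fun z => Cexp (v * Clog (1 - z)))
    (log_tail_coef 2) (binomial_coef v) gauss_moment (2 * N)
    Hhalf Hd (has_expansion_log_tail 2) eq_refl (has_expansion_power v)) as [r0 [Hr0 H]].
  destruct (exists_mult_Cmod_le_half d r0 Hr0) as [r [[Hr Hrr] Hdel_half]].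
  exists r. split; [exact Hr | ]. intros del Hdel. specialize (Hdel_half del Hdel).
  specialize (H del (fun t => ray_integrand (t * t) 1 v d) ltac:(lra)).
  fold (saddle_coef v) in H.
  assert (Ht : is_O infty (fun t => RtoC (t * t) * RInt_C (ray_integrand (t * t) 1 v d) 0 del
    - Csum (half_saddle_term v d (t * t)) N)%C (fun t => t / (t * t) ^ N)).
  { apply (is_O_ext (fun t => RtoC t ^ 2 * (RInt_C (ray_integrand (t * t) 1 v d) 0 del
      - Csum (fun j => d ^ j / RtoC t ^ S j * saddle_coef v j) (2 * N)))%C).
    { apply filter_imp with (2 := infty_ge 1). intros t Ht.
      rewrite <- saddle_partial_sum, RtoC_mult by (auto; lra). simpl. ring. }
    apply (is_O_weaken 1 _ (fun t => t ^ 2 * / t ^ S (2 * N))); [lra | | ].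
    { apply filter_imp with (2 := infty_ge 1). intros t Ht. rewrite sqr_div_odd_pow; lra. }
    apply is_O_mult; [apply is_O_RtoC_pow | apply H].
    - intros i. apply has_moment_gauss. lra.
    - intros t _. apply ex_RInt_ray_integrand; lra.
    - intros t s _ Hs. apply ray_integrand_saddle; [exact Hdd | ].
      apply Cmult_neq_0; [apply RtoC_neq_0; lra | exact Hd]. }
  apply (is_O_comp sqrt) with (1 := filterlim_sqrt_p) in Ht.
  destruct Ht as [K [HK Ht]]. exists K. split; [exact HK | ].
  generalize (filter_and _ _ (infty_ge 0) Ht). apply filter_imp. intros n [Hn Hb].
  now rewrite sqrt_sqrt in Hb.
Qed.

(** * The incomplete gamma function on the right half-plane *)

Lemma is_derive_id_mult_at_0 (g : R -> C) :
  continuous g 0 -> is_derive_C (fun t => RtoC t * g t)%C 0 (g 0).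
Proof.
  intros Hg. apply is_derive_C_of_o. intros eps.
  generalize (proj1 (continuous_C_Cmod g 0) Hg eps). apply filter_imp. intros y Hy.
  rewrite Rminus_0_r.
  replace (RtoC y * g y - 0 * g 0 - RtoC y * g 0)%C with (RtoC y * (g y - g 0))%C by ring.
  rewrite Cmod_mult, Cmod_R, Rmult_comm. apply Rmult_le_compat_r; [apply Rabs_pos | lra].
Qed.

(* The power [s ^ a] for real [s], extended by [0]: [Ccpow 0 a] is the junk value [1]. *)
Definition rpow (a : C) (s : R) : C :=
  if Rle_dec s 0 then RtoC 0 else Cexp (a * RtoC (ln s)).

Lemma rpow_pos (a : C) (s : R) : 0 < s -> rpow a s = Cexp (a * RtoC (ln s)).
Proof. intros Hs. unfold rpow. destruct (Rle_dec s 0); [lra | reflexivity]. Qed.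

Lemma rpow_nonpos (a : C) (s : R) : s <= 0 -> rpow a s = 0%C.
Proof. intros Hs. unfold rpow. now destruct (Rle_dec s 0). Qed.

Lemma rpow_1 (a : C) : rpow a 1 = 1%C.
Proof. rewrite rpow_pos, ln_1, Cmult_0_r by lra. apply Cexp_0. Qed.

Lemma rpow_plus_1 (a : C) (s : R) : rpow (a + 1) s = (RtoC s * rpow a s)%C.
Proof.
  destruct (Rle_dec s 0) as [Hs | Hs].
  - rewrite !rpow_nonpos by exact Hs. ring.
  - rewrite !rpow_pos, Cmult_plus_distr_r, Cexp_plus, Cmult_1_l, Cexp_RtoC, exp_ln by lra. ring.
Qed.

Lemma Cmod_rpow (a : C) (s : R) : 0 < s -> Cmod (rpow a s) = exp (Re a * ln s).
Proof. intros Hs. now rewrite rpow_pos, Cmod_Cexp, re_scal_r. Qed.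

Lemma locally_rpow_pos (a : C) (s : R) :
  0 < s -> locally s (fun t => Cexp (a * RtoC (ln t)) = rpow a t).
Proof.
  intros Hs. apply filter_imp with (P := fun t => 0 < t).
  - intros t Ht. now rewrite rpow_pos.
  - now apply open_gt.
Qed.

Lemma is_derive_rpow_pos (a : C) (s : R) :
  0 < s -> is_derive_C (rpow a) s (a * / RtoC s * rpow a s)%C.
Proof.
  intros Hs. apply is_derive_ext_loc with (1 := locally_rpow_pos a s Hs). evar_last.
  - apply is_derive_Cexp, is_derive_Cmult_l, is_derive_RtoC, is_derive_ln, Hs.
  - rewrite rpow_pos, RtoC_inv by lra. reflexivity.
Qed.

Lemma continuous_rpow (a : C) (s : R) : 0 < Re a -> 0 <= s -> continuous (rpow a) s.
Proof.
  intros Ha [Hs | <-]; [eapply continuous_is_derive_C, is_derive_rpow_pos, Hs | ].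
  apply continuous_C_Cmod. intros eps. assert (Heps := cond_pos eps).
  exists (mkposreal _ (exp_pos (ln eps / Re a))). intros y Hy.
  change (Rabs (y - 0) < exp (ln eps / Re a)) in Hy. rewrite Rminus_0_r in Hy.
  rewrite (rpow_nonpos a 0) by lra. unfold Cminus. rewrite Copp_0, Cplus_0_r.
  destruct (Rle_dec y 0) as [Hy0 | Hy0].
  - rewrite rpow_nonpos, Cmod_0 by exact Hy0. exact Heps.
  - rewrite Cmod_rpow by lra. rewrite Rabs_pos_eq in Hy by lra.
    rewrite <- (exp_ln eps Heps). apply exp_increasing.
    apply Rlt_le_trans with (Re a * (ln eps / Re a)); [ | right; field; lra].
    apply Rmult_lt_compat_l; [exact Ha | ]. rewrite <- (ln_exp (ln eps / Re a)).
    apply ln_increasing; lra.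
Qed.

Lemma is_derive_rpow_plus_1 (a : C) (s : R) :
  0 < Re a -> 0 <= s -> is_derive_C (rpow (a + 1)) s ((a + 1) * rpow a s)%C.
Proof.
  intros Ha [Hs | <-].
  - evar_last; [apply is_derive_rpow_pos, Hs | ]. rewrite rpow_plus_1. field.
    apply RtoC_neq_0. lra.
  - apply (is_derive_ext (V := C_R_NormedModule) (fun t => RtoC t * rpow a t)%C).
    + intros t. symmetry. apply rpow_plus_1.
    + replace ((a + 1) * rpow a 0)%C with (rpow a 0) by (rewrite rpow_nonpos by lra; ring).
      apply is_derive_id_mult_at_0, continuous_rpow; [exact Ha | lra].
Qed.

Definition laplace (g : R -> C) (z : C) : C := RInt_C (fun s => Cexp (- z * RtoC s) * g s)%C 0 1.

Lemma is_derive_Cexp_scal (c : C) (s : R) :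
  is_derive_C (fun s => Cexp (c * RtoC s)) s (c * Cexp (c * RtoC s))%C.
Proof.
  apply is_derive_Cexp. evar_last.
  - apply is_derive_Cmult_l, (is_derive_RtoC (fun s => s) s 1), (is_derive_id (K := R_AbsRing)).
  - apply Cmult_1_r.
Qed.

Lemma continuous_laplace_integrand (g : R -> C) (z : C) (s : R) :
  continuous g s -> continuous (fun s => Cexp (- z * RtoC s) * g s)%C s.
Proof.
  intros Hg. apply continuous_Cmult; [ | exact Hg].
  eapply continuous_is_derive_C, is_derive_Cexp_scal.
Qed.

Lemma is_RInt_laplace (g : R -> C) (z : C) :
  (forall s, 0 <= s <= 1 -> continuous g s) ->
  is_RInt_C (fun s => Cexp (- z * RtoC s) * g s)%C 0 1 (laplace g z).
Proof.
  intros Hg. apply is_RInt_C_RInt, ex_RInt_C_continuous; [lra | ].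
  intros s Hs. now apply continuous_laplace_integrand, Hg.
Qed.

Lemma laplace_integrand_remainder_le (z z1 g : C) (s h M : R) :
  0 <= s <= 1 -> Rabs h <= 1 -> Cmod g <= M ->
  Cmod (Cexp (- (z + RtoC h * z1) * RtoC s) * g - Cexp (- z * RtoC s) * g
        - RtoC h * (- z1 * (Cexp (- z * RtoC s) * (RtoC s * g))))%C
  <= exp (Cmod z) * (Cmod z1 ^ 2 * exp (Cmod z1)) * M * h ^ 2.
Proof.
  intros Hs Hh Hg. set (y := (- z1 * RtoC h * RtoC s)%C).
  replace (- (z + RtoC h * z1) * RtoC s)%C with (- z * RtoC s + y)%C by (unfold y; ring).
  replace (_ - _ - _)%C with (Cexp (- z * RtoC s) * (Cexp y - ps_trunc exp_coef 2 y) * g)%C.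
  2: { rewrite Cexp_plus. unfold ps_trunc, exp_coef. simpl. unfold y. field. }
  assert (Hz1 := Cmod_ge_0 z1). assert (Hh0 := Rabs_pos h).
  assert (Hy : Cmod y <= Cmod z1 * Rabs h).
  { unfold y. rewrite !Cmod_mult, Cmod_opp, Cmod_R, (Cmod_RtoC_nonneg s) by lra.
    assert (0 <= Cmod z1 * Rabs h) by nra. nra. }
  assert (Hexp : Cmod (Cexp (- z * RtoC s)) <= exp (Cmod z)).
  { apply Rle_trans with (1 := Cmod_Cexp_le _), exp_le_compat.
    rewrite Cmult_comm, <- (Cmod_opp z). now apply Cmod_dilation_le. }
  assert (Htaylor : Cmod (Cexp y - ps_trunc exp_coef 2 y)%C <= Cmod z1 ^ 2 * h ^ 2 * exp (Cmod z1)).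
  { apply Rle_trans with (1 := Cexp_taylor 2 y).
    apply Rmult_le_compat; [apply pow_le, Cmod_ge_0 | left; apply exp_pos | | ].
    - rewrite <- Rpow_mult_distr, <- (pow2_abs (Cmod z1 * h)),
      Rabs_mult, (Rabs_pos_eq (Cmod z1)) by lra.
      apply pow_incr. split; [apply Cmod_ge_0 | exact Hy].
    - apply exp_le_compat. nra. }
  rewrite !Cmod_mult.
  replace (exp (Cmod z) * (Cmod z1 ^ 2 * exp (Cmod z1)) * M * h ^ 2)
    with (exp (Cmod z) * (Cmod z1 ^ 2 * h ^ 2 * exp (Cmod z1)) * M) by ring.
  repeat (apply Rmult_le_compat; auto using Cmod_ge_0, Rmult_le_pos).
Qed.

Lemma is_derive_laplace (g : R -> C) (z0 z1 : C) (x : R) :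
  (forall s, 0 <= s <= 1 -> continuous g s) ->
  is_derive_C (fun t => laplace g (z0 + RtoC t * z1)) x
    (- z1 * laplace (fun s => RtoC s * g s)%C (z0 + RtoC x * z1))%C.
Proof.
  intros Hg. destruct (bounded_continuity (V := C_R_NormedModule) g 0 1 Hg) as [M HM].
  set (z := (z0 + RtoC x * z1)%C).
  apply (is_derive_C_of_quadratic _ _ _ (exp (Cmod z) * (Cmod z1 ^ 2 * exp (Cmod z1)) * M)).
  intros h Hh. fold z.
  replace (z0 + RtoC (x + h) * z1)%C with (z + RtoC h * z1)%C
    by (unfold z; rewrite RtoC_plus; ring).
  rewrite <- (Rmult_1_r (_ * h ^ 2)), <- (Rminus_0_r 1).
  apply (Cmod_is_RInt_le_const (fun s => Cexp (- (z + RtoC h * z1) * RtoC s) * g s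
    - Cexp (- z * RtoC s) * g s - RtoC h * (- z1 * (Cexp (- z * RtoC s) * (RtoC s * g s))))%C);
    [lra | | ].
  - intros s Hs. apply laplace_integrand_remainder_le; [lra | exact Hh | ].
    left. rewrite Cmod_norm. apply HM. lra.
  - apply is_RInt_Cminus; [apply is_RInt_Cminus; now apply is_RInt_laplace | ].
    apply is_RInt_Cmult_l, is_RInt_Cmult_l, (is_RInt_laplace (fun s => RtoC s * g s)%C).
    intros s Hs. apply continuous_Cmult; [ | now apply Hg].
    eapply continuous_is_derive_C, (is_derive_RtoC (fun s => s)), (is_derive_id (K := R_AbsRing)).
Qed.

Lemma laplace_rpow_by_parts (a z : C) :
  0 < Re a -> ((a + 1) * laplace (rpow a) z - z * laplace (rpow (a + 1)) z = Cexp (- z))%C.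
Proof.
  intros Ha.
  assert (Hc : forall s, 0 <= s <= 1 -> continuous (rpow a) s)
    by (intros; apply continuous_rpow; tauto).
  assert (Hc1 : forall s, 0 <= s <= 1 -> continuous (rpow (a + 1)) s).
  { intros s Hs. eapply continuous_is_derive_C, is_derive_rpow_plus_1; tauto. }
  apply (is_RInt_C_unique (fun s => (a + 1) * (Cexp (- z * RtoC s) * rpow a s)
    - z * (Cexp (- z * RtoC s) * rpow (a + 1) s))%C 0 1).
  - apply is_RInt_Cminus; now apply is_RInt_Cmult_l, is_RInt_laplace.
  - set (F := fun s => (Cexp (- z * RtoC s) * rpow (a + 1) s)%C).
    replace (Cexp (- z)) with (F 1 - F 0)%C.
    2: { unfold F. rewrite rpow_1, (rpow_nonpos _ 0), !Cmult_1_r by lra. ring. }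
    apply is_RInt_C_derive; [lra | | ].
    + intros s Hs. evar_last.
      * apply is_derive_Cmult; [apply is_derive_Cexp_scal | apply is_derive_rpow_plus_1; tauto].
      * simpl. ring.
    + intros s Hs. apply (continuous_minus (V := C_R_NormedModule));
        apply continuous_Cmult_l, continuous_laplace_integrand; auto.
Qed.

(* This is [int_0^u e^(- n x) x^a dx], along the segment from [0] to [u]. *)
Definition incomplete_gamma (n : R) (a u : C) : C :=
  (Cexp ((a + 1) * Clog u) * laplace (rpow a) (RtoC n * u))%C.

Definition gamma_integrand (n : R) (a u : C) : C := Cexp (- (RtoC n * u) + a * Clog u).

Lemma is_derive_incomplete_gamma (n : R) (a u0 u1 : C) (x : R) :
  0 < Re a -> 0 < Re (u0 + RtoC x * u1)%C ->
  is_derive_C (fun t => incomplete_gamma n a (u0 + RtoC t * u1)) x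
    (u1 * gamma_integrand n a (u0 + RtoC x * u1))%C.
Proof.
  intros Ha Hu. set (u := (u0 + RtoC x * u1)%C) in *. assert (Hu0 := Re_pos_neq_0 u Hu).
  apply (is_derive_ext (V := C_R_NormedModule) (fun t => Cexp ((a + 1) * Clog (u0 + RtoC t * u1))
    * laplace (rpow a) (RtoC n * u0 + RtoC t * (RtoC n * u1)))%C).
  { intros t. unfold incomplete_gamma. f_equal. f_equal. ring. }
  evar_last.
  - apply is_derive_Cmult.
    + apply is_derive_Cexp, is_derive_Cmult_l, is_derive_Clog; [exact Hu | apply is_derive_affine].
    + apply is_derive_laplace. intros s Hs. apply continuous_rpow; tauto.
  - cbv beta. fold u.
    replace (RtoC n * u0 + RtoC x * (RtoC n * u1))%C with (RtoC n * u)%C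
      by (unfold u; ring).
    replace (laplace (fun s => RtoC s * rpow a s)%C (RtoC n * u))
      with (laplace (rpow (a + 1)) (RtoC n * u)).
    2: { apply RInt_C_ext; [lra | ]. intros s _. now rewrite rpow_plus_1. }
    transitivity (u1 * / u * Cexp ((a + 1) * Clog u) * ((a + 1) * laplace (rpow a) (RtoC n * u)
      - RtoC n * u * laplace (rpow (a + 1)) (RtoC n * u)))%C; [now field | ].
    rewrite laplace_rpow_by_parts by exact Ha. unfold gamma_integrand.
    rewrite Cmult_plus_distr_r, Cmult_1_l, !Cexp_plus, (Cexp_Clog u Hu). now field.
Qed.

Lemma continuous_gamma_integrand (n : R) (a u0 u1 : C) (x : R) :
  0 < Re (u0 + RtoC x * u1)%C ->
  continuous (fun t => gamma_integrand n a (u0 + RtoC t * u1)) x.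
Proof.
  intros Hu. eapply continuous_is_derive_C, is_derive_Cexp, is_derive_Cplus.
  - apply (is_derive_opp (V := C_R_NormedModule)), is_derive_Cmult_l, is_derive_affine.
  - apply is_derive_Cmult_l, is_derive_Clog; [exact Hu | apply is_derive_affine].
Qed.

Lemma is_RInt_gamma_integrand (n : R) (a u0 u1 : C) (b c : R) :
  0 < Re a -> b <= c -> (forall x, b <= x <= c -> 0 < Re (u0 + RtoC x * u1)%C) ->
  is_RInt_C (fun t => u1 * gamma_integrand n a (u0 + RtoC t * u1))%C b c
    (incomplete_gamma n a (u0 + RtoC c * u1) - incomplete_gamma n a (u0 + RtoC b * u1))%C.
Proof.
  intros Ha Hbc Hu. apply (is_RInt_C_derive (fun t => incomplete_gamma n a (u0 + RtoC t * u1))).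
  - exact Hbc.
  - intros x Hx. apply is_derive_incomplete_gamma; auto.
  - intros x Hx. apply continuous_Cmult_l, continuous_gamma_integrand. auto.
Qed.

Lemma Sn_laplace (n : R) (w v : C) :
  0 < Re (RtoC n + v)%C ->
  Sn n w v = (1 + RtoC n * w * (Cexp (RtoC n * w) * laplace (rpow (RtoC n + v)) (RtoC n * w)))%C.
Proof.
  intros Ha. unfold Sn, laplace. rewrite <- (RInt_Cmult_l (Cexp (RtoC n * w))).
  - do 2 f_equal. apply RInt_C_ext; [lra | ]. intros s Hs. unfold Ccpow.
    rewrite rpow_pos, Clog_RtoC, Cmult_assoc, <- !Cexp_plus, RtoC_minus by lra. f_equal. ring.
  - eexists. apply is_RInt_laplace. intros s Hs. apply continuous_rpow; tauto.
Qed.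

Lemma Sn_incomplete_gamma (n : R) (w v : C) :
  0 < Re (RtoC n + v)%C -> 0 < Re w ->
  Sn n w v = (1 + RtoC n * (Cexp (RtoC n * w - (RtoC n + v) * Clog w)
                            * incomplete_gamma n (RtoC n + v) w))%C.
Proof.
  intros Ha Hw. rewrite Sn_laplace by exact Ha. unfold incomplete_gamma. set (a := (RtoC n + v)%C).
  assert (E : (Cexp (RtoC n * w - a * Clog w) * Cexp ((a + 1) * Clog w) = w * Cexp (RtoC n * w))%C).
  { rewrite <- (Cexp_Clog w Hw) at 4. rewrite <- !Cexp_plus. f_equal. ring. }
  rewrite (Cmult_assoc (Cexp (RtoC n * w - a * Clog w))), E. ring.
Qed.

(** * Exponentially small pieces of the contour *)

Lemma infty_Re_plus_pos (v : C) : infty (fun n => 0 < Re (RtoC n + v)%C).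
Proof.
  apply filter_imp with (2 := infty_ge (1 - Re v)). intros n Hn. rewrite re_plus, re_RtoC. lra.
Qed.

Lemma Cexp_mult_laplace (g : R -> C) (z : C) :
  (forall s, 0 <= s <= 1 -> continuous g s) ->
  (Cexp z * laplace g z = RInt_C (fun x => Cexp (z * RtoC x) * g (1 - x)%R) 0 1)%C.
Proof.
  intros Hg. set (f := fun s => (Cexp z * (Cexp (- z * RtoC s) * g s))%C).
  assert (Hf : is_RInt_C f 0 1 (Cexp z * laplace g z)%C)
    by now apply is_RInt_Cmult_l, is_RInt_laplace.
  assert (E : forall x,
    (RtoC (-1) * (RtoC (-1) * f (-1 * x + 1)%R) = Cexp (z * RtoC x) * g (1 - x)%R)%C).
  { intros x. unfold f. replace (-1 * x + 1) with (1 - x) by ring.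
    rewrite (Cmult_assoc (Cexp z)), <- Cexp_plus, RtoC_minus.
    replace (z + - z * (1 - RtoC x))%C with (z * RtoC x)%C by ring. ring. }
  symmetry. apply RInt_C_unique.
  apply (is_RInt_swap (V := C_R_NormedModule)) in Hf.
  replace 1 with (-1 * 0 + 1) in Hf at 1 by ring. replace 0 with (-1 * 1 + 1) in Hf at 2 by ring.
  apply (is_RInt_comp_lin (V := C_R_NormedModule)),
    (is_RInt_scal (V := C_R_NormedModule) _ _ _ (-1)) in Hf.
  rewrite scal_R_Cmult in Hf.
  replace (Cexp z * laplace g z)%C with (RtoC (-1) * - (Cexp z * laplace g z))%C by ring.
  apply is_RInt_ext with (2 := Hf). intros x _. rewrite !scal_R_Cmult. apply E.
Qed.

Lemma ln_1_minus_le (s : R) : 0 <= s < 1 -> ln (1 - s) <= - s - s ^ 2 / 2.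
Proof.
  intros Hs.
  destruct (MVT_gen (fun s => ln (1 - s) + s + s ^ 2 / 2) 0 s
    (fun s => - s ^ 2 / (1 - s))) as [c [Hc E]].
  - intros x. rewrite Rmin_left, Rmax_right by lra. intros Hx. auto_derive; [lra | ]. field. lra.
  - intros x. rewrite Rmin_left, Rmax_right by lra. intros Hx. apply continuity_pt_filterlim.
    apply (ex_derive_continuous (K := R_AbsRing) (V := R_NormedModule)
      (fun s => ln (1 - s) + s + s ^ 2 / 2)). auto_derive. lra.
  - rewrite Rmin_left, Rmax_right in Hc by lra. rewrite Rminus_0_r, ln_1 in E.
    assert (H : 0 <= c ^ 2 / (1 - c)) by (apply Rdiv_le_0_compat; [apply pow2_ge_0 | lra]).
    assert (0 <= c ^ 2 / (1 - c) * s) by (apply Rmult_le_pos; lra).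
    replace (- c ^ 2 / (1 - c) * (s - 0)) with (- (c ^ 2 / (1 - c) * s)) in E by (field; lra). lra.
Qed.

Lemma Cmod_reflected_integrand_le (n : R) (w v : C) (del x : R) :
  Re w <= 1 -> Rabs (Re v) <= n -> 0 < del -> del < x < 1 ->
  Cmod (Cexp (RtoC n * w * RtoC x) * rpow (RtoC n + v) (1 - x)%R)%C
  <= exp (2 * Rabs (Re v)) * exp (- (del ^ 2 / 2) * n).
Proof.
  intros Hw Hn Hdel Hx. rewrite Cmod_mult, Cmod_rpow, Cmod_Cexp, <- !exp_plus by lra.
  apply exp_le_compat. rewrite re_scal_r, re_scal_l, re_plus, re_RtoC.
  assert (HL := ln_1_minus_le x ltac:(lra)). set (m := Rabs (Re v)) in *.
  assert (Hm : 0 <= m) by apply Rabs_pos.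
  assert (Hv : - Re v <= m) by (unfold m; rewrite <- Rabs_Ropp; apply Rle_abs).
  assert (Hsq : del ^ 2 <= x ^ 2) by (apply pow_incr; lra).
  assert (Hx2 : 0 <= x ^ 2 <= 1).
  { split; [apply pow2_ge_0 | ]. rewrite <- (pow1 2). apply pow_incr. lra. }
  assert (H1 : (n + Re v) * ln (1 - x) <= (n - m) * (- x - x ^ 2 / 2)).
  { apply Rle_trans with ((n - m) * ln (1 - x)); [nra | ]. apply Rmult_le_compat_l; lra. }
  assert (H2 : n * Re w * x <= n * x) by (assert (0 <= n * x) by nra; nra).
  assert (H3 : n * del ^ 2 <= n * x ^ 2) by (apply Rmult_le_compat_l; lra).
  assert (H4 : m * (x + x ^ 2 / 2) <= m * 2) by (apply Rmult_le_compat_l; lra).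
  lra.
Qed.

Lemma endpoint_concentration (w v : C) (del : R) :
  Re w <= 1 -> 0 < del < 1 ->
  negligible (fun n => Cexp (RtoC n * w) * laplace (rpow (RtoC n + v)) (RtoC n * w)
                       - RInt_C (ray_integrand n w v 1) 0 del)%C.
Proof.
  intros Hw Hdel.
  set (f := fun n x => (Cexp (RtoC n * w * RtoC x) * rpow (RtoC n + v) (1 - x)%R)%C).
  assert (Hf : forall n b c, 0 < Re (RtoC n + v)%C -> b <= c <= 1 -> ex_RInt_C (f n) b c).
  { intros n b c Ha Hbc. apply ex_RInt_C_continuous; [lra | ]. intros x Hx.
    apply continuous_Cmult; [eapply continuous_is_derive_C, is_derive_Cexp_scal | ].
    apply (continuous_comp (fun x => 1 - x)); [ | apply continuous_rpow; lra].
    apply (continuous_minus (V := R_NormedModule));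
      [apply continuous_const | apply continuous_id]. }
  apply (negligible_ext (fun n => RInt_C (f n) del 1)).
  - apply filter_imp with (2 := infty_Re_plus_pos v). intros n Ha.
    rewrite Cexp_mult_laplace by (intros; apply continuous_rpow; tauto). fold (f n).
    rewrite (RInt_C_Chasles (f n) 0 del 1) by (apply Hf; lra).
    rewrite (RInt_C_ext (f n) (ray_integrand n w v 1) 0 del); [ | lra | ].
    + symmetry. ring.
    + intros x Hx. unfold f, ray_integrand. rewrite Cmult_1_r, rpow_pos, <- Cexp_plus by lra.
      replace (1 - RtoC x)%C with (RtoC (1 - x)) by apply RtoC_minus.
      rewrite Clog_RtoC by lra. f_equal. ring.
  - apply (negligible_RInt f del 1 (del ^ 2 / 2) (exp (2 * Rabs (Re v)))); [lra | nra | | ].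
    + apply filter_imp with (2 := infty_Re_plus_pos v). intros n Ha. apply Hf; lra.
    + apply filter_imp with (2 := infty_ge (Rabs (Re v))). intros n Hn x Hx.
      apply Cmod_reflected_integrand_le; lra.
Qed.

Lemma power_bounded_on_segment (v u0 u1 : C) (b c : R) :
  (forall x, b <= x <= c -> 0 < Re (u0 + RtoC x * u1)%C) ->
  exists M, forall x, b <= x <= c -> Cmod (Cexp (v * Clog (u0 + RtoC x * u1))) <= M.
Proof.
  intros Hu.
  destruct (bounded_continuity (V := C_R_NormedModule)
    (fun x => Cexp (v * Clog (u0 + RtoC x * u1))) b c) as [M HM].
  - intros x Hx. eapply continuous_is_derive_C, is_derive_Cexp, is_derive_Cmult_l, is_derive_Clog.
    + now apply Hu.
    + apply is_derive_affine.
  - exists M. intros x Hx. left. rewrite Cmod_norm. now apply HM.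
Qed.

Definition height (u : C) : R := ln (Cmod u) - Re u.

Definition Sn_prefactor (n : R) (w v : C) : C := Cexp (RtoC n * w - (RtoC n + v) * Clog w).

Lemma Cmod_Sn_prefactor_gamma_integrand (n : R) (w v u : C) :
  Cmod (Sn_prefactor n w v * gamma_integrand n (RtoC n + v) u)%C =
  exp (n * (height u - height w)) * (Cmod (Cexp (v * Clog u)) * Cmod (Cexp (- (v * Clog w)))).
Proof.
  unfold Sn_prefactor, gamma_integrand. rewrite <- Cexp_plus, !Cmod_Cexp, <- !exp_plus.
  f_equal. unfold height, Clog, Re. simpl. ring.
Qed.

Lemma negligible_low_segment (w v u0 u1 : C) (b c gap : R) :
  b <= c -> 0 < gap -> (forall x, b <= x <= c -> 0 < Re (u0 + RtoC x * u1)%C) ->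
  (forall x, b <= x <= c -> height (u0 + RtoC x * u1) - height w <= - gap) ->
  negligible (fun n => Sn_prefactor n w v *
    (incomplete_gamma n (RtoC n + v) (u0 + RtoC c * u1)
     - incomplete_gamma n (RtoC n + v) (u0 + RtoC b * u1)))%C.
Proof.
  intros Hbc Hgap Hu Hheight.
  set (f := fun n x => (Sn_prefactor n w v *
    (u1 * gamma_integrand n (RtoC n + v) (u0 + RtoC x * u1)))%C).
  assert (Hf : forall n, 0 < Re (RtoC n + v)%C ->
    is_RInt_C (f n) b c (Sn_prefactor n w v *
      (incomplete_gamma n (RtoC n + v) (u0 + RtoC c * u1)
       - incomplete_gamma n (RtoC n + v) (u0 + RtoC b * u1)))%C).
  { intros n Ha. now apply is_RInt_Cmult_l, is_RInt_gamma_integrand. }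
  apply (negligible_ext (fun n => RInt_C (f n) b c)).
  { apply filter_imp with (2 := infty_Re_plus_pos v). intros n Ha.
    now apply RInt_C_unique, Hf. }
  destruct (power_bounded_on_segment v u0 u1 b c Hu) as [M HM].
  apply (negligible_RInt f b c gap (Cmod u1 * (M * Cmod (Cexp (- (v * Clog w)))))); auto.
  - apply filter_imp with (2 := infty_Re_plus_pos v). intros n Ha. eexists. now apply Hf.
  - apply filter_imp with (2 := infty_ge 0). intros n Hn x Hx. unfold f.
    rewrite Cmult_assoc, (Cmult_comm _ u1), <- Cmult_assoc, Cmod_mult, Rmult_assoc.
    apply Rmult_le_compat_l; [apply Cmod_ge_0 | ].
    rewrite Cmod_Sn_prefactor_gamma_integrand, Rmult_comm. apply Rmult_le_compat.
    + apply Rmult_le_pos; apply Cmod_ge_0.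
    + left. apply exp_pos.
    + apply Rmult_le_compat_r; [apply Cmod_ge_0 | apply HM; lra].
    + apply exp_le_compat. specialize (Hheight x ltac:(lra)). nra.
Qed.

Lemma Clog_plus_real (w : C) (s : R) :
  0 < Re w -> 0 <= s -> Clog (w + RtoC s) = (Clog w + Clog (1 - RtoC s * - / w))%C.
Proof.
  intros Hw Hs. assert (Hw0 := Re_pos_neq_0 w Hw).
  assert (Hre1 : forall x, 0 <= x -> 0 < Re (w + RtoC x * 1)%C).
  { intros x Hx. rewrite Cmult_1_r, re_plus, re_RtoC. lra. }
  assert (Hre2 : forall x, 0 <= x -> 0 < Re (1 + RtoC x * / w)%C).
  { intros x Hx. rewrite re_plus, re_scal_l, re_RtoC.
    assert (0 <= Re (/ w)%C); [ | nra]. unfold Re, Cinv. simpl fst.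
    left. apply Rdiv_lt_0_compat; [exact Hw | ]. unfold Re in Hw. nra. }
  set (D := fun x => (Clog (w + RtoC x * 1) - Clog (1 + RtoC x * / w))%C).
  assert (HD : Cmod (D s - D 0)%C <= 0 * (s - 0)).
  { apply (mean_value_inequality D (fun _ => RtoC 0)); [exact Hs | | ].
    - intros x Hx. evar_last.
      + apply is_derive_Cminus; apply is_derive_Clog; try apply is_derive_affine;
          [apply Hre1 | apply Hre2]; lra.
      + assert (H1 : (w + RtoC x)%C <> 0%C).
        { rewrite <- (Cmult_1_r (RtoC x)). apply Re_pos_neq_0, Hre1. lra. }
        replace (1 + RtoC x * / w)%C with ((w + RtoC x * 1) / w)%C by (field; exact Hw0).
        simpl. field. auto.
    - intros x _. rewrite Cmod_0. apply Rle_refl. }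
  rewrite Rmult_0_l in HD. assert (H0 := Cmod_ge_0 (D s - D 0)%C).
  assert (E : (D s - D 0)%C = 0%C) by (apply Cmod_eq_0; lra).
  unfold D in E. rewrite !Cmult_0_l, !Cplus_0_r, Clog_1, !Cmult_1_r in E.
  replace (1 - RtoC s * - / w)%C with (1 + RtoC s * / w)%C by ring.
  apply Ceq_minus. rewrite <- E. ring.
Qed.

Lemma RInt_ray_integrand (n : R) (w v : C) (del : R) :
  0 < Re (RtoC n + v)%C -> 0 < Re w -> 0 <= del ->
  RInt_C (ray_integrand n w v (- / w)) 0 del =
  (Sn_prefactor n w v * (incomplete_gamma n (RtoC n + v) (w + RtoC del)
                          - incomplete_gamma n (RtoC n + v) w))%C.
Proof.
  intros Ha Hw Hdel. assert (Hw0 := Re_pos_neq_0 w Hw).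
  assert (H := is_RInt_gamma_integrand n (RtoC n + v) w 1 0 del Ha Hdel).
  rewrite Cmult_1_r, Cmult_0_l, Cplus_0_r in H.
  apply RInt_C_unique.
  apply (is_RInt_ext (V := C_R_NormedModule)
    (fun s => Sn_prefactor n w v * (1 * gamma_integrand n (RtoC n + v) (w + RtoC s * 1)))%C).
  - rewrite Rmin_left, Rmax_right by exact Hdel. intros s Hs.
    unfold ray_integrand, Sn_prefactor, gamma_integrand. rewrite Cmult_1_l, Cmult_1_r, <- Cexp_plus.
    rewrite Clog_plus_real by lra. f_equal. field. exact Hw0.
  - apply is_RInt_Cmult_l, H. intros x Hx. rewrite Cmult_1_r, re_plus, re_RtoC. lra.
Qed.

(** * The saddle on the positive axis *)

Lemma ln_1_plus_lt (x : R) : 0 < x -> ln (1 + x) < x.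
Proof.
  intros Hx. apply exp_lt_inv. rewrite exp_ln by lra. apply exp_ineq1. lra.
Qed.

Lemma ln_le_sub_1 (x : R) : 0 < x -> ln x <= x - 1.
Proof. intros Hx. assert (H := exp_ineq1_le (ln x)). rewrite exp_ln in H; lra. Qed.

Lemma ln_1_plus_minus_decreasing (x y : R) : 0 <= x <= y -> ln (1 + y) - y <= ln (1 + x) - x.
Proof.
  intros H. assert (E := ln_le_sub_1 ((1 + y) / (1 + x)) ltac:(apply Rdiv_lt_0_compat; lra)).
  rewrite ln_div in E by lra.
  assert ((1 + y) / (1 + x) - 1 <= y - x); [ | lra].
  replace ((1 + y) / (1 + x) - 1) with ((y - x) / (1 + x)) by (field; lra).
  apply Rle_div_l; nra.
Qed.

Lemma incomplete_gamma_1 (n : R) (a : C) : incomplete_gamma n a 1 = laplace (rpow a) (RtoC n).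
Proof.
  unfold incomplete_gamma. rewrite Clog_1, Cmult_0_r, Cexp_0, Cmult_1_l, Cmult_1_r. reflexivity.
Qed.

Lemma Sn_prefactor_1 (n : R) (v : C) : Sn_prefactor n 1 v = Cexp (RtoC n).
Proof. unfold Sn_prefactor. rewrite Clog_1. f_equal. ring. Qed.

Lemma is_O_inv_pow_sqrt (f : R -> C) (N : nat) :
  is_O infty f (fun n => / n ^ N) -> is_O infty f (fun n => sqrt n / n ^ N).
Proof.
  apply (is_O_weaken 1); [lra | ]. apply filter_imp with (2 := infty_ge 1). intros n Hn.
  assert (Hs := sqrt_ge_1 n Hn).
  assert (0 < / n ^ N) by (apply Rinv_0_lt_compat, pow_lt; lra). unfold Rdiv. nra.
Qed.

Lemma is_O_replace_negligible (f g s : R -> C) (N : nat) :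
  is_O infty (fun n => RtoC n * f n - s n)%C (fun n => sqrt n / n ^ N) ->
  negligible (fun n => g n - f n)%C ->
  is_O infty (fun n => RtoC n * g n - s n)%C (fun n => sqrt n / n ^ N).
Proof.
  intros Hf Hneg.
  apply (is_O_ext (fun n => (RtoC n * f n - s n) + RtoC n * (g n - f n))%C).
  { apply filter_forall. intros n. ring. }
  apply is_O_plus; [exact Hf | ]. apply is_O_inv_pow_sqrt, is_O_mult_id, Hneg.
Qed.

Lemma left_half_saddle_contribution (v : C) (N : nat) :
  is_O infty
    (fun n => RtoC n * (Cexp (RtoC n) * incomplete_gamma n (RtoC n + v) 1)
              - Csum (half_saddle_term v 1 n) N)%C
    (fun n => sqrt n / n ^ N).
Proof.
  destruct (half_saddle_contribution v 1 N (Cmult_1_l 1)) as [r [Hr H]].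
  assert (Hdel : 0 < Rmin r (/ 2) < 1).
  { split; [apply Rmin_pos; lra | ]. assert (Hmin := Rmin_r r (/ 2)). lra. }
  apply is_O_replace_negligible with (1 := H _ (conj (proj1 Hdel) (Rmin_l _ _))).
  apply negligible_ext with (2 := endpoint_concentration 1 v _ (Rle_refl 1) Hdel).
  apply filter_forall. intros n. now rewrite incomplete_gamma_1, Cmult_1_r.
Qed.

Lemma right_half_saddle_contribution (v : C) (b : R) (N : nat) :
  1 < b ->
  is_O infty
    (fun n => RtoC n * (Cexp (RtoC n) * (incomplete_gamma n (RtoC n + v) (RtoC b)
                                         - incomplete_gamma n (RtoC n + v) 1))
              - Csum (half_saddle_term v (- (1)) n) N)%C
    (fun n => sqrt n / n ^ N).
Proof.
  intros Hb. destruct (half_saddle_contribution v (- (1)) N) as [r [Hr H]]; [ring | ].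
  set (del := Rmin r (b - 1)).
  assert (Hdel : 0 < del) by (apply Rmin_pos; lra).
  assert (Hdelb : del <= b - 1) by apply Rmin_r.
  apply is_O_replace_negligible with (1 := H del (conj Hdel (Rmin_l _ _))).
  assert (Htail : negligible (fun n => Sn_prefactor n 1 v *
    (incomplete_gamma n (RtoC n + v) (1 + RtoC (b - 1) * 1)
     - incomplete_gamma n (RtoC n + v) (1 + RtoC del * 1)))%C).
  { assert (Hgap := ln_1_plus_lt del Hdel).
    apply (negligible_low_segment 1 v 1 1 del (b - 1) (del - ln (1 + del))); [lra | lra | | ].
    - intros x Hx. rewrite Cmult_1_r, re_plus, !re_RtoC. lra.
    - intros x Hx. unfold height. rewrite Cmult_1_r, <- RtoC_plus,
        Cmod_RtoC_nonneg, !re_RtoC by lra.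
      rewrite Cmod_1, ln_1. assert (E := ln_1_plus_minus_decreasing del x ltac:(lra)). lra. }
  apply negligible_ext with (2 := Htail).
  apply filter_imp with (2 := infty_Re_plus_pos v). intros n Ha.
  replace (- (1))%C with (- / 1)%C by field.
  assert (H1 : 0 < Re 1) by (rewrite re_RtoC; lra).
  rewrite RInt_ray_integrand, Sn_prefactor_1, !Cmult_1_r, <- !RtoC_plus by (assumption || lra).
  replace (1 + (b - 1)) with b by ring. ring.
Qed.

(* The odd-order terms of the two halves of the saddle cancel. *)
Lemma saddle_contribution (v : C) (b : R) (N : nat) :
  1 < b ->
  is_O infty
    (fun n => RtoC n * (Cexp (RtoC n) * incomplete_gamma n (RtoC n + v) (RtoC b))
              - sq2pin n * Csum (fun r => gam r v / RtoC n ^ r) N)%C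
    (fun n => sqrt n / n ^ N).
Proof.
  intros Hb.
  apply is_O_ext with (2 := is_O_plus _ _ _ (left_half_saddle_contribution v N)
    (right_half_saddle_contribution v b N Hb)).
  apply filter_forall. intros n.
  assert (E : (sq2pin n * Csum (fun r => gam r v / RtoC n ^ r) N =
    Csum (half_saddle_term v 1 n) N + Csum (half_saddle_term v (- (1)) n) N)%C).
  { rewrite <- Csum_plus, <- Csum_mult_l. apply Csum_ext. intros r _.
    unfold half_saddle_term, Cdiv.
    transitivity (sq2pin n * (gam r v * / RtoC n ^ r) * (/ 2 + / 2))%C; [ | ring].
    replace (/ 2 + / 2)%C with (RtoC 1) by field. ring. }
  rewrite E. ring.
Qed.

(** * Expansions of [Sn] *)

Lemma Csum_kdelta (f : nat -> C) (z : C) (N : nat) :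
  (0 < N)%nat ->
  Csum (fun r => (f r - kdelta r) / z ^ r)%C N = (Csum (fun r => f r / z ^ r) N - 1)%C.
Proof.
  intros HN. destruct N as [ | N]; [lia | ].
  rewrite (Csum_ext _ (fun r => f r / z ^ r - kdelta r / z ^ r)%C) by (intros; unfold Cdiv; ring).
  rewrite Csum_minus, (Csum_S_l (fun r => kdelta r / z ^ r)%C).
  rewrite (Csum_0 (fun r => kdelta (S r) / z ^ S r)%C).
  - f_equal. unfold kdelta. simpl. field.
  - intros r _. unfold kdelta. simpl. unfold Cdiv. ring.
Qed.

Lemma is_O_series_bounded (c : nat -> C) (N : nat) :
  is_O infty (fun n => Csum (fun r => c r / RtoC n ^ r)%C N) (fun _ => 1).
Proof.
  apply (is_O_Csum (fun r n => c r / RtoC n ^ r)%C). intros r _.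
  apply is_O_Cmult_l, is_O_inv_pow_1.
Qed.

Lemma Sn_expansion_Re_lt_1 (w v : C) (N : nat) :
  (0 < N)%nat -> Re w < 1 ->
  is_O infty (fun n => Sn n w v - Csum (fun r => Ucoef r w v / RtoC n ^ r) N)%C (fun n => / n ^ N).
Proof.
  intros HN Hw. destruct (endpoint_contribution w v 1 N C1_nz) as [r [Hr H]].
  { unfold Cminus. rewrite Cmult_1_r, re_plus, re_opp, re_RtoC. lra. }
  set (del := Rmin r (/ 2)). assert (Hdel : 0 < del) by (apply Rmin_pos; lra).
  assert (Hdelr : del <= r) by apply Rmin_l. assert (Hdel2 : del <= / 2) by apply Rmin_r.
  destruct (H del (conj Hdel Hdelr)) as [_ Hend].
  assert (Hneg := endpoint_concentration w v del ltac:(lra) ltac:(lra)).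
  apply negligible_Cmult_l with (c := w) in Hneg.
  apply is_O_ext with (2 := is_O_plus _ _ _ Hend (is_O_mult_id _ _ (Hneg (S N)))).
  apply filter_imp with (2 := infty_Re_plus_pos v). intros n Ha.
  rewrite Sn_laplace, Csum_kdelta by assumption. ring.
Qed.

Lemma negligible_vertical_segment (w v : C) (del : R) :
  1 <= Re w -> 0 < del ->
  negligible (fun n => Sn_prefactor n w v *
    (incomplete_gamma n (RtoC n + v) (w + RtoC del)
     - incomplete_gamma n (RtoC n + v) (RtoC (Re w + del))))%C.
Proof.
  intros Hw Hdel. set (b := Re w + del). set (iy := (Ci * RtoC (Im w))%C).
  assert (Hre : forall x : R, Re (RtoC b + RtoC x * iy)%C = b).
  { intros x. unfold iy, Re. simpl. ring. }
  assert (Him : forall x : R, Im (RtoC b + RtoC x * iy)%C = x * Im w).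
  { intros x. unfold iy, Im. simpl. ring. }
  assert (Hend : (w + RtoC del)%C = (RtoC b + RtoC 1 * iy)%C).
  { apply injective_projections; unfold b, iy, Re, Im; simpl; ring. }
  assert (Hgap := ln_1_plus_lt del Hdel).
  assert (H := negligible_low_segment w v (RtoC b) iy 0 1 (del - ln (1 + del))).
  rewrite Cmult_0_l, Cplus_0_r, <- Hend in H. apply H; [lra | lra | | ].
  - intros x _. rewrite Hre. unfold b. lra.
  - intros x Hx. set (u := (RtoC b + RtoC x * iy)%C).
    assert (Hw1 : 1 <= Cmod w) by (apply Rle_trans with (1 := Hw), Re_le_Cmod).
    assert (Hu0 : 0 < Cmod u).
    { apply Rlt_le_trans with (2 := Re_le_Cmod u). unfold u. rewrite Hre. unfold b. lra. }
    assert (Hu : Cmod u <= Cmod w * (1 + del)).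
    { apply Rle_trans with (Cmod (w + RtoC del)).
      - apply Rsqr_incr_0; try apply Cmod_ge_0. rewrite !Rsqr_pow2, !Cmod2_alt, Hend.
        unfold u. rewrite !Hre, !Him, Rmult_1_l, Rpow_mult_distr.
        assert (Hi := pow2_ge_0 (Im w)). assert (Hx2 := pow_incr x 1 2 Hx). nra.
      - apply Rle_trans with (1 := Cmod_triangle _ _). rewrite (Cmod_RtoC_nonneg del) by lra. nra. }
    apply ln_le in Hu; [ | exact Hu0]. rewrite ln_mult in Hu by lra.
    unfold height. replace (Re u) with b by (symmetry; apply Hre). unfold b. lra.
Qed.

Lemma Re_1_minus_inv_pos (w : C) : 1 <= Re w -> w <> 1%C -> 0 < Re ((1 - w) * - / w)%C.
Proof.
  intros Hw Hw1. assert (Hw0 : w <> 0%C) by (apply Re_pos_neq_0; lra).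
  replace ((1 - w) * - / w)%C with (1 - / w)%C by (field; exact Hw0).
  replace (Re (1 - / w)%C) with (1 - Re w / (Re w ^ 2 + Im w ^ 2)) by reflexivity.
  assert (Hsq : Re w < Re w ^ 2 + Im w ^ 2).
  { destruct (Req_dec (Im w) 0) as [Hi | Hi].
    - assert (Re w <> 1) by (intros Hr; now apply Hw1, injective_projections).
      rewrite Hi. nra.
    - assert (0 < Im w ^ 2) by now apply pow2_gt_0. nra. }
  apply Rlt_0_minus, (Rmult_lt_reg_r (Re w ^ 2 + Im w ^ 2)); [lra | ].
  unfold Rdiv. rewrite Rmult_assoc, Rinv_l by lra. lra.
Qed.

Definition saddle_weight (n : R) (w v : C) : C := (/ (wepow n w * Ccpow w v))%C.

Lemma saddle_weight_Cexp (n : R) (w v : C) :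
  saddle_weight n w v = Cexp (- (RtoC n * Clog w + RtoC n * (1 - w) + v * Clog w)).
Proof. unfold saddle_weight, wepow, Ccpow. now rewrite <- Cexp_plus, Cexp_opp. Qed.

Lemma Sn_prefactor_eq_saddle_weight (n : R) (w v : C) :
  Sn_prefactor n w v = (saddle_weight n w v * Cexp (RtoC n))%C.
Proof. unfold Sn_prefactor. rewrite saddle_weight_Cexp, <- Cexp_plus. f_equal. ring. Qed.

Lemma Sn_sub_saddle_expansion (w v : C) (N : nat) :
  (0 < N)%nat -> 1 <= Re w -> w <> 1%C ->
  exists b, 1 < b /\
  is_O infty
    (fun n => Sn n w v
       - saddle_weight n w v * (RtoC n * (Cexp (RtoC n) * incomplete_gamma n (RtoC n + v) (RtoC b)))
       - Csum (fun r => Ucoef r w v / RtoC n ^ r) N)%C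
    (fun n => / n ^ N).
Proof.
  intros HN Hw Hw1. assert (Hw0 : w <> 0%C) by (apply Re_pos_neq_0; lra).
  destruct (endpoint_contribution w v (- / w) N) as [del [Hdel H]].
  { intros E. apply C1_nz. transitivity (- / w * - w)%C; [now field | ]. rewrite E. ring. }
  { now apply Re_1_minus_inv_pos. }
  destruct (H del) as [_ Hend]; [lra | ]. exists (Re w + del). split; [lra | ].
  assert (Hneg := negligible_vertical_segment w v del Hw Hdel).
  apply is_O_ext with (2 := is_O_plus _ _ _ Hend (is_O_mult_id _ _ (Hneg (S N)))).
  apply filter_imp with (2 := infty_Re_plus_pos v). intros n Ha.
  rewrite Sn_incomplete_gamma, RInt_ray_integrand, Csum_kdelta by (assumption || lra).
  change (Cexp (RtoC n * w - (RtoC n + v) * Clog w)) with (Sn_prefactor n w v).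
  rewrite Sn_prefactor_eq_saddle_weight. field. exact Hw0.
Qed.

Lemma Sn_expansion_Re_ge_1 (w v : C) (N : nat) :
  (0 < N)%nat -> 1 <= Re w -> w <> 1%C ->
  exists saddle : R -> C,
    is_O infty
      (fun n => saddle n - sq2pin n * Csum (fun r => gam r v / RtoC n ^ r) N)%C
      (fun n => sqrt n / n ^ N) /\
    is_O infty
      (fun n => Sn n w v - saddle_weight n w v * saddle n
        - Csum (fun r => Ucoef r w v / RtoC n ^ r) N)%C
      (fun n => / n ^ N).
Proof.
  intros HN Hw Hw1. destruct (Sn_sub_saddle_expansion w v N HN Hw Hw1) as [b [Hb H]].
  eexists. split; [exact (saddle_contribution v b N Hb) | exact H].
Qed.

Lemma modwe_height (w : C) : w <> 0%C -> modwe w = exp (1 + height w).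
Proof.
  intros Hw. unfold modwe, height. rewrite Cmod_mult, Cmod_Cexp.
  unfold Cminus. rewrite re_plus, re_opp, re_RtoC.
  replace (1 + (ln (Cmod w) - Re w)) with (ln (Cmod w) + (1 + - Re w)) by ring.
  rewrite (exp_plus (ln (Cmod w))), exp_ln; [reflexivity | now apply Cmod_gt_0].
Qed.

Lemma Cmod_saddle_weight (n : R) (w v : C) :
  Cmod (saddle_weight n w v) = exp (- Re (v * Clog w)%C) * exp (- (1 + height w) * n).
Proof.
  rewrite saddle_weight_Cexp, Cmod_Cexp, <- exp_plus. f_equal. unfold height, Clog, Re. simpl. ring.
Qed.

Lemma sq2pin_bounds (n : R) : 1 <= n -> sqrt n <= Cmod (sq2pin n) <= 3 * n.
Proof.
  intros Hn. unfold sq2pin. rewrite Cmod_RtoC_nonneg by apply sqrt_pos.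
  assert (H1 := PI2_1). assert (H4 := PI_4). unfold PI2 in H1.
  split; [apply sqrt_le_1_alt; nra | ].
  rewrite <- (sqrt_square (3 * n)) by lra. apply sqrt_le_1_alt. nra.
Qed.

Lemma is_O_saddle_linear (saddle : R -> C) (c : nat -> C) (N : nat) :
  is_O infty (fun n => saddle n - sq2pin n * Csum (fun r => c r / RtoC n ^ r) N)%C
    (fun n => sqrt n / n ^ N) ->
  is_O infty saddle (fun n => n ^ 1).
Proof.
  intros H.
  apply (is_O_ext (fun n => (saddle n - sq2pin n * Csum (fun r => c r / RtoC n ^ r) N)
    + sq2pin n * Csum (fun r => c r / RtoC n ^ r) N)%C).
  { apply filter_forall. intros n. ring. }
  apply is_O_plus.
  - apply (is_O_weaken 3) with (3 := H); [lra | ].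
    apply filter_imp with (2 := infty_ge 1). intros n Hn.
    assert (Hinv := inv_pow_le_1 N n Hn). assert (Hs := sqrt_ge_1 n Hn).
    assert (Hsn := sq2pin_bounds n Hn). rewrite pow_1. unfold Rdiv. nra.
  - apply (is_O_weaken 1) with (g := fun n => n ^ 1 * 1); [lra | | ].
    + apply filter_forall. intros n. lra.
    + apply is_O_mult; [ | apply is_O_series_bounded].
      exists 3. split; [lra | ]. apply filter_imp with (2 := infty_ge 1). intros n Hn.
      rewrite pow_1. now apply sq2pin_bounds.
Qed.

Lemma Sn_expansion_modwe_gt_1 (w v : C) (N : nat) :
  (0 < N)%nat -> 1 <= Re w -> 1 < modwe w ->
  is_O infty (fun n => Sn n w v - Csum (fun r => Ucoef r w v / RtoC n ^ r) N)%C (fun n => / n ^ N).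
Proof.
  intros HN Hw Hmod. assert (Hw0 : w <> 0%C) by (apply Re_pos_neq_0; lra).
  rewrite modwe_height in Hmod by exact Hw0.
  assert (Hheight : 0 < 1 + height w) by (apply exp_lt_inv; rewrite exp_0; exact Hmod).
  assert (Hw1 : w <> 1%C).
  { intros ->. unfold height in Hheight. rewrite Cmod_1, ln_1, re_RtoC in Hheight. lra. }
  destruct (Sn_expansion_Re_ge_1 w v N HN Hw Hw1) as [saddle [Hsaddle H]].
  assert (Hweight : negligible (fun n => saddle_weight n w v)).
  { apply (negligible_exp (1 + height w)); [exact Hheight | ].
    exists (exp (- Re (v * Clog w)%C)). split; [left; apply exp_pos | ].
    apply filter_forall. intros n. right. apply Cmod_saddle_weight. }
  apply (is_O_ext (fun n => (Sn n w v - saddle_weight n w v * saddle n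
    - Csum (fun r => Ucoef r w v / RtoC n ^ r) N) + saddle n * saddle_weight n w v)%C).
  { apply filter_forall. intros n. ring. }
  apply is_O_plus; [exact H | ].
  now apply (negligible_mult_l 1 saddle _ (is_O_saddle_linear _ _ _ Hsaddle)).
Qed.

Lemma saddle_weight_unit_modulus (n : R) (w v : C) :
  ln (Cmod w) = Re w - 1 ->
  saddle_weight n w v = (Cexp (RtoC n * Ci * RtoC (phi w)) / Ccpow w v)%C.
Proof.
  intros Hw. rewrite saddle_weight_Cexp. unfold Cdiv, Ccpow.
  rewrite <- Cexp_opp, <- Cexp_plus. f_equal.
  assert (E : Clog w = (RtoC (Re w - 1) + Ci * RtoC (Carg w))%C).
  { rewrite <- Hw. unfold Clog. apply injective_projections; simpl; ring. }
  rewrite E at 1. unfold phi. apply injective_projections; simpl; unfold Re, Im; ring.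
Qed.

Lemma Sn_expansion_T (w v : C) (N : nat) :
  (0 < N)%nat -> regT w ->
  is_O infty
    (fun n => Sn n w v - Csum (fun r => / RtoC n ^ r * (Ucoef r w v
       + gam r v * (Cexp (RtoC n * Ci * RtoC (phi w)) / Ccpow w v) * sq2pin n)) N)%C
    (fun n => sqrt n / n ^ N).
Proof.
  intros HN [Hmod Hw]. assert (Hw0 : w <> 0%C) by (apply Re_pos_neq_0; lra).
  rewrite modwe_height in Hmod by exact Hw0.
  assert (Hheight : 1 + height w = 0) by (apply exp_inv; rewrite exp_0; exact Hmod).
  assert (Hw1 : w <> 1%C) by (intros ->; rewrite re_RtoC in Hw; lra).
  destruct (Sn_expansion_Re_ge_1 w v N HN ltac:(lra) Hw1) as [saddle [Hsaddle H]].
  assert (Hweight : is_O infty (fun n => saddle_weight n w v) (fun _ => 1)).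
  { exists (exp (- Re (v * Clog w)%C)). split; [left; apply exp_pos | ].
    apply filter_forall. intros n. right.
    rewrite Cmod_saddle_weight, Hheight, Ropp_0, Rmult_0_l, exp_0. ring. }
  apply is_O_ext with (2 := is_O_plus _ _ _ (is_O_inv_pow_sqrt _ _ H)
    (is_O_mult_l _ _ _ Hweight Hsaddle)).
  apply filter_forall. intros n.
  rewrite <- saddle_weight_unit_modulus by (unfold height in Hheight; lra).
  rewrite (Csum_ext (fun r => / RtoC n ^ r * _)%C (fun r => Ucoef r w v / RtoC n ^ r
    + saddle_weight n w v * sq2pin n * (gam r v / RtoC n ^ r))%C) by (intros; unfold Cdiv; ring).
  rewrite Csum_plus, Csum_mult_l. ring.
Qed.

Lemma is_O_1_saddle_weight (w v : C) (N : nat) :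
  1 + height w < 0 ->
  is_O infty (fun _ => RtoC 1) (fun n => Cmod (sq2pin n * saddle_weight n w v)%C / n ^ N).
Proof.
  intros Hheight. set (c0 := exp (- Re (v * Clog w)%C)). assert (Hc0 : 0 < c0) by apply exp_pos.
  destruct (pow_le_exp N (- (1 + height w)) ltac:(lra)) as [K [HK H]].
  exists (K / c0). split; [left; now apply Rdiv_lt_0_compat | ].
  apply filter_imp with (2 := infty_ge 1). intros n Hn.
  assert (Hpow : 0 < n ^ N) by (apply pow_lt; lra).
  rewrite Cmod_1, Cmod_mult, Cmod_saddle_weight. fold c0. set (E := exp (- (1 + height w) * n)).
  assert (HE : n ^ N <= K * E) by (apply H; lra).
  assert (Hs : 1 <= Cmod (sq2pin n)).
  { apply Rle_trans with (1 := sqrt_ge_1 n Hn). now apply sq2pin_bounds. }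
  replace (K / c0 * (Cmod (sq2pin n) * (c0 * E) / n ^ N))
    with (Cmod (sq2pin n) * (K * E / n ^ N)) by (field; lra).
  rewrite <- (Rmult_1_l 1). apply Rmult_le_compat; try lra. apply Rle_div_r; lra.
Qed.

Lemma Sn_expansion_Z (w v : C) (N : nat) :
  (0 < N)%nat -> regZ w ->
  is_O infty
    (fun n => Sn n w v - sq2pin n / (wepow n w * Ccpow w v)
      * Csum (fun r => gam r v / RtoC n ^ r) N)%C
    (fun n => Cmod (sq2pin n / (wepow n w * Ccpow w v))%C / n ^ N).
Proof.
  intros HN [Hmod Hw]. assert (Hw0 : w <> 0%C) by (apply Re_pos_neq_0; lra).
  rewrite modwe_height in Hmod by exact Hw0.
  assert (Hheight : 1 + height w < 0) by (apply exp_lt_inv; rewrite exp_0; exact Hmod).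
  assert (Hw1 : w <> 1%C) by (intros ->; rewrite re_RtoC in Hw; lra).
  destruct (Sn_expansion_Re_ge_1 w v N HN ltac:(lra) Hw1) as [saddle [Hsaddle H]].
  change (fun n => Cmod (sq2pin n / _) / n ^ N)
    with (fun n => Cmod (sq2pin n * saddle_weight n w v)%C / n ^ N).
  assert (Hone := is_O_1_saddle_weight w v N Hheight).
  assert (Hweight : is_O infty (fun n => saddle_weight n w v)
    (fun n => Cmod (saddle_weight n w v))).
  { apply is_O_of_le, filter_forall. intros n. apply Rle_refl. }
  apply (is_O_ext (fun n => ((Sn n w v - saddle_weight n w v * saddle n
      - Csum (fun r => Ucoef r w v / RtoC n ^ r) N)
      + Csum (fun r => Ucoef r w v / RtoC n ^ r) N) * 1
    + saddle_weight n w v * (saddle n - sq2pin n * Csum (fun r => gam r v / RtoC n ^ r) N))%C).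
  { apply filter_forall. intros n. unfold saddle_weight, Cdiv. ring. }
  apply is_O_plus.
  - apply is_O_mult_l; [ | exact Hone]. apply is_O_plus; [ | apply is_O_series_bounded].
    apply (is_O_weaken 1) with (3 := H); [lra | ].
    apply filter_imp with (2 := infty_ge 1). intros n Hn. rewrite Rmult_1_r. now apply inv_pow_le_1.
  - apply (is_O_weaken 1) with (3 := is_O_mult _ _ _ _ Hweight Hsaddle); [lra | ].
    apply filter_imp with (2 := infty_ge 1). intros n Hn. rewrite Cmod_mult, Rmult_1_l.
    assert (0 <= / n ^ N) by (left; apply Rinv_0_lt_compat, pow_lt; lra).
    unfold Rdiv. rewrite <- Rmult_assoc. apply Rmult_le_compat_r; [assumption | ].
    rewrite Rmult_comm. apply Rmult_le_compat_r; [apply Cmod_ge_0 | now apply sq2pin_bounds].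
Qed.

Lemma Sn_expansion_1 (v : C) (N : nat) :
  (0 < N)%nat ->
  is_O infty
    (fun n => Sn n 1 v - Csum (fun r => / RtoC n ^ r * (rho r v + gam r v / RtoC 2 * sq2pin n)) N)%C
    (fun n => sqrt n / n ^ N).
Proof.
  intros HN. apply is_O_ext with (2 := left_half_saddle_contribution v N).
  apply filter_imp with (2 := infty_Re_plus_pos v). intros n Ha.
  rewrite Sn_laplace, incomplete_gamma_1, !Cmult_1_r by exact Ha.
  rewrite (Csum_ext (half_saddle_term v 1 n)
    (fun r => (rho r v + gam r v / RtoC 2 * sq2pin n - kdelta r) / RtoC n ^ r)%C).
  - rewrite (Csum_kdelta (fun r => rho r v + gam r v / RtoC 2 * sq2pin n)%C) by exact HN.
    rewrite (Csum_ext (fun r => / RtoC n ^ r * _)%C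
      (fun r => (rho r v + gam r v / RtoC 2 * sq2pin n) / RtoC n ^ r)%C)
        by (intros; unfold Cdiv; ring).
    ring.
  - intros r _. unfold half_saddle_term, Cdiv. ring.
Qed.

Lemma is_O_half_integer_pow_bound (f : R -> C) (N : nat) :
  is_O infty f (fun n => sqrt n / n ^ N) ->
  exists K M, forall n, M <= n -> Cmod (f n) <= K / Rpower n (INR N - / 2).
Proof.
  intros H. apply is_O_infty_bound. apply (is_O_weaken 1) with (3 := H); [lra | ].
  apply filter_imp with (2 := infty_ge 1). intros n Hn. right.
  unfold Rminus. rewrite Rpower_plus, Rpower_Ropp, Rpower_sqrt, Rpower_pow by lra.
  assert (Hs := sqrt_ge_1 n Hn). field. split; [lra | apply pow_nonzero; lra].
Qed.

Theorem theorem5p3 (v : C) (RR : nat) (HR : (1 <= RR)%nat) :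
  (exists K N : R, forall n : R, N <= n ->
     Cmod (Sn n 1 v -
           Csum (fun r => / (RtoC n ^ r) *
                   (rho r v + gam r v / RtoC 2 * sq2pin n))%C RR)%C
     <= K / Rpower n (INR RR - / 2))
  /\
  (forall w : C, regX w \/ regY w \/ regS w ->
   exists K N : R, forall n : R, N <= n ->
     Cmod (Sn n w v - Csum (fun r => Ucoef r w v / (RtoC n ^ r))%C RR)%C
     <= K / n ^ RR)
  /\
  (forall w : C, regT w ->
   exists K N : R, forall n : R, N <= n ->
     Cmod (Sn n w v -
           Csum (fun r => / (RtoC n ^ r) *
                   (Ucoef r w v +
                    gam r v * (Cexp (RtoC n * Ci * RtoC (phi w)) / Ccpow w v)
                    * sq2pin n))%C RR)%C
     <= K / Rpower n (INR RR - / 2))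
  /\
  (forall w : C, regZ w ->
   exists K N : R, forall n : R, N <= n ->
     Cmod (Sn n w v -
           sq2pin n / (wepow n w * Ccpow w v) *
           Csum (fun r => gam r v / (RtoC n ^ r))%C RR)%C
     <= Cmod (sq2pin n / (wepow n w * Ccpow w v))%C * (K / n ^ RR)).
Proof.
  split; [ | split; [ | split]].
  - now apply is_O_half_integer_pow_bound, Sn_expansion_1.
  - intros w Hw. apply is_O_infty_bound. destruct (Rlt_dec (Re w) 1) as [Hw1 | Hw1].
    + now apply Sn_expansion_Re_lt_1.
    + apply Sn_expansion_modwe_gt_1; [exact HR | lra | ].
      destruct Hw as [HX | [[_ HY] | [_ HS]]]; [exact HX | lra | lra].
  - intros w Hw. now apply is_O_half_integer_pow_bound, Sn_expansion_T.
  - intros w Hw. destruct (is_O_infty_bound _ _ (Sn_expansion_Z w v RR HR Hw)) as [K [N H]].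
    exists K, N. intros n Hn. apply Rle_trans with (1 := H n Hn). right. unfold Rdiv. ring.
Qed.
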